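(* Let $\Gamma$ be a simple graph with $n$ edges and vertex-connectivity $\geq 2$. Then for all prime powers $q$: (i) $\bar N(\Psi_\Gamma)=q^{n-1}+O(q^{n-3})$ (with implied constant depending only on $\Gamma$), and $\bar N(\Psi_\Gamma)\equiv 0 \pmod{q^2}$. (ii) Suppose $\Gamma$ has a $3$-valent vertex $v$ whose incident edges are labelled $1,2,3$ (other edges $4,\dots,n$). Then $$\bar N(\Psi_\Gamma)=q^3\,\bar N(\Psi_{\Gamma-123},\Psi_{\Gamma-1/23},\Psi_{\Gamma-2/13},\Psi_{\Gamma/123})-q^2\,\bar N(\Psi_{\Gamma-123},\Psi_{\Gamma-1/23},\Psi_{\Gamma-2/13}),$$ both counts taken in $\mathbb{P}\mathbb{F}_q^{n-4}$ (variables $x_4,\dots,x_n$). Moreover, the polynomial $$\Delta=\tfrac12\big(\Psi_{\Gamma-1/23}+\Psi_{\Gamma-2/13}-\Psi_{\Gamma-3/12}\big)$$ lies in $\mathbb{Z}[x_4,\dots,x_n]$, and with $\Delta_{12}=\Psi_{\Gamma-123}\,x_3+\Delta$ one has $$\bar N(\Psi_\Gamma)=q\,\bar N(\Psi_{\Gamma/3})_{\mathbb{P}\mathbb{F}_q^{n-2}}+q\,\bar N(\Delta_{12})_{\mathbb{P}\mathbb{F}_q^{n-3}}-q^2\,\bar N(\Delta)_{\mathbb{P}\mathbb{F}_q^{n-4}},$$ where $\Psi_{\Gamma/3}$ is in the variables $x_1,x_2,x_4,\dots,x_n$, $\Delta_{12}$ in $x_3,\dots,x_n$, $\Delta$ in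 $x_4,\dots,x_n$. In particular $$\bar N(\Psi_\Gamma)\equiv q\,\bar N(\Delta_{12})_{\mathbb{P}\mathbb{F}_q^{n-3}}\equiv q^2\,\bar N(\Psi_{\Gamma-123},\Delta)_{\mathbb{P}\mathbb{F}_q^{n-4}}\pmod{q^3}.$$ (iii) If, in addition to (ii), there is an edge $4$ such that edges $2,3,4$ form a triangle, then $$\delta=\tfrac12\big(\Psi_{\Gamma-123/4}+\Psi_{\Gamma-24/13}-\Psi_{\Gamma-34/12}\big)\in\mathbb{Z}[x_5,\dots,x_n]$$ and \begin{align*} \bar N(\Psi_\Gamma)={}&q(q-2)\,\bar N(\Psi_{\Gamma-2/3})_{\mathbb{P}\mathbb{F}_q^{n-3}} +q(q-1)\big[\bar N(\Psi_{\Gamma-123})+\bar N(\Psi_{\Gamma-24/3})\big]_{\mathbb{P}\mathbb{F}_q^{n-4}} +q^2\,\bar N(\Psi_{\Gamma-2/34})_{\mathbb{P}\mathbb{F}_q^{n-4}}\\ &+q^2\big[\bar N(\Psi_{\Gamma-1234})+\bar N(\Psi_{\Gamma-123/4})-\bar N(\Psi_{\Gamma-1234},\delta)-\bar N(\Psi_{\Gamma-123/4},\delta)-(q-2)\bar N(\delta)\big]_{\mathbb{P}\mathbb{F}_q^{n-5}}. \end{align*}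
   Context: For a connected graph $G$ (multiple edges and loops allowed) with variable $x_e$ for each edge $e$, the graph polynomial is $\Psi_G=\sum_T\prod_{e\notin T}x_e$, summed over spanning trees $T$ of $G$; it is homogeneous of degree $h_1(G)$ (number of independent cycles) and linear in each variable. The edges of $\Gamma$ are labelled $1,\dots,n$ with variables $x_1,\dots,x_n$. For edge sets $A,B$, $\Gamma-A/B$ denotes $\Gamma$ with the edges in $A$ deleted and the edges in $B$ contracted (contraction keeps multiple edges); e.g. $\Gamma-1/23$ has edge 1 removed and edges 2,3 contracted, $\Gamma/123$ has edges 1,2,3 contracted, $\Gamma-123$ has them deleted. The graph polynomial of a minor is a polynomial in the variables of its remaining edges. For homogeneous $f_1,\dots,f_m\in\mathbb{Z}[y_1,\dots,y_N]$, $\bar N(f_1,\dots,f_m)_{\mathbb{P}\mathbb{F}_q^{N-1}}$ is the number of points of $\mathbb{P}^{N-1}(\mathbb{F}_q)$ (coordinates $y_1,\dots,y_N$) at which at least one $f_i$ is nonzero; equivalently $(q^N-N(f_1,\dots,f_m))/(q-1)$ with $N(\cdot)$ the number of common zeros in $\mathbb{F}_q^N$. When no subscript is given, the projective space is the one on the variables indicated (for $\Psi_\Gamma$, all $n$ edge variables, i.e. $\mathbb{P}\mathbb{F}_q^{n-1}$). Congruences are congruences of integers.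
   Formalization: N̄ is taken as (q^N − N)/(q−1), which differs from the point count if some f_i is a nonzero constant (e.g. Ψ_{Γ−123}=1 when Γ−v is a tree); as it may then be non-integral, the last congruence of (ii) is stated in Z localized at integers prime to q. *)

(* Defs.v *)
From HB Require Import structures.
From mathcomp Require Import all_boot all_order all_algebra.
From mathcomp Require Import mpoly.

Set Implicit Arguments.
Unset Strict Implicit.
Unset Printing Implicit Defensive.

Import Order.TTheory GRing.Theory Num.Theory.
Local Open Scope ring_scope.

(* A finite multigraph (loops and multiple edges allowed) whose vertices are
   taken in V and whose edges are labelled in 'I_n.  Minors keep the ambient
   types, so that a remaining edge keeps its label, hence its variable. The
   order of the two components of [ends e] is irrelevant. *)
Record mgraph (V : finType) (n : nat) := MGraph {
  verts : {set V};
  edges : {set 'I_n};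
  ends : 'I_n -> V * V
}.

Definition whole_graph (V : finType) (n : nat) (ends : 'I_n -> V * V) :
  mgraph V n := MGraph [set: V] [set: 'I_n] ends.

Section Graphs.
Variables (V : finType) (n : nat).
Implicit Types (G : mgraph V n) (A B T : {set 'I_n}) (e f g : 'I_n).

Definition endset G e : {set V} := [set (ends G e).1; (ends G e).2].

Definition joined G B : rel V :=
  [rel x y | [exists e in B, (ends G e == (x, y)) || (ends G e == (y, x))]].

Definition spans G T : bool :=
  (verts G != set0) && [forall x in verts G, forall y in verts G,
                          connect (joined G T) x y].

Definition connected_graph G : bool := spans G (edges G).

(* No edge of T lies on a cycle of T; this excludes loops and parallel edges. *)
Definition acyclic G T : bool :=
  [forall e in T, ~~ connect (joined G (T :\ e)) (ends G e).1 (ends G e).2].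

Definition spanning_tree G T : bool :=
  [&& T \subset edges G, spans G T & acyclic G T].

(* A disconnected graph has no spanning tree, so its polynomial is 0. *)
Definition graph_poly G : {mpoly int[n]} :=
  \sum_(T : {set 'I_n} | spanning_tree G T) \prod_(e in edges G :\: T) 'X_e.

Definition delete_edges A G : mgraph V n :=
  MGraph (verts G) (edges G :\: A) (ends G).

(* Every vertex is replaced by a chosen representative of its component in the
   graph formed by the contracted edges. *)
Definition contract_edges B G : mgraph V n :=
  let rep := fingraph.root (joined G (B :&: edges G)) in
  MGraph (rep @: verts G) (edges G :\: B)
         (fun e => (rep (ends G e).1, rep (ends G e).2)).

Definition minor G A B : mgraph V n := contract_edges B (delete_edges A G).

Definition delete_verts (W : {set V}) G : mgraph V n :=
  MGraph (verts G :\: W) [set e in edges G | [disjoint endset G e & W]] (ends G).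

Definition simple_graph G : Prop :=
  (forall e, e \in edges G -> (ends G e).1 != (ends G e).2) /\
  (forall e f, e \in edges G -> f \in edges G ->
     endset G e = endset G f -> e = f).

(* vertex-connectivity >= k *)
Definition vertex_connected (k : nat) G : Prop :=
  (k < #|verts G|)%N /\
  (forall W : {set V}, W \subset verts G -> (#|W| < k)%N ->
     connected_graph (delete_verts W G)).

Definition incident G (v : V) : {set 'I_n} := [set e in edges G | v \in endset G e].

(* For a graph without loops at v. *)
Definition three_valent G (v : V) e f g : Prop :=
  uniq [:: e; f; g] /\ incident G v = [set e; f; g].

Definition triangle G e f g : Prop :=
  [/\ e \in edges G, f \in edges G & g \in edges G] /\
  exists x y z : V, uniq [:: x; y; z] /\
    [/\ endset G e = [set x; y], endset G f = [set y; z]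
      & endset G g = [set z; x]].

(* p lies in Z[x_i, i \in S]. *)
Definition in_vars (S : {set 'I_n}) (p : {mpoly int[n]}) : Prop :=
  forall m, m \in msupp p -> forall i, m i != 0%N -> i \in S.

End Graphs.

Section Counting.
Variables (F : finFieldType) (n : nat).
Implicit Types (S : {set 'I_n}) (fs : seq {mpoly int[n]}) (x : 'rV[F]_n).

Definition eval_at (p : {mpoly int[n]}) x : F :=
  (map_mpoly (intr : int -> F) p).@[fun i => x 0 i].

(* The affine space F^S, as the coordinate subspace of F^n. *)
Definition affine S : {set 'rV[F]_n} :=
  [set x : 'rV[F]_n | [forall i, (i \notin S) ==> (x 0 i == 0)]].

Definition nb_zeros S fs : nat :=
  #|[set x in affine S | all (fun p => eval_at p x == 0) fs]|.

(* The number of points, at which some member of fs does not vanish, of the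
   projective space over F with coordinates x_i, i \in S.  If some member of fs
   is a nonzero constant, the division need not be exact: the affine origin is
   then counted with weight 1/(q-1).  This is the convention under which
   counts for a trivalent vertex v remain valid when G - v is a tree.  In all
   other cases see [NbarE]. *)
Definition Nbar S fs : rat :=
  (#|F|%:R ^+ #|S| - (nb_zeros S fs)%:R) / (#|F|%:R - 1).

Definition proj_point x : {set 'rV[F]_n} := [set c *: x | c : F & c != 0].

Definition proj_nonzeros S fs : {set {set 'rV[F]_n}} :=
  [set proj_point x | x in affine S
                    & (x != 0) && has (fun p => eval_at p x != 0) fs].

End Counting.

Definition congr_int (m : nat) (a b : rat) : Prop :=
  exists z : int, a - b = (m%:Z * z)%:~R.

(* Congruence modulo m between rationals, in the localization of Z at the
   integers prime to m; see [congr_locE]. *)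
Definition congr_loc (m : nat) (a b : rat) : Prop :=
  exists (k : nat) (z : int), coprime k m /\ k%:R * (a - b) = (m%:Z * z)%:~R.

Lemma congr_locE (m : nat) (a b : int) :
  congr_loc m a%:~R b%:~R <-> congr_int m a%:~R b%:~R.
Proof.
split=> [[k [z [cokm E]]]|[z E]]; last first.
  by exists 1%N, z; rewrite coprime1n mul1r.
have {}E : k%:Z * (a - b) = m%:Z * z.
  by apply: (@intr_inj rat); rewrite -E rmorphM rmorphB.
have : (m%:Z %| k%:Z * (a - b))%Z by rewrite E dvdz_mulr.
rewrite Gauss_dvdzr; last by rewrite coprimezE /= coprime_sym.
by case/dvdzP=> w Ew; exists w; rewrite -rmorphB Ew mulrC.
Qed.

Section Points.
Variables (F : finFieldType) (n : nat).
Implicit Types (S : {set 'I_n}) (fs : seq {mpoly int[n]}) (x y : 'rV[F]_n).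

Lemma eval_homog d (p : {mpoly int[n]}) (c : F) x :
  p \is d.-homog -> eval_at p (c *: x) = c ^+ d * eval_at p x.
Proof.
move=> /dhomogP hp; rewrite /eval_at /map_mpoly /mmap !raddf_sum mulr_sumr.
rewrite big_seq [RHS]big_seq; apply: eq_bigr => m /hp hm /=.
rewrite !mevalM !mevalC /mmap1 !rmorph_prod /= mulrCA; congr (_ * _).
have -> : d = (\sum_i (m : 'X_{1.. n}) i)%N by rewrite -mdegE; apply/esym.
rewrite -prodrXr -big_split; apply: eq_bigr => i _ /=.
by rewrite !rmorphXn /= !mevalXU mxE exprMn.
Qed.

Lemma NbarE S fs :
  (forall p, p \in fs -> exists2 d, (0 < d)%N & p \is d.-homog) ->
  Nbar F S fs = #|proj_nonzeros F S fs|%:R.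
Proof.
move=> hom.
pose nz x := has (fun p => eval_at p x != 0) fs.
pose A := [set x in affine F S | (x != 0) && nz x].
have nz0 : nz 0 = false.
  apply/negbTE/hasPn => p /hom[d d0 hp]; rewrite negbK.
  by rewrite -(scale0r 0) (eval_homog _ _ hp) expr0n gtn_eqF // mul0r.
have cardS : #|affine F S| = (#|F| ^ #|S|)%N.
  pose ext (h : {ffun 'I_n -> F}) : 'rV[F]_n := \row_i h i.
  have -> : affine F S = ext @: [set h | h \in pffun_on 0 S F].
    apply/setP=> x; rewrite inE; apply/forallP/imsetP=> [hx|[h]].
      exists [ffun i => x 0 i]; last by apply/rowP=> i; rewrite mxE ffunE.
      rewrite inE; apply/pffun_onP; split=> //.
      apply/subsetP=> i; rewrite !inE ffunE; apply: contraNT => iS.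
      by have := hx i; rewrite iS.
    rewrite inE => /pffun_onP[/subsetP hs _] -> i; apply/implyP=> iS.
    by rewrite mxE; apply: contraNT iS => hi; apply: hs; rewrite inE.
  rewrite card_imset; last first.
    by move=> h k /rowP E; apply/ffunP=> i; have := E i; rewrite !mxE.
  by rewrite cardsE card_pffun_on.
have q1 : (1 < #|F|)%N by rewrite (cardD1 (0:F)) (cardD1 (1:F)) !inE oner_neq0.
have cardA : (#|A| + nb_zeros F S fs = #|F| ^ #|S|)%N.
  rewrite -cardS -(cardsID [set x | nz x] (affine F S)); congr (_ + _)%N.
    apply: eq_card => x; rewrite !inE; congr (_ && _).
    by case: eqP => // ->; rewrite nz0.
  apply: eq_card => x; rewrite !inE /nz -all_predC andbC; congr (_ && _).
  by apply: eq_all => p; rewrite /= negbK.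
have sA c x : c != 0 -> x \in A -> c *: x \in A.
  move=> c0; rewrite !inE => /and3P[/forallP xS x0 /hasP[p pfs px]].
  apply/and3P; split.
  - apply/forallP=> i; apply/implyP=> iS; have := xS i.
    by rewrite iS mxE => /eqP ->; rewrite mulr0.
  - by rewrite scaler_eq0 negb_or c0.
  - apply/hasP; exists p => //; have [d _ hp] := hom p pfs.
    by rewrite (eval_homog _ _ hp) mulf_neq0 ?expf_neq0.
have self x : x \in proj_point x.
  by apply/imsetP; exists 1; rewrite ?inE ?oner_neq0 // scale1r.
have cl x y : y \in proj_point x -> proj_point y = proj_point x.
  case/imsetP=> c; rewrite inE => c0 ->; apply/setP=> z.
  apply/imsetP/imsetP=> -[d]; rewrite inE => d0 ->.
    by exists (d * c); rewrite ?inE ?mulf_neq0 // scalerA.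
  exists (d / c); rewrite ?inE ?mulf_neq0 ?invr_eq0 //.
  by rewrite scalerA divfK.
have partA : partition (proj_nonzeros F S fs) A.
  apply/and3P; split.
  - apply/eqP/setP=> x; apply/bigcupP/idP=> [[B /imsetP[y yA ->]]|xA].
      by case/imsetP=> c; rewrite inE => c0 ->; apply: sA => //; rewrite inE.
    by exists (proj_point x) => //; apply/imset_f; move: xA; rewrite inE.
  - apply/trivIsetP=> _ _ /imsetP[x _ ->] /imsetP[y _ ->] ne.
    rewrite -setI_eq0; apply: contraNT ne => /set0Pn[z /setIP[zx zy]].
    by rewrite -(cl _ _ zx) (cl _ _ zy).
  - by apply/imsetP=> -[x _ E]; have := self x; rewrite -E inE.
have : #|A| = (#|proj_nonzeros F S fs| * #|F|.-1)%N.
  apply: card_uniform_partition partA => _ /imsetP[x + ->].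
  rewrite inE => /and3P[_ x0 _]; rewrite card_imset; last first.
    move=> c d /eqP; rewrite -subr_eq0 -scalerBl scaler_eq0 (negPf x0) orbF.
    by rewrite subr_eq0 => /eqP.
  by rewrite -(cardC1 (0 : F)); apply: eq_card => c; rewrite !inE.
move=> cA; rewrite /Nbar -natrX -cardA natrD addrK cA natrM.
have -> : #|F|%:R - 1 = (#|F|.-1)%:R :> rat.
  by rewrite -[in LHS](prednK (ltnW q1)) -natr1 addrK.
by rewrite mulfK // pnatr_eq0 -lt0n -ltnS prednK // ltnW.
Qed.

End Points.

(* Main.v *)
(* By the matrix-tree theorem, Psi is up to sign the determinant of the symmetric
   matrix [D, B; B^T, 0], where D is the diagonal matrix of the variables and B the
   incidence matrix with one vertex dropped.  By the Desnanot-Jacobi identity,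
   Psi_{-i/j} Psi_{-j/i} - Psi_{-ij} Psi_{/ij} is then the square of an off-diagonal
   minor M_ij, and everything is counted along lines, on which Psi is affine.
   For a 3-valent vertex the row of that vertex gives linear relations between the
   minors of its three edges, so that +-M_12 is half of Psi_{-1} + Psi_{-2} - Psi_{-3};
   this is Delta_12, and (ii) and (iii) reduce to counts of points in F_q^3 and F_q^4
   for fixed values of the other variables.
   Modulo q, the number of nonzeros of a polynomial that is affine in each variable is
   determined by its top coefficient.  Applied to M_ij, which has no top coefficient
   when there are enough vertices, this gives the congruence modulo q^2 in (i).
   Finally Psi has q^(n-1) + O(q^(n-2)) zeros because M_kj does not vanish identically
   when k and j share a vertex v: a spanning tree of the graph without v, together
   with either of k and j, is a spanning tree. *)
Require Import Defs.
From mathcomp Require Import all_boot all_order all_algebra.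
From mathcomp Require Import mpoly ring lra zify.
Import Order.TTheory GRing.Theory Num.Theory.
Local Open Scope ring_scope.

Set Implicit Arguments.
Unset Strict Implicit.
Unset Printing Implicit Defensive.

(** * Determinants *)

Section Cofactors.
Variable R : comNzRingType.
Implicit Types (m : nat).

Lemma cofactor_eq m (M N : 'M[R]_m) a b :
  (forall i j, i != a -> j != b -> M i j = N i j) ->
  cofactor M a b = cofactor N a b.
Proof.
move=> E; rewrite /cofactor; congr (_ * \det _).
by apply/matrixP=> i j; rewrite !mxE E // eq_sym neq_lift.
Qed.

Lemma det_delta_row m (M : 'M[R]_m) a b :
  (forall j, M a j = (j == b)%:R) -> \det M = cofactor M a b.
Proof.
move=> E; rewrite (expand_det_row M a) (bigD1 b) //= big1 => [|j jb].
  by rewrite addr0 E eqxx mul1r.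
by rewrite E (negPf jb) mul0r.
Qed.

Lemma det_delta_col m (M : 'M[R]_m) a b :
  (forall i, M i b = (i == a)%:R) -> \det M = cofactor M a b.
Proof.
move=> E; rewrite (expand_det_col M b) (bigD1 a) //= big1 => [|j jb].
  by rewrite addr0 E eqxx mul1r.
by rewrite E (negPf jb) mul0r.
Qed.

Lemma det_entry m (M M' : 'M[R]_m) e :
    (forall i j, (i, j) != (e, e) -> M i j = M' i j) -> M' e e = 0 ->
  \det M = M e e * cofactor M e e + \det M'.
Proof.
move=> E E0; rewrite (expand_det_row M e) (expand_det_row M' e).
rewrite (bigD1 e) //= [in RHS](bigD1 e) //= E0 mul0r add0r; congr (_ + _).
apply: eq_bigr => j je; rewrite E; last by rewrite xpair_eqE negb_and je orbT.
congr (_ * _); apply: cofactor_eq => i k ie _.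
by rewrite E // xpair_eqE negb_and ie.
Qed.

Definition set_row_delta m (M : 'M[R]_m) a b : 'M[R]_m :=
  \matrix_(i, j) if i == a then (j == b)%:R else M i j.

Lemma cofactorE m (M : 'M[R]_m) a b : cofactor M a b = \det (set_row_delta M a b).
Proof.
rewrite (@det_delta_row _ _ a b) => [|j]; last by rewrite mxE eqxx.
by apply: cofactor_eq => i j ia _; rewrite mxE (negPf ia).
Qed.

(* The entry in position (e, e) is the variable: deleting e means replacing
   row e and column e by those of the identity matrix. *)
Lemma cofactor_entry m (M M' D : 'M[R]_m) a b e :
    e != a -> e != b ->
    (forall i j, (i, j) != (e, e) -> M i j = M' i j) -> M' e e = 0 ->
    (forall i j, i != e -> j != e -> M i j = D i j) ->
    (forall j, D e j = (j == e)%:R) ->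
  cofactor M a b = M e e * cofactor D a b + cofactor M' a b.
Proof.
move=> ea eb EM E0 ED De; rewrite !cofactorE (@det_entry _ _ (set_row_delta M' a b) e).
- congr (_ * _ + _); first by rewrite mxE (negPf ea).
  rewrite (@det_delta_row _ (set_row_delta D a b) e e).
    by apply: cofactor_eq => i j ie je; rewrite !mxE; case: eqP => // _; apply: ED.
  by move=> j; rewrite mxE (negPf ea).
- by move=> i j ij; rewrite !mxE EM.
- by rewrite mxE (negPf ea).
Qed.

Lemma det_1mul m k (U : 'M[R]_(m, k)) (W : 'M[R]_(k, m)) :
  \det (1%:M + U *m W) = \det (1%:M + W *m U).
Proof.
have E1 : block_mx 1%:M U 0 1%:M *m block_mx 1%:M (- U) W 1%:M =
    block_mx (1%:M + U *m W) 0 W 1%:M.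
  by rewrite mulmx_block !mul1mx !mul0mx !add0r ?mulmx1 addNr.
have E2 : block_mx 1%:M 0 (- W) 1%:M *m block_mx 1%:M (- U) W 1%:M =
    block_mx 1%:M (- U) 0 (1%:M + W *m U).
  rewrite mulmx_block !mul1mx !mul0mx !addr0 !mulmx1 addNr mulNmx mulmxN opprK.
  by rewrite addrC.
have := congr1 determinant E1; rewrite det_mulmx det_ublock det_lblock !det1.
have := congr1 determinant E2; rewrite det_mulmx det_ublock det_lblock !det1.
by rewrite !mul1r ?mulr1 => -> ->.
Qed.

Lemma det_two_cols m (P : 'M[R]_m) a b : a != b ->
    (forall i j, j != a -> j != b -> P i j = (i == j)%:R) ->
  \det P = P a a * P b b - P a b * P b a.
Proof.
move=> ab E.
pose s (k : 'I_2) := if k == ord0 then a else b.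
pose U : 'M[R]_(m, 2) := \matrix_(i, k) (P i (s k) - (i == s k)%:R).
pose W : 'M[R]_(2, m) := \matrix_(k, j) (j == s k)%:R.
have -> : P = 1%:M + U *m W.
  apply/matrixP=> i j; rewrite !mxE big_ord_recl big_ord1 !mxE /s /=.
  case: (eqVneq j a) => [->|ja]; first by rewrite (negPf ab) mulr1 mulr0 addr0 addrC subrK.
  case: (eqVneq j b) => [->|jb]; first by rewrite mulr1 mulr0 add0r addrC subrK.
  by rewrite !mulr0 !addr0 E.
rewrite det_1mul.
have -> : 1%:M + W *m U = \matrix_(i < 2, k < 2) P (s i) (s k).
  apply/matrixP=> i k; rewrite !mxE (bigD1 (s i)) //= big1 => [|j ji]; last first.
    by rewrite !mxE (negPf ji) mul0r.
  rewrite !mxE eqxx mul1r addr0 (_ : (s i == s k) = (i == k)).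
    by rewrite addrC subrK.
  rewrite /s -!val_eqE; move: i k => [[|[|//]] ?] [[|[|//]] ?] /=; rewrite ?eqxx //.
    exact: negPf.
  by rewrite eq_sym; apply: negPf.
have HP i j : (1%:M + U *m W) i j = P i j.
  rewrite !mxE big_ord_recl big_ord1 !mxE /s /=.
  case: (eqVneq j a) => [->|ja]; first by rewrite (negPf ab) mulr1 mulr0 addr0 addrC subrK.
  case: (eqVneq j b) => [->|jb]; first by rewrite mulr1 mulr0 add0r addrC subrK.
  by rewrite !mulr0 !addr0 E.
rewrite !HP (expand_det_row _ ord0) big_ord_recl big_ord1 /cofactor !det_mx11 !mxE /s /=.
by rewrite expr0 expr1 mul1r mulN1r mulrN.
Qed.

(* Desnanot-Jacobi: multiply M by the matrix obtained from the identity by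
   replacing columns a and b by those of the adjugate. *)
Lemma dodgson_lreg m (M D : 'M[R]_m) a b : a != b -> GRing.lreg (\det M) ->
    (forall i j, i != a -> i != b -> j != a -> j != b -> D i j = M i j) ->
    (forall i, D i a = (i == a)%:R) -> (forall i, D i b = (i == b)%:R) ->
    (forall j, D a j = (j == a)%:R) -> (forall j, D b j = (j == b)%:R) ->
  \det M * \det D = cofactor M a a * cofactor M b b - cofactor M a b * cofactor M b a.
Proof.
move=> ab reg ED Da Db aD bD.
pose P := \matrix_(i, j) (if (j == a) || (j == b) then (\adj M) i j else (i == j)%:R).
pose K := \matrix_(i, j) (if (j == a) || (j == b) then (i == j)%:R else M i j).
pose d := \row_j (if (j == a) || (j == b) then \det M else 1).
have MP : M *m P = K *m diag_mx d.
  apply/matrixP=> i j; rewrite mul_mx_diag !mxE; case: ifP => jab.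
    transitivity ((M *m \adj M) i j); last by rewrite mul_mx_adj mxE mulr_natl.
    by rewrite [RHS]mxE; apply: eq_bigr => k _; rewrite [P k j]mxE jab.
  rewrite mulr1 (bigD1 j) //= big1 => [|k kj]; first by rewrite !mxE jab eqxx mulr1 addr0.
  by rewrite !mxE jab (negPf kj) mulr0.
have detd : \det (diag_mx d) = \det M * \det M.
  rewrite det_diag (bigD1 a) //= (bigD1 b) 1?eq_sym //= !mxE !eqxx orbT /=.
  by rewrite big1 ?mulr1 // => j /andP[ja jb]; rewrite mxE (negPf ja) (negPf jb).
pose K' := \matrix_(i, j) (if i == a then (j == a)%:R else K i j).
have detK : \det K = \det D.
  transitivity (\det K').
    rewrite (@det_delta_col _ K a a) => [|i]; last by rewrite mxE eqxx.
    rewrite (@det_delta_row _ K' a a) => [|i]; last by rewrite mxE eqxx.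
    by apply: cofactor_eq => i j ia ja; rewrite [RHS]mxE (negPf ia).
  rewrite (@det_delta_col _ K' b b) => [|i]; last first.
    by rewrite !mxE eqxx orbT; case: eqP => // ->; rewrite eq_sym.
  rewrite (@det_delta_row _ D b b) //; apply: cofactor_eq => i j ib jb.
  rewrite !mxE; case: (eqVneq i a) => [->|ia]; first by rewrite aD.
  by case: (eqVneq j a) => [->|ja]; rewrite ?Da //= (negPf jb) ED.
have := congr1 determinant MP; rewrite !det_mulmx detd detK.
rewrite [\det P](det_two_cols ab); last first.
  by move=> i j ja jb; rewrite mxE (negPf ja) (negPf jb).
rewrite !mxE !eqxx !orbT /= => E; apply: reg; rewrite mulrA mulrC -E.
by congr (_ * (_ - _)); apply: mulrC.
Qed.
End Cofactors.

Section Dodgson.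
Variable R : comNzRingType.

Lemma dodgson m (M D : 'M[R]_m) a b : a != b ->
    (forall i j, i != a -> i != b -> j != a -> j != b -> D i j = M i j) ->
    (forall i, D i a = (i == a)%:R) -> (forall i, D i b = (i == b)%:R) ->
    (forall j, D a j = (j == a)%:R) -> (forall j, D b j = (j == b)%:R) ->
  \det M * \det D = cofactor M a a * cofactor M b b - cofactor M a b * cofactor M b a.
Proof.
move=> ab ED Da Db aD bD.
pose X := char_poly_mx (- M).
pose Y := \matrix_(i, j) if [|| i == a, i == b, j == a | j == b] then (i == j)%:R else X i j.
pose ev : {rmorphism {poly R} -> R} := horner_eval 0.
have evX : map_mx ev X = M.
  apply/matrixP=> i j; rewrite !mxE /= /horner_eval hornerD hornerN hornerC.
  by rewrite hornerMn hornerX mul0rn add0r opprK.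
have evY : map_mx ev Y = D.
  apply/matrixP=> i j; rewrite mxE [Y i j]mxE.
  case: (eqVneq i a) => [->|ia]; first by rewrite aD rmorph_nat eq_sym.
  case: (eqVneq i b) => [->|ib]; first by rewrite bD rmorph_nat eq_sym.
  case: (eqVneq j a) => [->|ja]; first by rewrite Da rmorph_nat (negPf ia).
  case: (eqVneq j b) => [->|jb]; first by rewrite Db rmorph_nat (negPf ib).
  by rewrite /= ED // -[in RHS]evX [in RHS]mxE.
have reg : GRing.lreg (\det X) by apply: monic_lreg; apply: char_poly_monic.
have cE c d : ev (cofactor X c d) = cofactor M c d by rewrite -cofactor_map_mx evX.
have dX : ev (\det X) = \det M by rewrite -det_map_mx evX.
have dY : ev (\det Y) = \det D by rewrite -det_map_mx evY.
rewrite -dX -dY -!cE -!rmorphM -rmorphB; congr (ev _); apply: dodgson_lreg => //.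
- by move=> i j /negPf ia /negPf ib /negPf ja /negPf jb; rewrite mxE ia ib ja jb.
- by move=> i; rewrite mxE eqxx !orbT.
- by move=> i; rewrite mxE eqxx !orbT.
- by move=> i; rewrite mxE eqxx /= eq_sym.
- by move=> i; rewrite mxE eqxx !orbT /= eq_sym.
Qed.

End Dodgson.

(** * Connectivity and minors *)

Lemma connect_map (V W : finType) (e : rel V) (e' : rel W) (f : V -> W) :
  (forall a b, e a b -> connect e' (f a) (f b)) ->
  forall x y, connect e x y -> connect e' (f x) (f y).
Proof.
move=> H x y /connectP[p]; elim: p x => [|z p IH] x /=; first by move=> _ ->.
by case/andP=> /H xz /IH{}IH /IH; apply: connect_trans.
Qed.

Section Connectivity.
Variables (V : finType) (n : nat).
Implicit Types (G : mgraph V n) (A B T X Y : {set 'I_n}) (e f : 'I_n).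

Lemma joinedP G B x y :
  reflect (exists2 e, e \in B & ends G e = (x, y) \/ ends G e = (y, x)) (joined G B x y).
Proof.
apply: (iffP existsP) => -[e].
  by case/andP=> eB /orP[] /eqP E; exists e => //; [left|right].
by move=> eB E; exists e; rewrite eB; case: E => ->; rewrite eqxx ?orbT.
Qed.

Lemma joined_ends G B e : e \in B -> joined G B (ends G e).1 (ends G e).2.
Proof. by move=> eB; apply/joinedP; exists e => //; left; case: (ends G e). Qed.

Lemma joined_csym G B : connect_sym (joined G B).
Proof.
apply: sym_connect_sym => x y.
by apply/joinedP/joinedP=> -[e eB E]; exists e => //; case: E; [right|left|right|left].
Qed.

Lemma connect_joined_sub G X Y :
  (forall e, e \in X -> connect (joined G Y) (ends G e).1 (ends G e).2) ->
  subrel (connect (joined G X)) (connect (joined G Y)).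
Proof.
move=> H; apply: connect_sub => x y /joinedP[e /H + E].
by case: E => -> //=; rewrite joined_csym.
Qed.

Lemma connect_joinedS G X Y : X \subset Y ->
  subrel (connect (joined G X)) (connect (joined G Y)).
Proof.
by move=> /subsetP XY; apply: connect_joined_sub => e /XY eY; apply/connect1/joined_ends.
Qed.

Lemma connect_joinedU1 G X e x y : connect (joined G (e |: X)) x y ->
  [\/ connect (joined G X) x y,
      connect (joined G X) x (ends G e).1 /\ connect (joined G X) (ends G e).2 y |
      connect (joined G X) x (ends G e).2 /\ connect (joined G X) (ends G e).1 y].
Proof.
move=> /connectP[p]; elim: p x => [|z p IH] x /=.
  by move=> _ ->; constructor 1.
case/andP=> /joinedP[f + Ef] /IH{}IH /IH{}IH; rewrite !inE => /orP[/eqP fe|fX].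
  rewrite fe in Ef; case: Ef IH => -> /=.
    by case=> [h|[h1 h2]|[h1 h2]]; [constructor 2|constructor 2|constructor 1].
  by case=> [h|[h1 h2]|[h1 h2]]; [constructor 3|constructor 1|constructor 3].
have xz : connect (joined G X) x z by apply/connect1/joinedP; exists f.
case: IH => [h|[h1 h2]|[h1 h2]]; [constructor 1|constructor 2|constructor 3];
  by rewrite ?(connect_trans xz) //; split=> //; rewrite ?(connect_trans xz).
Qed.

Lemma acyclicP G T : reflect
  (forall e, e \in T -> ~~ connect (joined G (T :\ e)) (ends G e).1 (ends G e).2)
  (acyclic G T).
Proof.
by apply: (iffP forallP) => H e; [move/implyP: (H e)|apply/implyP; apply: H].
Qed.

Lemma acyclicS G X Y : X \subset Y -> acyclic G Y -> acyclic G X.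
Proof.
move=> XY /acyclicP aY; apply/acyclicP=> e eX.
apply: contra (aY e (subsetP XY e eX)); apply: connect_joinedS.
exact: setSD.
Qed.

Lemma acyclicU G T B : [disjoint T & B] -> acyclic G B ->
  (forall e, e \in T -> ~~ connect (joined G ((T :|: B) :\ e)) (ends G e).1 (ends G e).2) ->
  acyclic G (T :|: B).
Proof.
move=> dTB aB aT; apply/acyclicP=> e; case: (boolP (e \in T)) => [eT _|eT]; first exact: aT.
rewrite inE (negPf eT) /= => eB.
suff H k (X : {set 'I_n}) : X \subset T -> #|X| = k ->
    ~~ connect (joined G (X :|: B :\ e)) (ends G e).1 (ends G e).2.
  rewrite (_ : (T :|: B) :\ e = T :|: B :\ e) ?(H #|T|) //.
  by apply/setP=> f; rewrite !inE; case: (eqVneq f e) => //= ->; rewrite (negPf eT).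
elim: k X => [|k IH] X XT cX.
  by move/cards0_eq: cX => ->; rewrite set0U; move/acyclicP: aB; apply.
have /card_gt0P[f fX] : (0 < #|X|)%N by rewrite cX.
have {}IH : ~~ connect (joined G (X :\ f :|: B :\ e)) (ends G e).1 (ends G e).2.
  apply: IH; first by apply: subset_trans XT; apply: subsetDl.
  by move: cX; rewrite (cardsD1 f) fX => -[].
apply/negP; rewrite (_ : X :|: _ = f |: (X :\ f :|: B :\ e)); last first.
  by rewrite setUA setD1K.
have fT : f \in T := subsetP XT f fX.
have fe : e != f by apply: contraNneq eT => ->.
set Y := X :\ f :|: B :\ e in IH *.
have fB : f \notin B by rewrite (disjointFr dTB).
have YS : e |: Y \subset (T :|: B) :\ f.
  apply/subsetP=> h; rewrite !inE => /or3P[/eqP->|/andP[-> hX]|/andP[he hB]].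
  - by rewrite fe eB orbT.
  - by rewrite (subsetP XT).
  - by rewrite hB orbT andbT; apply: contraNneq fB => <-.
have mono x y : connect (joined G Y) x y -> connect (joined G ((T :|: B) :\ f)) x y.
  by apply: connect_joinedS; apply: subset_trans YS; apply: subsetUr.
have ee : connect (joined G ((T :|: B) :\ f)) (ends G e).1 (ends G e).2.
  by apply/connect1/joined_ends; apply: (subsetP YS); rewrite setU11.
case/connect_joinedU1=> [|[h1 h2]|[h1 h2]]; first by rewrite (negPf IH).
  move: (aT f fT); rewrite (connect_trans _ (connect_trans ee _)) //.
    by rewrite joined_csym; apply: mono.
  by rewrite joined_csym; apply: mono.
move: (aT f fT); rewrite joined_csym (connect_trans _ (connect_trans ee _)) //.
  by rewrite joined_csym; apply: mono.
by rewrite joined_csym; apply: mono.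
Qed.

Section Contraction.
Variables (G : mgraph V n) (B : {set 'I_n}).
Hypothesis BG : B \subset edges G.
Let rep := fingraph.root (joined G (B :&: edges G)).

Lemma contract_connect T x y :
  connect (joined (contract_edges B G) T) (rep x) (rep y) =
  connect (joined G (T :|: B)) x y.
Proof.
have BE : B :&: edges G = B by apply/setIidPl.
have repx z : connect (joined G (T :|: B)) z (rep z).
  have := connect_root (joined G (B :&: edges G)) z.
  by apply: connect_joinedS; rewrite BE subsetUr.
apply/idP/idP => [H|].
  have {}H : connect (joined G (T :|: B)) (rep x) (rep y).
    move: H; apply: (@connect_map _ _ _ _ id) => a b /joinedP[e eT] /= E.
    have : connect (joined G (T :|: B)) (rep (ends G e).1) (rep (ends G e).2).
      rewrite (connect_trans _ (connect_trans (connect1 (joined_ends G _)) (repx _))) //.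
        by rewrite joined_csym.
      by rewrite inE eT.
    by case: E => -[<- <-] //; rewrite joined_csym.
  by apply: connect_trans (repx x) (connect_trans H _); rewrite joined_csym.
apply: connect_map => a b /joinedP[e + E]; rewrite inE => /orP[eT|eB].
  by apply/connect1/joinedP; exists e => //=; case: E => -> /=; [left|right].
rewrite (_ : rep a = rep b) //; apply/(@fingraph.rootP _ _ (joined_csym G (B :&: edges G))).
by apply/connect1/joinedP; exists e; rewrite ?BE.
Qed.

Lemma spans_contract T : spans (contract_edges B G) T = spans G (T :|: B).
Proof.
rewrite /spans /= -/rep; congr andb.
  congr (~~ _); apply/eqP/eqP=> [|->]; last exact: imset0.
  by move=> E; apply/setP=> x; rewrite inE; apply/negP=> /(imset_f rep); rewrite E inE.
apply/forall_inP/forall_inP=> H x xG.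
  apply/forall_inP=> y yG; rewrite -contract_connect.
  by move/forall_inP: (H _ (imset_f rep xG)); apply; apply: imset_f.
apply/forall_inP=> y /imsetP[y' yG ->]; case/imsetP: xG => x' xG ->.
by rewrite contract_connect; move/forall_inP: (H _ xG); apply.
Qed.

Lemma acyclic_contract T : acyclic G B -> [disjoint T & B] ->
  acyclic (contract_edges B G) T = acyclic G (T :|: B).
Proof.
move=> aB dTB; apply/acyclicP/idP=> [H|/acyclicP H e eT]; last first.
  rewrite contract_connect (_ : _ :|: _ = (T :|: B) :\ e); first by apply: H; rewrite inE eT.
  by apply/setP=> f; rewrite !inE; case: eqP => // ->; rewrite (disjointFr dTB).
apply: acyclicU => // e eT; move: (H e eT); rewrite contract_connect.
rewrite (_ : _ :|: _ = (T :|: B) :\ e) //.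
by apply/setP=> f; rewrite !inE; case: eqP => // ->; rewrite (disjointFr dTB).
Qed.

Lemma spanning_tree_contract T : acyclic G B ->
  spanning_tree (contract_edges B G) T = [disjoint T & B] && spanning_tree G (T :|: B).
Proof.
move=> aB; rewrite /spanning_tree /= subsetD subUset BG andbT spans_contract.
by case: (boolP [disjoint T & B]) => d; rewrite ?andbF //= acyclic_contract // andbT.
Qed.

End Contraction.

Lemma spanning_tree_minor G A B T :
    B \subset edges G -> [disjoint A & B] -> acyclic G B ->
  spanning_tree (minor G A B) T =
    [&& [disjoint T & B], [disjoint T & A] & spanning_tree G (T :|: B)].
Proof.
move=> BG dAB aB; rewrite /minor spanning_tree_contract //=; last first.
  by rewrite subsetD BG disjoint_sym.
rewrite {1}/spanning_tree /= subsetD.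
have -> : [disjoint T :|: B & A] = [disjoint T & A].
  by rewrite disjoints_subset subUset -!disjoints_subset [X in _ && X]disjoint_sym dAB andbT.
by rewrite /spanning_tree; case: [disjoint T & A]; rewrite ?andbF ?andbT.
Qed.

Lemma spans_tree G X : X \subset edges G -> spans G X ->
  exists2 T : {set 'I_n}, T \subset X & spanning_tree G T.
Proof.
move=> XG sX.
have := @arg_minnP {set 'I_n} X (fun Y : {set 'I_n} => (Y \subset X) && spans G Y) (fun Y => #|Y|).
rewrite subxx sX => /(_ isT)[T /andP[TX sT] minT]; exists T => //.
apply/and3P; split=> //; first exact: subset_trans XG.
apply/acyclicP=> e eT; apply/negP=> ce.
have := minT (T :\ e); rewrite leqNgt [X in (_ < X)%N](cardsD1 e) eT add1n ltnS leqnn.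
suff -> : (T :\ e \subset X) && spans G (T :\ e) by move=> /(_ isT).
rewrite (subset_trans _ TX) ?subsetDl //=.
case/andP: sT => V0 /forall_inP sT; rewrite /spans V0 /=.
apply/forall_inP=> x /sT/forall_inP sx; apply/forall_inP=> y /sx.
apply: connect_joined_sub => f fT; case: (eqVneq f e) => [->//|fe].
by apply/connect1/joined_ends; rewrite !inE fe.
Qed.

Section Leaf.
Variables (G : mgraph V n) (v u : V) (e : 'I_n) (T : {set 'I_n}).
Hypothesis (uv : u != v) (ev : endset G e = [set v; u]).
Hypothesis Tv : forall f, f \in T -> v \notin endset G f.

Lemma leaf_ends : ends G e = (v, u) \/ ends G e = (u, v).
Proof.
move: ev uv; rewrite /endset; case: (ends G e) => a b /= /setP E uv'.
move: (E v) (E u); rewrite !inE !eqxx orbT /= (eq_sym v a) (eq_sym u a).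
case: (eqVneq a v) => [-> _|_ /= /eqP <-].
  by rewrite [v == u]eq_sym (negPf uv') /= => /eqP <-; left.
by rewrite (negPf uv') orbF => /eqP <-; right.
Qed.

Let drop x := if x == v then u else x.

Lemma connect_leaf X x y : X \subset T ->
  connect (joined G (e |: X)) x y -> connect (joined G X) (drop x) (drop y).
Proof.
move=> /subsetP XT; apply: connect_map => a b /joinedP[f].
rewrite !inE => /orP[/eqP ->|fX] E.
  suff -> : drop a = drop b by [].
  by case: leaf_ends E => -> [] [<- <-]; rewrite /drop eqxx (negPf uv).
have := Tv (XT _ fX); rewrite /endset !inE negb_or => /andP[h1 h2].
apply/connect1/joinedP; exists f => //; rewrite /drop.
by case: E => E; move: h1 h2; rewrite E /= ![v == _]eq_sym => /negPf-> /negPf->; [left|right].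
Qed.

Lemma connect_isolated x : connect (joined G T) v x -> x = v.
Proof.
move=> /connectP[[|y p]] //= /andP[/joinedP[f fT E] _] _.
by have := Tv fT; case: E => E; rewrite /endset E /= !inE eqxx ?orbT.
Qed.

Lemma leaf_notin : e \notin T.
Proof. by apply/negP=> /Tv; rewrite ev !inE eqxx. Qed.

Lemma acyclic_leaf : acyclic G (e |: T) = acyclic G T.
Proof.
apply/idP/idP=> [|/acyclicP aT]; first by apply: acyclicS; apply: subsetUr.
apply/acyclicP=> f; rewrite !inE => /orP[/eqP ->|fT].
  rewrite setU1K ?leaf_notin //.
  by apply/negP; case: leaf_ends => -> /=; [|rewrite joined_csym];
    move=> /connect_isolated E; move: uv; rewrite E eqxx.
have fe : f != e by apply: contraTneq fT => ->; apply: leaf_notin.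
rewrite (_ : _ :\ f = e |: (T :\ f)); last first.
  by apply/setP=> h; rewrite !inE; case: (eqVneq h e) => // ->; rewrite eq_sym fe.
apply/negP=> /(connect_leaf (subsetDl _ _)).
have := Tv fT; rewrite /endset !inE negb_or ![v == _]eq_sym /drop => /andP[/negPf-> /negPf->].
by rewrite (negPf (aT f fT)).
Qed.

End Leaf.

Lemma spanning_tree_leaf G v u e T :
    v \in verts G -> u \in verts G -> e \in edges G -> u != v ->
    endset G e = [set v; u] -> T \subset edges (delete_verts [set v] G) ->
  spanning_tree (delete_verts [set v] G) T = spanning_tree G (e |: T).
Proof.
move=> vG uG eG uv ev /= TG.
have Tv f : f \in T -> v \notin endset G f.
  by move/(subsetP TG); rewrite inE disjoint_sym disjoints1 => /andP[].
have TE : T \subset edges G.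
  by apply/subsetP=> f /(subsetP TG); rewrite inE => /andP[].
rewrite /spanning_tree TG subUset sub1set eG TE /= (acyclic_leaf uv ev Tv).
congr andb; rewrite /spans; congr andb.
  rewrite (_ : verts G != set0); last by apply/set0Pn; exists v.
  by apply/set0Pn; exists u; rewrite !inE uv.
apply/forall_inP/forall_inP=> /= H x xG.
  have toD z : z \in verts G -> exists2 z', z' \in verts G :\: [set v] &
      connect (joined G (e |: T)) z z'.
    move=> zG; case: (eqVneq z v) => [->|zv]; last by exists z; rewrite ?inE ?zv.
    exists u; first by rewrite !inE uv.
    apply/connect1/joinedP; exists e; first by rewrite setU11.
    exact: leaf_ends.
  apply/forall_inP=> y yG; have [x' x'G xx] := toD x xG; have [y' y'G yy] := toD y yG.
  apply: connect_trans xx _; rewrite joined_csym; apply: connect_trans yy _.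
  rewrite joined_csym.
  have /forall_inP := H x' x'G; move=> /(_ y' y'G).
  exact: (@connect_joinedS G T (e |: T) (subsetUr _ _)).
apply/forall_inP=> y; move: xG; rewrite !inE => /andP[xv xG] /andP[yv yG].
have /forall_inP/(_ y yG) := H x xG.
by move=> /(connect_leaf uv ev Tv (subxx _)); rewrite (negPf xv) (negPf yv).
Qed.

End Connectivity.

(** * The matrix-tree theorem *)

Section Incidence.
Variables (V : finType) (n : nat) (ends : 'I_n -> V * V) (v0 : V).
Implicit Types (A T X : {set 'I_n}) (e : 'I_n).
Notation G := (whole_graph ends).
Notation r := #|[set~ v0]|.

Definition incidence e w : int := (w == (ends e).1)%:R - (w == (ends e).2)%:R.

Definition vertex (k : 'I_r) : V := enum_val k.

Lemma sum_incidence (R : nzRingType) (b : V -> R) e :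
  \sum_w b w * (incidence e w)%:~R = b (ends e).1 - b (ends e).2.
Proof.
have H u : \sum_w b w * (w == u)%:R = b u.
  by rewrite (bigD1 u) //= eqxx mulr1 big1 ?addr0 // => w /negPf->; rewrite mulr0.
rewrite -!H -sumrB; apply: eq_bigr => w _.
by rewrite /incidence rmorphB /= mulrBr !rmorph_nat.
Qed.

Lemma sum_vertex (R : nmodType) (b : V -> R) :
  b v0 = 0 -> \sum_k b (vertex k) = \sum_w b w.
Proof.
move=> b0; rewrite [RHS](bigD1 v0) //= b0 add0r.
rewrite /vertex -(big_enum_val b) /=; apply: eq_bigl => w.
by rewrite !inE.
Qed.

Lemma connect_vector X x y : connect (joined G X) x y ->
  exists2 a : 'I_n -> int, (forall e, e \notin X -> a e = 0) &
    forall w, \sum_e a e * incidence e w = (w == x)%:R - (w == y)%:R.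
Proof.
move=> /connectP[p]; elim: p x => [|z p IH] x /=.
  move=> _ ->; exists (fun=> 0) => // w; rewrite subrr big1 // => e _.
  by rewrite mul0r.
case/andP=> /joinedP[e eX /= E] /IH{}IH /IH[a aX Ea].
pose s : int := if (ends e == (x, z)) then 1 else -1.
exists (fun f => a f + (f == e)%:R * s) => [f fX|w].
  by rewrite aX // (_ : f == e = false) ?mul0r ?addr0 //; apply: contraNF fX => /eqP->.
rewrite (eq_bigr (fun f => a f * incidence f w + (f == e)%:R * s * incidence f w)); last first.
  by move=> f _; rewrite mulrDl.
rewrite big_split /= Ea (bigD1 e) //= eqxx mul1r big1 ?addr0 => [|f /negPf->]; last first.
  by rewrite !mul0r.
have -> : s * incidence e w = (w == x)%:R - (w == z)%:R.
  rewrite /s /incidence; case: eqP => [-> /=|]; first by rewrite mul1r.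
  by case: E => -> //= _; rewrite mulN1r opprB.
by rewrite addrC addrA subrK.
Qed.

Definition incidence_mx (R : nzRingType) : 'M[R]_(n, r) :=
  \matrix_(e, k) (incidence e (vertex k))%:~R.

Lemma spans_mx T : spans G T ->
  exists2 C : 'M[int]_(r, n), (forall k e, e \notin T -> C k e = 0) &
    C *m incidence_mx int = 1%:M.
Proof.
case/andP=> _ /forall_inP sT.
have H (k : 'I_r) : exists a : {ffun 'I_n -> int}, (forall e, e \notin T -> a e = 0) /\
    forall w, \sum_e a e * incidence e w = (w == vertex k)%:R - (w == v0)%:R.
  have /forall_inP/(_ v0) := sT (vertex k) (in_setT _).
  rewrite in_setT => /(_ isT)/connect_vector[a aT Ea].
  exists [ffun e => a e]; split=> [e eT|w]; first by rewrite ffunE aT.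
  by rewrite -Ea; apply: eq_bigr => e _; rewrite ffunE.
have [a Ha] := fin_all_exists H; exists (\matrix_(k, e) a k e) => [k e eT|].
  by rewrite mxE (Ha k).1.
apply/matrixP=> k l; rewrite !mxE -[LHS](_ : (vertex l == vertex k)%:R - (vertex l == v0)%:R = _).
  have := enum_valP l; rewrite !inE => /negPf->.
  by rewrite subr0 eq_sym (inj_eq enum_val_inj).
by rewrite -(Ha k).2; apply: eq_bigr => e _; rewrite !mxE intz.
Qed.

Lemma acyclic_free (R : nzRingType) T (a : 'rV[R]_n) : acyclic G T ->
  (forall e, e \notin T -> a 0 e = 0) -> a *m incidence_mx R = 0 -> a = 0.
Proof.
move=> /acyclicP aT a0 E.
have {}E w : \sum_e a 0 e * (incidence e w)%:~R = 0.
  have Ek k : \sum_e a 0 e * (incidence e (vertex k))%:~R = 0.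
    transitivity ((a *m incidence_mx R) 0 k); last by rewrite E mxE.
    by rewrite mxE; apply: eq_bigr => e _; rewrite mxE.
  have Ew u : u != v0 -> \sum_e a 0 e * (incidence e u)%:~R = 0.
    move=> uv; have uin : u \in [set~ v0] by rewrite !inE.
    by have := Ek (enum_rank_in uin u); rewrite /vertex enum_rankK_in.
  case: (eqVneq w v0) => [->|]; last exact: Ew.
  have : \sum_u \sum_e a 0 e * (incidence e u)%:~R = 0.
    rewrite exchange_big big1 //= => e _; rewrite -mulr_sumr.
    have := sum_incidence (fun=> 1 : R) e; rewrite subrr.
    by under eq_bigr do rewrite mul1r; move=> ->; rewrite mulr0.
  by rewrite (bigD1 v0) //= [X in _ + X]big1 ?addr0 // => u uv; apply: Ew.
apply/rowP=> e; rewrite mxE; case: (boolP (e \in T)) => [eT|/a0//].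
pose b w : R := (connect (joined G (T :\ e)) (ends e).1 w)%:R.
have : \sum_w (\sum_f a 0 f * (incidence f w)%:~R) * b w = 0.
  by rewrite big1 // => w _; rewrite E mul0r.
under eq_bigr => w _ do rewrite mulr_suml.
rewrite exchange_big /= (bigD1 e) //= [X in _ + X]big1 => [|f fe].
  rewrite addr0; under eq_bigr => w _ do rewrite -mulrA -[_ * b w]commr_int.
  rewrite -mulr_sumr sum_incidence /b connect0 (negPf (aT e eT)).
  by rewrite subr0 mulr1.
under eq_bigr => w _ do rewrite -mulrA -[_ * b w]commr_int.
rewrite -mulr_sumr sum_incidence; case: (boolP (f \in T)) => [fT|/a0->]; last by rewrite mul0r.
have fTe : f \in T :\ e by rewrite !inE fe.
have := connect1 (joined_ends G fTe) => cf.
rewrite /b -(same_connect_r (joined_csym _ _) cf) subrr mulr0 //.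
Qed.

End Incidence.

Section TreeMatrix.
Variables (V : finType) (n : nat) (ends : 'I_n -> V * V) (v0 : V).
Implicit Types (A T X : {set 'I_n}) (e : 'I_n).
Notation G := (whole_graph ends).
Notation r := #|[set~ v0]|.
Notation vertex := (@vertex V v0).
Notation incidence := (incidence ends).

Definition select_mx (R : nzRingType) T : 'M[R]_(#|T|, n) := \matrix_(i, e) (enum_val i == e)%:R.

Lemma select_mx_tr (R : comNzRingType) T : select_mx R T *m (select_mx R T)^T = 1%:M.
Proof.
apply/matrixP=> i j; rewrite !mxE (bigD1 (enum_val i)) //= !mxE eqxx mul1r.
rewrite (inj_eq enum_val_inj) eq_sym big1 ?addr0 // => e /negPf ie.
by rewrite mxE eq_sym ie mul0r.
Qed.

Lemma select_mx_sq (R : comNzRingType) T :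
  (select_mx R T)^T *m select_mx R T = diag_mx (\row_e (e \in T)%:R).
Proof.
apply/matrixP=> e f; rewrite !mxE.
under eq_bigr => i _ do rewrite !mxE.
rewrite -(big_enum_val (fun g => (g == e)%:R * (g == f)%:R : R)) /=.
case: (boolP (e \in T)) => eT.
  by rewrite (bigD1 e) //= eqxx mul1r big1 ?addr0 // => g /andP[_ /negPf->]; rewrite mul0r.
rewrite mul0rn big1 // => g gT; rewrite (_ : g == e = false) ?mul0r //.
by apply: contraNF eT => /eqP <-.
Qed.

Lemma spanning_tree_card T : spanning_tree G T -> #|T| = r.
Proof.
case/and3P=> _ sT aT; apply/eqP; rewrite eqn_leq; apply/andP; split.
  suff : row_free (select_mx rat T *m incidence_mx ends v0 rat).
    by rewrite /row_free => /eqP <-; apply: rank_leq_col.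
  rewrite -kermx_eq0; apply/eqP/row_matrixP=> i; rewrite row0.
  set K := kermx _; have : row i K *m select_mx rat T *m incidence_mx ends v0 rat = 0.
    by rewrite -mulmxA -row_mul mulmx_ker row0.
  move=> /(acyclic_free aT) H; rewrite -[row i K]mulmx1 -(select_mx_tr rat T) mulmxA H ?mul0mx //.
  move=> e eT; rewrite mxE big1 // => j _; rewrite [select_mx _ _ _ _]mxE.
  rewrite (_ : _ == e = false) ?mulr0 //; apply: contraNF eT => /eqP <-.
  exact: enum_valP.
have [C CT] := spans_mx v0 sT.
suff -> : C = C *m ((select_mx int T)^T *m select_mx int T).
  by rewrite mulmxA -mulmxA => /mulmx1_min.
rewrite select_mx_sq mul_mx_diag; apply/matrixP=> k e; rewrite !mxE.
by case: (boolP (e \in T)) => [|/CT->]; rewrite ?mulr1 ?mul0r.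
Qed.

Lemma spans_card T : spans G T -> #|T| = r -> spanning_tree G T.
Proof.
move=> sT cT; have TE : T \subset edges G by apply/subsetP=> e; rewrite !inE.
have [T' T'T tT'] := spans_tree TE sT.
suff -> : T = T' by [].
by apply/eqP; rewrite eq_sym eqEcard T'T cT -(spanning_tree_card tT') leqnn.
Qed.

Section Matrix.
Variable R : comNzRingType.
Implicit Types x : 'rV[R]_n.

Definition tree_inc A : 'M[R]_(n, r) :=
  \matrix_(e, k) (if e \in A then 0 else incidence_mx ends v0 R e k).

(* The edges in A are deleted: their rows and columns are those of the identity matrix. *)
Definition tree_mx A x : 'M[R]_(n + r) :=
  block_mx (diag_mx (\row_e (if e \in A then 1 else x 0 e))) (tree_inc A) (tree_inc A)^T 0.

End Matrix.

Lemma det_ker (R : idomainType) m (M : 'M[R]_m) (z : 'cV_m) i : M *m z = 0 -> z i 0 != 0 -> \det M = 0.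
Proof.
move=> Mz zi; have := mul_adj_mx M => /(congr1 (mulmx^~ z)).
rewrite -mulmxA Mz mulmx0 mul_scalar_mx => /(congr1 (fun X : 'cV_m => X i 0)).
by rewrite !mxE => /esym/eqP; rewrite mulf_eq0 (negPf zi) orbF => /eqP.
Qed.

Lemma det_tree_mx_spans A : ~~ spans G (~: A) -> \det (tree_mx A (0 : 'rV[int]_n)) = 0.
Proof.
rewrite negb_and negbK => /orP[/eqP E|]; first by move: (in_setT v0); rewrite [setT]E inE.
move=> nc; have [w cw] : exists w, ~~ connect (joined G (~: A)) v0 w.
  apply/existsP; apply: contraR nc => /existsPn H; apply/forall_inP=> x _.
  apply/forall_inP=> y _; have := H x; have := H y; rewrite !negbK => h1 h2.
  by apply: connect_trans h1; rewrite joined_csym.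
pose b u : int := (~~ connect (joined G (~: A)) v0 u)%:R.
have wv : w != v0 by apply: contraNneq cw => ->; apply: connect0.
have wI : w \in [set~ v0] by rewrite !inE.
apply: (@det_ker _ _ _ (col_mx 0 (\col_k b (vertex k))) (rshift n (enum_rank_in wI w))).
  rewrite mul_block_col !mulmx0 mul0mx !addr0 add0r (_ : _ *m _ = 0) ?col_mx0 //.
  apply/matrixP=> e j; rewrite !mxE; case: (boolP (e \in A)) => eA.
    by rewrite big1 // => k _; rewrite mxE eA mul0r.
  under eq_bigr => k _ do rewrite !mxE (negPf eA) mulrC.
  rewrite (sum_vertex (b := fun u => b u * (incidence e u)%:~R)).
    rewrite sum_incidence /b.
    have eA' : e \in ~: A by rewrite inE.
    have := connect1 (joined_ends G eA') => cf.
    by rewrite (same_connect_r (joined_csym _ _) cf) subrr.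
  by rewrite /b connect0 mul0r.
by rewrite col_mxEd mxE /vertex enum_rankK_in // /b cw.
Qed.

Lemma det_tree_mx_acyclic A : ~~ acyclic G (~: A) -> \det (tree_mx A (0 : 'rV[int]_n)) = 0.
Proof.
case/forallPn=> e; rewrite negb_imply negbK => /andP[eA] /connect_vector[a aA Ea].
pose z : 'cV[int]_n := \col_f (a f - (f == e)%:R).
apply: (@det_ker _ _ _ (col_mx z 0) (lshift r e)).
  rewrite mul_block_col !mulmx0 !addr0 -[RHS]col_mx0; congr col_mx.
    rewrite mul_diag_mx; apply/matrixP=> f j; rewrite !mxE.
    case: (boolP (f \in A)) => [fA|]; rewrite ?mul0r // mul1r aA ?inE ?fA ?andbF //.
    rewrite (_ : f == e = false) ?subr0 //.
    by apply: contraTF eA => /eqP <-; rewrite inE negbK.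
  apply/matrixP=> k j; rewrite !mxE.
  transitivity (\sum_f (a f * incidence f (vertex k) - (f == e)%:R * incidence e (vertex k))).
    apply: eq_bigr => f _; rewrite !mxE; case: (boolP (f \in A)) => fA.
      rewrite aA ?inE ?fA ?andbF // (_ : f == e = false) ?mul0r ?subr0 //.
      by apply: contraTF eA => /eqP <-; rewrite inE negbK.
    by rewrite intz mulrBr mulrC [_ * (f == e)%:R]mulrC; case: eqP => [->|]; rewrite ?mul0r.
  rewrite sumrB Ea [X in _ - X](bigD1 e) //= eqxx mul1r big1 ?addr0 => [|f /negPf->]; last first.
    by rewrite mul0r.
  by rewrite subrr.
by rewrite col_mxEu mxE aA ?eqxx // !inE eqxx.
Qed.

Lemma det_tree_mx_square A : #|~: A| = r ->
  exists2 c : int, \det (tree_mx A (0 : 'rV[int]_n)) = (-1) ^+ r * c ^+ 2 &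
    spans G (~: A) -> c ^+ 2 = 1.
Proof.
set T := ~: A => cT.
have [U [UU UT]] : exists U : 'M[int]_(r, n),
    U *m U^T = 1%:M /\ U^T *m U = diag_mx (\row_e (e \in T)%:R).
  by case: _ / cT; exists (select_mx int T); rewrite select_mx_tr select_mx_sq.
have UE : U^T *m (U *m incidence_mx ends v0 int) = tree_inc int A.
  rewrite mulmxA UT mul_diag_mx; apply/matrixP=> e k; rewrite !mxE inE.
  by case: (e \in A); rewrite ?mul0r ?mul1r.
set E := incidence_mx ends v0 int in UE.
exists (\det (U *m E)); last first.
  move=> /(spans_mx v0)[C CT CE].
  have : \det (C *m U^T) * \det (U *m E) = 1.
    rewrite -det_mulmx mulmxA -[C *m U^T *m U]mulmxA UT (_ : C *m _ = C) ?CE ?det1 //.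
    rewrite mul_mx_diag; apply/matrixP=> k e; rewrite !mxE.
    by case: (boolP (e \in T)) => [|/CT->]; rewrite ?mulr1 ?mul0r.
  move=> /(congr1 absz); rewrite abszM => /eqP; rewrite muln_eq1 => /andP[_ /eqP E1].
  by case: (\det _) E1 => m /=; [move=> ->|case=> ->].
pose P : 'M[int]_n := 1%:M - U^T *m U.
have -> : tree_mx A (0 : 'rV[int]_n) =
  block_mx 1%:M 0 0 (U *m E)^T *m block_mx P U^T U 0 *m block_mx 1%:M 0 0 (U *m E).
  rewrite !mulmx_block !(mul0mx, mulmx0, mul1mx, mulmx1, addr0, add0r) UE /tree_mx.
  congr block_mx; last by rewrite -UE trmx_mul trmxK.
  rewrite /P UT; apply/matrixP=> e f; rewrite !mxE; case: (eqVneq e f) => [->|]; rewrite ?subr0 //.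
  by rewrite /T inE; case: (f \in A); rewrite ?subr0 ?subrr.
rewrite !det_mulmx !det_lblock det1 det_tr !mul1r.
suff -> : \det (block_mx P U^T U 0) = (-1) ^+ r.
  by rewrite mulrAC mulrC expr2.
have -> : block_mx P U^T U 0 = block_mx 1%:M 0 0 (-1)%:M *m (block_mx 1%:M U^T 0 1%:M *m
    block_mx 1%:M 0 (- U) 1%:M *m block_mx 1%:M U^T 0 1%:M).
  rewrite !mulmx_block !(mul0mx, mulmx0, mul1mx, mulmx1, addr0, add0r) !mulmxN -/P.
  rewrite !mulNmx !mul_scalar_mx !scaleN1r !opprK UU addNr oppr0.
  by congr block_mx; rewrite /P mulmxBl mul1mx -mulmxA UU mulmx1 subrr add0r.
by rewrite !det_mulmx !det_lblock !det_ublock !det1 det_scalar !mulr1 mul1r.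
Qed.

Lemma det_tree_mx0 A : \det (tree_mx A (0 : 'rV[int]_n)) = (-1) ^+ r * (spanning_tree G (~: A))%:R.
Proof.
case: (boolP (spanning_tree G (~: A))) => tA.
  have [c -> ->] := det_tree_mx_square (spanning_tree_card tA); first by [].
  by case/and3P: tA.
rewrite mulr0; move: tA; rewrite /spanning_tree subsetT /= negb_and.
by case/orP; [apply: det_tree_mx_spans|apply: det_tree_mx_acyclic].
Qed.

End TreeMatrix.

Lemma disjoints_setU1r (T : finType) (A B : {set T}) e :
  [disjoint A & e |: B] = (e \notin A) && [disjoint A & B].
Proof. by rewrite -!setI_eq0 setIUr setU_eq0 setI_eq0 disjoint_sym disjoints1. Qed.

Section MultiAffine.
Variables (R : comNzRingType) (n : nat).
Implicit Types (A X Z : {set 'I_n}) (e : 'I_n) (x y : 'rV[R]_n).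

Definition zap Z x : 'rV[R]_n := \row_i (if i \in Z then 0 else x 0 i).

Lemma zapE Z x i : zap Z x 0 i = if i \in Z then 0 else x 0 i.
Proof. by rewrite mxE. Qed.

(* A family of functions closed under taking the coefficient of x_e, which
   is recorded by adding e to the index A. *)
Definition multi_affine X (g : {set 'I_n} -> 'rV[R]_n -> R) :=
  forall A e x, e \in X -> e \notin A -> g A x = x 0 e * g (e |: A) x + g A (zap [set e] x).

Lemma multi_affine_eq X g h : multi_affine X g -> multi_affine X h ->
    (forall A x, (forall e, e \in X -> e \notin A -> x 0 e = 0) -> g A x = h A x) ->
  forall A x, g A x = h A x.
Proof.
move=> mg mh H A x; have [k] := ubnP #|[set e in X | (e \notin A) && (x 0 e != 0)]|.
elim: k A x => // k IH A x; rewrite ltnS => le.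
case: (pickP (fun e => [&& e \in X, e \notin A & x 0 e != 0])) => [e /and3P[eX eA xe]|no].
  rewrite (mg _ e) // (mh _ e) //; congr (_ * _ + _); apply: IH.
    apply: leq_trans le; apply: proper_card; apply/properP; split.
      apply/subsetP=> f; rewrite !inE negb_or => /and3P[-> /andP[_ ->] ->] //.
    by exists e; rewrite !inE ?eqxx ?eX ?eA.
  apply: leq_trans le; apply: proper_card; apply/properP; split.
    apply/subsetP=> f; rewrite !inE zapE !inE => /and3P[-> -> /=].
    by case: ifP; rewrite ?eqxx.
  by exists e; rewrite !inE ?zapE ?inE ?eqxx ?eX ?eA.
apply: H => e eX eA; have := no e; rewrite eX eA /= => /negbFE/eqP //.
Qed.

End MultiAffine.

Section TreeSum.
Variables (V : finType) (n : nat) (ends : 'I_n -> V * V).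
Notation G := (whole_graph ends).

(* The graph polynomial of the graph with the edges in A deleted.  At points where
   the variables of B vanish, it is that of the graph with B contracted as well. *)
Definition tree_sum (R : comNzRingType) (A : {set 'I_n}) (x : 'rV[R]_n) : R :=
  \sum_(T : {set 'I_n} | spanning_tree G T && [disjoint T & A])
     \prod_(e in ~: (T :|: A)) x 0 e.

Section Ring.
Variable R : comNzRingType.
Implicit Types (A T : {set 'I_n}) (e : 'I_n) (x y : 'rV[R]_n).

Lemma tree_sumE A x :
  tree_sum A x = \sum_(T : {set 'I_n} | spanning_tree G T && [disjoint T & A])
                    \prod_(e in ~: (T :|: A)) x 0 e.
Proof. by []. Qed.

Lemma tree_sum_eq A x y : (forall e, e \notin A -> x 0 e = y 0 e) ->
  tree_sum A x = tree_sum A y.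
Proof.
move=> E; apply: eq_bigr => T _; apply: eq_bigr => e.
by rewrite !inE negb_or => /andP[_ /E].
Qed.

Lemma tree_sum_affine : multi_affine setT (@tree_sum R).
Proof.
move=> A e x _ eA; rewrite /tree_sum (bigID (fun T : {set 'I_n} => e \in T)) /= addrC; congr (_ + _).
  rewrite mulr_sumr; apply: eq_big => [T|T /andP[/andP[_ dT] eT]].
    by rewrite -andbA disjoints_setU1r [X in _ && X]andbC.
  rewrite (bigD1 e) /=; last by rewrite !inE negb_or eT.
  congr (_ * _); apply: eq_bigl => f; rewrite !inE.
  by case: (f == e); rewrite ?andbT ?andbF ?orbT.
rewrite [RHS](bigID (fun T : {set 'I_n} => e \in T)) /= [X in _ + X]big1 ?addr0.
  apply: eq_bigr => T /andP[_ eT]; apply: eq_bigr => f; rewrite !inE negb_or => /andP[fT _].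
  by rewrite zapE inE (_ : f == e = false) //; apply: contraNF fT => /eqP->.
move=> T /andP[_ eT]; rewrite (bigD1 e) /=; last by rewrite !inE negb_or eT.
by rewrite zapE !inE eqxx mul0r.
Qed.

Lemma tree_sum0 A x : (forall e, e \notin A -> x 0 e = 0) ->
  tree_sum A x = (spanning_tree G (~: A))%:R.
Proof.
move=> x0.
have H T : T != ~: A -> [disjoint T & A] -> \prod_(e in ~: (T :|: A)) x 0 e = 0.
  move=> TA dT; have TS : T \subset ~: A by rewrite -disjoints_subset.
  have /subsetPn[e] : ~~ (~: A \subset T) by apply: contraNN TA => h; rewrite eqEsubset TS.
  rewrite inE => eA eT; rewrite (bigD1 e) /=; last by rewrite !inE negb_or eT.
  by rewrite x0 // mul0r.
rewrite /tree_sum; case: (boolP (spanning_tree G (~: A))) => tA.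
  rewrite (bigD1 (~: A)) /=; last by rewrite tA disjoints_subset subxx.
  rewrite [X in _ + X]big1 => [|T /andP[/andP[_ dT] /H]]; last exact.
  by rewrite setUC setUCr setCT big_set0 addr0.
rewrite big1 // => T /andP[tT dT]; apply: H => //.
by apply: contraNneq tA => <-.
Qed.

End Ring.

Section Entries.
Variables (v0 : V) (R : comNzRingType).
Implicit Types (A T : {set 'I_n}) (e : 'I_n) (x y : 'rV[R]_n).
Notation r := #|[set~ v0]|.
Notation tree_mx := (@tree_mx _ _ ends v0 _).
Notation edge := (lshift r).

Lemma tree_mxEE A x e f :
  tree_mx A x (edge e) (edge f) = (if e \in A then 1 else x 0 e) *+ (e == f).
Proof. by rewrite block_mxEul !mxE. Qed.

Lemma tree_mxEV A x e k :
  tree_mx A x (edge e) (rshift n k) =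
    if e \in A then 0 else (incidence ends e (vertex k))%:~R.
Proof. by rewrite block_mxEur !mxE. Qed.

Lemma tree_mxVE A x e k :
  tree_mx A x (rshift n k) (edge e) =
    if e \in A then 0 else (incidence ends e (vertex k))%:~R.
Proof. by rewrite block_mxEdl !mxE. Qed.

Lemma tree_mxVV A x k l : tree_mx A x (rshift n k) (rshift n l) = 0.
Proof. by rewrite block_mxEdr mxE. Qed.

End Entries.

Notation tree_mxE := (tree_mxEE, tree_mxEV, tree_mxVE, tree_mxVV).

Section Det.
Variables (v0 : V) (R : comNzRingType).
Implicit Types (A T : {set 'I_n}) (e : 'I_n) (x y : 'rV[R]_n).
Notation r := #|[set~ v0]|.
Notation tree_mx := (@tree_mx _ _ ends v0 _).
Notation edge := (lshift r).

Lemma tr_tree_mx A x : (tree_mx A x)^T = tree_mx A x.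
Proof. by rewrite tr_block_mx tr_diag_mx trmxK trmx0. Qed.

Lemma tree_mx_zap A x e i j : (i, j) != (edge e, edge e) ->
  tree_mx A x i j = tree_mx A (zap [set e] x) i j.
Proof.
case: (split_ordP i) => k ->; case: (split_ordP j) => l ->; rewrite !tree_mxE //.
rewrite xpair_eqE !eq_lshift zapE inE.
case: (eqVneq k l) => [<-|]; rewrite ?mulr0n //.
by rewrite andbb => /negPf->.
Qed.

Lemma tree_mx_del A x e i j : i != edge e -> j != edge e ->
  tree_mx A x i j = tree_mx (e |: A) x i j.
Proof.
case: (split_ordP i) => k ->; case: (split_ordP j) => l ->; rewrite !tree_mxE // ?eq_lshift !inE.
- by move=> /negPf->.
- by move=> /negPf->.
- by move=> _ /negPf->.
Qed.

Lemma tree_mx_delta A x e j : tree_mx (e |: A) x (edge e) j = (j == edge e)%:R.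
Proof.
case: (split_ordP j) => l ->; rewrite !tree_mxE ?eq_lshift ?eq_rlshift !inE eqxx //.
by rewrite eq_sym.
Qed.

Lemma cofactor_tree_mx_diag A x e :
  cofactor (tree_mx A x) (edge e) (edge e) = \det (tree_mx (e |: A) x).
Proof.
rewrite (@det_delta_row _ _ _ (edge e) (edge e)); last exact: tree_mx_delta.
by apply: cofactor_eq => i j; apply: tree_mx_del.
Qed.

Lemma det_tree_mx_affine : multi_affine setT (fun A x => \det (tree_mx A x)).
Proof.
move=> A e x _ eA; rewrite (@det_entry _ _ _ (tree_mx A (zap [set e] x)) (edge e)).
- by rewrite cofactor_tree_mx_diag tree_mxE eqxx (negPf eA).
- by move=> i j; apply: tree_mx_zap.
- by rewrite tree_mxE eqxx (negPf eA) zapE inE eqxx.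
Qed.

Lemma det_tree_mx A x : \det (tree_mx A x) = (-1) ^+ r * tree_sum A x.
Proof.
apply: (multi_affine_eq det_tree_mx_affine (h := fun A x => (-1) ^+ r * tree_sum A x)).
  by move=> {}A e {}x eT eA; rewrite (tree_sum_affine _ eT) // mulrDr mulrCA.
move=> {}A {}x x0; rewrite tree_sum0; last by move=> e; apply: x0; rewrite inE.
have -> : tree_mx A x = map_mx (intr : int -> R) (tree_mx A 0).
  apply/matrixP=> i j; rewrite [RHS]mxE.
  case: (split_ordP i) => k ->; case: (split_ordP j) => l ->; rewrite !tree_mxE //.
  - case: (boolP (k \in A)) => [_|kA]; last by rewrite x0 ?inE // mxE !mul0rn.
    by case: (k == l); rewrite ?mulr1n ?mulr0n ?rmorph1 ?rmorph0.
  - by case: ifP => //; rewrite intz.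
  - by case: ifP => //; rewrite intz.
by rewrite det_map_mx det_tree_mx0 rmorphM /= rmorphXn rmorphN1 rmorph_nat.
Qed.

Definition tree_minor (i j : 'I_n) A x : R := cofactor (tree_mx A x) (edge i) (edge j).

Lemma tree_minor_affine i j : multi_affine (~: [set i; j]) (tree_minor i j).
Proof.
move=> A e x; rewrite !inE negb_or => /andP[ei ej] eA.
rewrite /tree_minor (@cofactor_entry _ _ _ (tree_mx A (zap [set e] x)) (tree_mx (e |: A) x)
  _ _ (edge e)) ?eq_lshift //.
- by rewrite tree_mxE eqxx (negPf eA).
- by move=> a b; apply: tree_mx_zap.
- by rewrite tree_mxE eqxx (negPf eA) zapE inE eqxx.
- by move=> a b; apply: tree_mx_del.
- exact: tree_mx_delta.
Qed.

Lemma tree_minor_eq i j A x y : i != j ->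
  (forall e, e \notin A -> e \notin [set i; j] -> x 0 e = y 0 e) ->
  tree_minor i j A x = tree_minor i j A y.
Proof.
move=> ij E; apply: cofactor_eq => a b.
case: (split_ordP a) => k ->; case: (split_ordP b) => l ->; rewrite !tree_mxE // !eq_lshift.
case: (eqVneq k l) => [<-|]; rewrite ?mulr0n // => ki kj.
by case: (boolP (k \in A)) => // kA; rewrite E // !inE negb_or ki.
Qed.

Lemma tree_minorC i j A x : tree_minor i j A x = tree_minor j i A x.
Proof. by rewrite /tree_minor -[in LHS]tr_tree_mx cofactor_tr. Qed.

Lemma tree_minor_diag i A x : tree_minor i i A x = (-1) ^+ r * tree_sum (i |: A) x.
Proof. by rewrite /tree_minor cofactor_tree_mx_diag det_tree_mx. Qed.

Lemma tree_minor_sqr i j A x : i != j ->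
  tree_minor i j A x ^+ 2 = tree_sum (i |: A) x * tree_sum (j |: A) x
                            - tree_sum A x * tree_sum (i |: (j |: A)) x.
Proof.
move=> ij.
have := @dodgson _ _ (tree_mx A x) (tree_mx (i |: (j |: A)) x) (edge i) (edge j).
have H k l : tree_mx (k |: (l |: A)) x = tree_mx (l |: (k |: A)) x by rewrite setUCA.
have Hd k l (B : {set 'I_n}) : tree_mx (k |: B) x l (edge k) = (l == edge k)%:R.
  by rewrite -tr_tree_mx mxE tree_mx_delta.
rewrite eq_lshift => /(_ ij) E.
have {}E : \det (tree_mx A x) * \det (tree_mx (i |: (j |: A)) x) =
    tree_minor i i A x * tree_minor j j A x - tree_minor i j A x * tree_minor j i A x.
  apply: E => [k l ki kj li lj|k|k|k|k]; rewrite ?Hd ?tree_mx_delta //.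
  - by rewrite -!tree_mx_del.
  - by rewrite H Hd.
  - by rewrite H tree_mx_delta.
move: E; rewrite !det_tree_mx !tree_minor_diag [tree_minor j i A x]tree_minorC -expr2.
have s1 : (-1) ^+ r * (-1) ^+ r = 1 :> R by rewrite -expr2 sqrr_sign.
rewrite mulrACA s1 mul1r mulrACA s1 mul1r => ->.
by rewrite opprB addrC subrK.
Qed.

Lemma sum_incidence_minor v j A x : v != v0 ->
  \sum_(e | e \notin A) (incidence ends e v)%:~R * tree_minor j e A x = 0.
Proof.
move=> vv; have vI : v \in [set~ v0] by rewrite !inE.
pose k := enum_rank_in vI v.
transitivity ((tree_mx A x *m \adj (tree_mx A x)) (rshift n k) (edge j)).
  rewrite mxE big_split_ord /= [X in _ + X]big1 ?addr0 => [|l _]; last first.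
    by rewrite tree_mxE mul0r.
  rewrite big_mkcond; apply: eq_bigr => e _; rewrite tree_mxE mxE /vertex enum_rankK_in //.
  by case: (e \in A) => //=; rewrite mul0r.
by rewrite mul_mx_adj mxE eq_rlshift.
Qed.

End Det.

Lemma three_valent_minor v0 v e1 e2 e3 : simple_graph G -> v != v0 ->
    three_valent G v e1 e2 e3 ->
  exists s : int, s ^+ 2 = 1 /\
    forall (R : comNzRingType) (A : {set 'I_n}) (x : 'rV[R]_n), [disjoint A & [set e1; e2; e3]] ->
      (s%:~R * tree_minor v0 e1 e2 A x) *+ 2 =
      tree_sum (e1 |: A) x + tree_sum (e2 |: A) x - tree_sum (e3 |: A) x.
Proof.
move=> [noloop _] vv [u3 inc].
have e12 : e1 != e2 by move: u3; rewrite /= inE negb_or => /andP[/andP[]].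
have e13 : e1 != e3 by move: u3; rewrite /= inE negb_or !inE => /andP[/andP[]].
have e23 : e2 != e3 by move: u3; rewrite /= !inE => /andP[_ /andP[]].
pose eps e := incidence ends e v.
have eps1 e : e \in [set e1; e2; e3] -> eps e ^+ 2 = 1.
  rewrite -inc !inE /eps /incidence /endset /= ![v == _]eq_sym.
  have := noloop e (in_setT e); rewrite /=.
  case: (eqVneq (ends e).1 v) => [->|_ _] /=; last by case: eqP.
  by rewrite eq_sym => /negPf->.
have eps0 e : e \notin [set e1; e2; e3] -> eps e = 0.
  rewrite -inc !inE /eps /incidence /endset /= ![v == _]eq_sym negb_or.
  by case/andP=> /negPf-> /negPf->; rewrite subrr.
have E1 : eps e1 ^+ 2 = 1 by apply: eps1; rewrite !inE eqxx.
have E2 : eps e2 ^+ 2 = 1 by apply: eps1; rewrite !inE eqxx orbT.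
have E3 : eps e3 ^+ 2 = 1 by apply: eps1; rewrite !inE eqxx !orbT.
pose r := #|[set~ v0]|.
exists (- ((-1) ^+ r * (eps e1 * eps e2))); split.
  by rewrite sqrrN !exprMn E1 E2 sqrr_sign.
move=> R A x dA.
have rel j : (eps e1)%:~R * tree_minor v0 j e1 A x + (eps e2)%:~R * tree_minor v0 j e2 A x +
             (eps e3)%:~R * tree_minor v0 j e3 A x = 0.
  have notA e : e \in [set e1; e2; e3] -> e \notin A by move=> h; rewrite (disjointFl dA).
  rewrite -[RHS](sum_incidence_minor j A x vv).
  rewrite (bigD1 e1) /=; last by rewrite notA // !inE eqxx.
  rewrite (bigD1 e2) /=; last by rewrite notA ?(eq_sym e2) // !inE eqxx orbT.
  rewrite (bigD1 e3) /=; last by rewrite notA ?(eq_sym e3) ?e13 ?e23 // !inE eqxx !orbT.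
  rewrite big1 ?addr0 ?addrA // => e /andP[/andP[/andP[_ n1] n2] n3].
  by rewrite -/(eps e) eps0 ?mul0r // !inE !negb_or n1 n2.
have sg j : tree_sum (j |: A) x = (-1) ^+ r * tree_minor v0 j j A x.
  by rewrite tree_minor_diag mulrA -expr2 sqrr_sign mul1r.
have := rel e1; have := rel e2; have := rel e3.
rewrite !sg [tree_minor v0 e2 e1 _ _]tree_minorC [tree_minor v0 e3 e1 _ _]tree_minorC.
rewrite [tree_minor v0 e3 e2 _ _]tree_minorC.
have toR e : eps e ^+ 2 = 1 -> (eps e)%:~R ^+ 2 = 1 :> R.
  by move=> h; rewrite -rmorphXn /= h.
move: (toR _ E1) (toR _ E2) (toR _ E3); rewrite rmorphN !rmorphM rmorphXn rmorphN1 /=.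
move: ((eps e1)%:~R : R) ((eps e2)%:~R : R) ((eps e3)%:~R : R) => a b c.
move: (tree_minor _ e1 e1 _ _) (tree_minor _ e2 e2 _ _) (tree_minor _ e3 e3 _ _) => m1 m2 m3.
move: (tree_minor _ e1 e2 _ _) (tree_minor _ e1 e3 _ _) (tree_minor _ e2 e3 _ _) => m12 m13 m23.
move: ((-1) ^+ r : R) => s a1 b1 c1 H3 H2 H1.
have -> : m1 = - (a * b * m12) - a * c * m13.
  transitivity (a ^+ 2 * m1); first by rewrite a1 mul1r.
  by rewrite -[LHS]subr0 -(mulr0 a) -H1; ring.
have -> : m2 = - (a * b * m12) - b * c * m23.
  transitivity (b ^+ 2 * m2); first by rewrite b1 mul1r.
  by rewrite -[LHS]subr0 -(mulr0 b) -H2; ring.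
have -> : m3 = - (a * c * m13) - b * c * m23.
  transitivity (c ^+ 2 * m3); first by rewrite c1 mul1r.
  by rewrite -[LHS]subr0 -(mulr0 c) -H3; ring.
ring.
Qed.

End TreeSum.

Notation tree_mxE := (tree_mxEE, tree_mxEV, tree_mxVE, tree_mxVV).

(** * Graph polynomials of minors *)

Section Variables.
Variable n : nat.
Implicit Types (S : {set 'I_n}) (p q : {mpoly int[n]}).

Definition edge_vars : 'rV[{mpoly int[n]}]_n := \row_i 'X_i.

Lemma in_vars0 S : in_vars S (0 : {mpoly int[n]}).
Proof. by move=> m; rewrite msupp0. Qed.

Lemma in_vars1 S : in_vars S (1 : {mpoly int[n]}).
Proof. by move=> m; rewrite msupp1 inE => /eqP -> i; rewrite mnm0E. Qed.

Lemma in_varsD S p q : in_vars S p -> in_vars S q -> in_vars S (p + q).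
Proof. by move=> hp hq m /msuppD_le; rewrite mem_cat => /orP[/hp|/hq]. Qed.

Lemma in_varsN S p : in_vars S p -> in_vars S (- p).
Proof. by move=> hp m; rewrite mcoeff_msupp mcoeffN oppr_eq0 -mcoeff_msupp => /hp. Qed.

Lemma in_varsM S p q : in_vars S p -> in_vars S q -> in_vars S (p * q).
Proof.
move=> hp hq m /msuppM_le/allpairsP[[m1 m2] /= [/hp h1 /hq h2 ->]] i.
by rewrite mnmDE addn_eq0 negb_and => /orP[/h1|/h2].
Qed.

Lemma in_varsX S i : i \in S -> in_vars S ('X_i : {mpoly int[n]}).
Proof.
move=> iS m; rewrite msuppX inE => /eqP -> j; rewrite mnm1E.
by case: (eqVneq i j) => [<-|].
Qed.

Lemma in_vars_half S p : in_vars S (p *+ 2) -> in_vars S p.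
Proof.
move=> h m; rewrite mcoeff_msupp => pm; apply: h.
by rewrite mcoeff_msupp mcoeffMn mulrn_eq0 negb_or.
Qed.

Lemma dhomog_half d p : p *+ 2 \is d.-homog -> p \is d.-homog.
Proof.
move=> /dhomogP h; apply/dhomogP=> m; rewrite mcoeff_msupp => pm; apply: h.
by rewrite mcoeff_msupp mcoeffMn mulrn_eq0 negb_or.
Qed.

Variable F : finFieldType.

Definition eval_morph (x : 'rV[F]_n) : {rmorphism {mpoly int[n]} -> F} :=
  meval (fun i => x 0 i) \o map_mpoly (intr : int -> F).

Lemma eval_atE p x : eval_at p x = eval_morph x p.
Proof. by []. Qed.

Lemma eval_edge_vars x i : eval_morph x 'X_i = x 0 i.
Proof. by rewrite /= map_mpolyX mevalXU. Qed.

Lemma map_eval_vars B x : map_mx (eval_morph x) (zap B edge_vars) = zap B x.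
Proof.
apply/rowP=> i; rewrite mxE !zapE; case: ifP => _; first exact: rmorph0.
by rewrite mxE eval_edge_vars.
Qed.

End Variables.

Section Minors.
Variables (V : finType) (n : nat) (ends : 'I_n -> V * V).
Notation G := (whole_graph ends).
Notation tree_sum := (@tree_sum V n ends _).
Notation X := (edge_vars n).
Implicit Types A B T : {set 'I_n}.

Section Morph.
Variables (R R' : comNzRingType) (f : {rmorphism R -> R'}).

Lemma rmorph_tree_sum A (x : 'rV[R]_n) : f (tree_sum A x) = tree_sum A (map_mx f x).
Proof.
rewrite rmorph_sum; apply: eq_bigr => T _; rewrite rmorph_prod.
by apply: eq_bigr => e _; rewrite mxE.
Qed.

Lemma rmorph_tree_minor v0 i j A (x : 'rV[R]_n) :
  f (tree_minor ends v0 i j A x) = tree_minor ends v0 i j A (map_mx f x).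
Proof.
rewrite /tree_minor -cofactor_map_mx; congr cofactor.
apply/matrixP=> a b; rewrite mxE.
case: (split_ordP a) => k ->; case: (split_ordP b) => l ->; rewrite !tree_mxE ?rmorph0 //.
- by rewrite rmorphMn /=; case: ifP; rewrite ?rmorph1 // mxE.
- by case: ifP; rewrite ?rmorph0 // rmorph_int.
- by case: ifP; rewrite ?rmorph0 // rmorph_int.
Qed.

End Morph.

Lemma tree_sum_zap (R : comNzRingType) A B (x : 'rV[R]_n) : [disjoint A & B] ->
  tree_sum A (zap B x) =
  \sum_(T : {set 'I_n} | [&& [disjoint T & B], [disjoint T & A] & spanning_tree G (T :|: B)])
     \prod_(e in ~: A :\: B :\: T) x 0 e.
Proof.
move=> dAB; rewrite tree_sumE (bigID (fun T : {set 'I_n} => B \subset T)) /=.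
rewrite [X in _ + X]big1 ?addr0 => [|T /andP[/andP[tT dTA] /subsetPn[e eB eT]]]; last first.
  rewrite (bigD1 e) /=; last by rewrite !inE negb_or eT (disjointFl dAB eB).
  by rewrite zapE eB mul0r.
rewrite (reindex_onto (fun T => T :|: B) (fun T => T :\: B)) /= => [|T /andP[_ BT]]; last first.
  apply/setP=> e; rewrite !inE; case: (boolP (e \in B)) => [/(subsetP BT)->|] //=.
  by rewrite orbF.
apply: eq_big => [T|T _].
  rewrite subsetUr andbT.
  have -> : ((T :|: B) :\: B == T) = [disjoint T & B].
    rewrite setDUl setDv setU0; apply/eqP/idP => [<-|/setDidPl//].
    by rewrite -setI_eq0 setIDAC setDIl setDv setI0.
  have -> : [disjoint T :|: B & A] = [disjoint T & A].
    by rewrite -!setI_eq0 setIUl setU_eq0 [B :&: A]setIC [A :&: B]disjoint_setI0 // eqxx andbT.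
  by rewrite andbC [X in _ && X]andbC.
apply: eq_big => [e|e].
  by rewrite !inE !negb_or -andbA andbC; do 3 case: (e \in _).
by rewrite zapE !inE !negb_or => /andP[/andP[_ /negPf->]].
Qed.

Lemma graph_polyE : graph_poly G = tree_sum set0 X.
Proof.
apply: eq_big => [T|T _]; first by rewrite -setI_eq0 setI0 eqxx andbT.
by apply: eq_big => [e|e _]; rewrite ?mxE // !inE orbF andbT.
Qed.

Lemma graph_poly_minor A B : [disjoint A & B] -> acyclic G B ->
  graph_poly (minor G A B) = tree_sum A (zap B X).
Proof.
move=> dAB aB; rewrite tree_sum_zap //; apply: eq_big => [T|T _].
  by rewrite spanning_tree_minor // subsetT.
by apply: eq_big => [e|e _]; rewrite ?mxE // !inE andbT.
Qed.

End Minors.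

Section Graph.
Variables (V : finType) (n : nat) (ends : 'I_n -> V * V).
Notation G := (whole_graph ends).
Notation tree_sum := (@tree_sum V n ends _).
Notation X := (edge_vars n).
Implicit Types (A B T Z : {set 'I_n}) (e : 'I_n) (v : V).

Lemma tree_sum_eq0 (R : comNzRingType) A B (x : 'rV[R]_n) : [disjoint A & B] ->
    (forall e, e \in B -> x 0 e = 0) ->
    (forall T, spanning_tree G T -> ~~ (B \subset T)) ->
  tree_sum A x = 0.
Proof.
move=> dAB x0 nT; rewrite tree_sumE big1 // => T /andP[/nT/subsetPn[e eB eT] dTA].
by rewrite (bigD1 e) /= ?x0 ?mul0r // !inE negb_or eT (disjointFl dAB eB).
Qed.

Lemma tree_sum_swap (R : comNzRingType) Z A1 A2 (x : 'rV[R]_n) : A1 \subset Z -> A2 \subset Z ->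
    (forall e, e \in Z -> x 0 e = 0) ->
    (forall T, [disjoint T & Z] ->
       spanning_tree G (T :|: (Z :\: A1)) = spanning_tree G (T :|: (Z :\: A2))) ->
  tree_sum A1 x = tree_sum A2 x.
Proof.
move=> A1Z A2Z x0 H.
pose g B A (y : 'rV[R]_n) := tree_sum (B :|: (A :\: Z)) (zap Z y).
have gaff B : B \subset Z -> multi_affine (~: Z) (g B).
  move=> BZ A e y; rewrite inE => eZ eA.
  rewrite /g (@tree_sum_affine _ _ _ _ _ e) ?inE //; last first.
    rewrite (negPf eA) andbF orbF; apply: contra eZ; exact: (subsetP BZ).
  rewrite zapE (negPf eZ) setDUl (_ : [set e] :\: Z = [set e]) 1?setUCA; last first.
    by apply/setDidPl; rewrite disjoints1.
  congr (_ * _ + tree_sum _ _); apply/rowP=> i; rewrite !zapE inE.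
  by do 2 case: ifP.
have gx B : B \subset Z -> g B set0 x = tree_sum B x.
  move=> BZ; rewrite /g set0D setU0; congr (tree_sum _ _).
  by apply/rowP=> i; rewrite zapE; case: ifP => // /x0.
rewrite -(gx A1) // -(gx A2) //; apply: (multi_affine_eq (gaff A1 A1Z) (gaff A2 A2Z)) => A y y0.
have base B : B \subset Z -> g B A y = (spanning_tree G (~: (Z :|: A) :|: (Z :\: B)))%:R.
  move=> BZ; rewrite /g tree_sum0 => [|e]; last first.
    rewrite !inE negb_or negb_and negbK zapE; case: ifP => //= eZ /andP[_ eA].
    by apply: y0 => //; rewrite inE eZ.
  congr (spanning_tree _ _)%:R; apply/setP=> e; rewrite !inE.
  case: (boolP (e \in B)) => [/(subsetP BZ)->//|_] /=.
  by case: (e \in Z); rewrite ?orbF.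
by rewrite !base // H // disjoints_subset setCU subsetIl.
Qed.

Lemma tree_sum_homog v0 A B : tree_sum A (zap B X) \is (n - (#|[set~ v0]| + #|A|)).-homog.
Proof.
apply: rpred_sum => T /andP[tT dTA].
have -> : (n - (#|[set~ v0]| + #|A|) = #|~: (T :|: A)|)%N.
  rewrite [in RHS]cardsCs setCK cardsU (disjoint_setI0 dTA) cards0 subn0 card_ord.
  by rewrite (spanning_tree_card v0 tT).
rewrite -sum1_card; elim/big_ind2: _ => [|p d q d' hp hq|e _]; first exact: dhomog1.
  exact: dhomogM.
rewrite zapE; case: ifP => _; first exact: rpred0.
by rewrite mxE dhomogX /= mdeg1.
Qed.

Lemma tree_sum_in_vars A B : in_vars (~: (A :|: B)) (tree_sum A (zap B X)).
Proof.
apply: big_ind => [||T _]; [exact: in_vars0|exact: in_varsD|].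
apply: big_ind => [||e]; [exact: in_vars1|exact: in_varsM|].
rewrite !inE negb_or => /andP[_ eA]; rewrite zapE; case: ifP => eB; first exact: in_vars0.
by rewrite mxE; apply: in_varsX; rewrite !inE (negPf eA) eB.
Qed.

Lemma connect_endset B e a b : e \in B -> a != b -> endset G e = [set a; b] ->
  connect (joined G B) a b.
Proof.
move=> eB ab E; apply/connect1/joinedP; exists e => //.
by apply: leaf_ends E; rewrite eq_sym.
Qed.

Lemma spanning_tree_swap T a b c : a != b -> b != c -> a \notin T -> b \notin T -> c \notin T ->
    connect (joined G [set b; c]) (ends a).1 (ends a).2 ->
  spanning_tree G (T :|: [set a; b]) -> spanning_tree G (T :|: [set b; c]).
Proof.
move=> ab bc aT bT cT H tT; have v0 : V by exact: (ends a).1.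
have card2 d f : d != f -> d \notin T -> f \notin T -> #|T :|: [set d; f]| = (#|T| + 2)%N.
  move=> df dT fT; rewrite cardsU cards2 df (_ : T :&: _ = set0) ?cards0 ?subn0 //.
  apply/setP=> e; rewrite !inE; case: (boolP (e \in T)) => //= eT.
  by apply/negP=> /orP[] /eqP E; move: eT; rewrite E ?(negPf dT) ?(negPf fT).
apply: (@spans_card _ _ _ v0); last first.
  by rewrite -(spanning_tree_card v0 tT) !card2.
case/and3P: tT => _ /andP[n0 /forall_inP sT] _; rewrite /spans n0 /=.
apply/forall_inP=> x /sT/forall_inP sx; apply/forall_inP=> y /sx.
apply: connect_joined_sub => e; rewrite !inE => /or3P[eT|/eqP->|/eqP->] /=.
- by apply/connect1/(@joined_ends _ _ G); rewrite inE eT.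
- by move: H; apply: connect_joinedS; apply: subsetUr.
- by apply/connect1/(@joined_ends _ _ G); rewrite !inE eqxx orbT.
Qed.

Hypothesis simple : simple_graph G.

Lemma neighbour v e : v \in endset G e -> exists2 u, u != v & endset G e = [set v; u].
Proof.
have := simple.1 e (in_setT e); rewrite /endset !inE /= => ne /orP[] /eqP ->.
  by exists (ends e).2; rewrite 1?eq_sym.
by exists (ends e).1; rewrite // setUC.
Qed.

Lemma acyclic_set1 e : acyclic G [set e].
Proof.
apply/acyclicP=> f; rewrite inE => /eqP ->; rewrite setDv /=.
apply/negP=> /connectP[[|z p]] /=; first by move=> _ E; have := simple.1 e (in_setT e); rewrite /= E eqxx.
by case/andP=> /joinedP[g]; rewrite inE.
Qed.

Lemma three_valentP v e1 e2 e3 : three_valent G v e1 e2 e3 ->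
  [/\ [/\ e1 != e2, e1 != e3 & e2 != e3],
      (forall e, (v \in endset G e) = (e \in [set e1; e2; e3])) &
      exists u1 u2 u3, [/\ [/\ u1 != v, u2 != v & u3 != v], [/\ u1 != u2, u1 != u3 & u2 != u3] &
        [/\ endset G e1 = [set v; u1], endset G e2 = [set v; u2] & endset G e3 = [set v; u3]]]].
Proof.
case=> un inc.
have e12 : e1 != e2 by move: un; rewrite /= inE negb_or => /andP[/andP[]].
have e13 : e1 != e3 by move: un; rewrite /= inE negb_or !inE => /andP[/andP[]].
have e23 : e2 != e3 by move: un; rewrite /= !inE => /andP[_ /andP[]].
have incE e : (v \in endset G e) = (e \in [set e1; e2; e3]) by rewrite -inc !inE.
split=> //.
have /neighbour[u1 u1v E1] : v \in endset G e1 by rewrite incE !inE eqxx.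
have /neighbour[u2 u2v E2] : v \in endset G e2 by rewrite incE !inE eqxx orbT.
have /neighbour[u3 u3v E3] : v \in endset G e3 by rewrite incE !inE eqxx !orbT.
exists u1, u2, u3; split=> //; split.
- apply: contraNneq e12 => E; apply/eqP; apply: simple.2; rewrite ?inE //.
  by rewrite E1 E2 E.
- apply: contraNneq e13 => E; apply/eqP; apply: simple.2; rewrite ?inE //.
  by rewrite E1 E3 E.
- apply: contraNneq e23 => E; apply/eqP; apply: simple.2; rewrite ?inE //.
  by rewrite E2 E3 E.
Qed.

Lemma acyclic_star v e1 e2 e3 : three_valent G v e1 e2 e3 -> acyclic G [set e1; e2; e3].
Proof.
move=> /three_valentP[_ _ [u1 [u2 [u3 [[u1v u2v u3v] [u12 u13 u23] [E1 E2 E3]]]]]].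
rewrite -setUA (@acyclic_leaf _ _ _ u1 v); first 1 last.
- by rewrite eq_sym.
- by rewrite E1 setUC.
- by move=> f /set2P[] ->; rewrite ?E2 ?E3 !inE negb_or u1v ?u12 ?u13.
rewrite (@acyclic_leaf _ _ _ u2 v); first exact: acyclic_set1.
- by rewrite eq_sym.
- by rewrite E2 setUC.
- by move=> f /set1P ->; rewrite E3 !inE negb_or u2v u23.
Qed.

Section Removed.
Variable v : V.
Notation Gv := (delete_verts [set v] G).

Lemma mem_edges_removed e : (e \in edges Gv) = (v \notin endset G e).
Proof. by rewrite inE in_setT disjoint_sym disjoints1. Qed.

Lemma spanning_tree_removed e T : v \in endset G e ->
    (forall f, f \in T -> v \notin endset G f) ->
  spanning_tree Gv T = spanning_tree G (e |: T).
Proof.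
move=> ve Tv; have [u uv E] := neighbour ve.
apply: (@spanning_tree_leaf _ _ _ _ u); rewrite ?in_setT //.
by apply/subsetP=> f /Tv; rewrite mem_edges_removed.
Qed.

Lemma tree_avoiding : vertex_connected 2 G ->
  exists T, (forall e, e \in T -> v \notin endset G e) /\
    forall e, v \in endset G e -> spanning_tree G (e |: T).
Proof.
case=> _ /(_ [set v]); rewrite subsetT cards1 => /(_ isT isT) cv.
have [T Tv tT] := spans_tree (subxx _) cv.
have Tv' f : f \in T -> v \notin endset G f by move/(subsetP Tv); rewrite mem_edges_removed.
by exists T; split=> // e ve; rewrite -spanning_tree_removed.
Qed.

Lemma graph_poly_minor_removed e1 e2 e3 A B : three_valent G v e1 e2 e3 ->
    [disjoint A & [set e1; e2; e3]] -> [disjoint B & [set e1; e2; e3]] ->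
    [disjoint A & B] -> acyclic G B ->
  graph_poly (minor Gv ([set e1; e2; e3] :|: A) B) =
  tree_sum ([set e1; e2] :|: A) (zap (e3 |: B) X).
Proof.
move=> tv dA dB dAB aB; have [[e12 e13 e23] incE _] := three_valentP tv.
have edgesE e : (e \in edges Gv) = (e \notin [set e1; e2; e3]).
  by rewrite mem_edges_removed incE.
have e3A : e3 \notin A by rewrite (disjointFl dA) // !inE eqxx !orbT.
have e1B : e1 \notin B by rewrite (disjointFl dB) // !inE eqxx.
have e2B : e2 \notin B by rewrite (disjointFl dB) // !inE eqxx orbT.
have BE : B \subset edges Gv by apply/subsetP=> e eB; rewrite edgesE (disjointFr dB).
rewrite tree_sum_zap; last first.
  rewrite disjoints_setU1r !inE !negb_or [e3 == e1]eq_sym e13 [e3 == e2]eq_sym e23 e3A /=.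
  apply/pred0P=> e /=; rewrite !inE; case: (boolP (e \in B)) => eB; rewrite ?andbF // andbT.
  rewrite (disjointFl dAB eB) orbF; apply/negP=> /orP[] /eqP E; move: eB; rewrite E.
    by rewrite (negPf e1B).
  by rewrite (negPf e2B).
apply: eq_big => [T|T _].
  rewrite spanning_tree_minor //; last first.
    by rewrite -setI_eq0 setIUl setU_eq0 !setI_eq0 disjoint_sym dB.
  case: (boolP (T \subset edges Gv)) => TE.
    have Tn e : e \in T -> e \notin [set e1; e2; e3] by move/(subsetP TE); rewrite edgesE.
    have dT e : e \in [set e1; e2; e3] -> e \notin T by apply: contraL => /Tn.
    rewrite disjoints_setU1r dT ?(inE, eqxx, orbT) //=.
    have -> : [disjoint T & [set e1; e2; e3] :|: A] = [disjoint T & A].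
      rewrite -!setI_eq0 setIUr setU_eq0 (_ : T :&: _ = set0) ?eqxx //.
      by apply/setP=> e; rewrite !in_setI in_set0; apply/negP=> /andP[/Tn/negPf->].
    have -> : [disjoint T & [set e1; e2] :|: A] = [disjoint T & A].
      rewrite -!setI_eq0 setIUr setU_eq0 (_ : T :&: _ = set0) ?eqxx //.
      apply/setP=> e; rewrite !in_setI in_set0; apply/negP=> /andP[/Tn].
      by rewrite !inE => /norP[/negPf->].
    congr [&& _, _ & _]; rewrite setUCA; apply: spanning_tree_removed.
      by rewrite incE !inE eqxx !orbT.
    move=> f; rewrite inE -mem_edges_removed => /orP[/(subsetP TE)//|/(subsetP BE)//].
  have -> : spanning_tree Gv (T :|: B) = false.
    by apply: contraNF TE => /and3P[]; rewrite subUset => /andP[].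
  rewrite !andbF; apply/esym/negP=> /and3P[d1 d2 _]; case/subsetPn: TE => e eT.
  rewrite edgesE negbK !inE => /orP[/orP[]|] /eqP E.
  - by have := disjointFr d2 eT; rewrite E !inE eqxx.
  - by have := disjointFr d2 eT; rewrite E !inE eqxx orbT.
  - by have := disjointFr d1 eT; rewrite E !inE eqxx.
apply: eq_big => [e|e _]; last by rewrite mxE.
rewrite /= !in_setD edgesE !inE !negb_or.
by do 6 case: (_ \in _) || case: (_ == _).
Qed.

End Removed.

End Graph.

(** * Counting along lines *)

Lemma set_ind (T : finType) (P : {set T} -> Prop) : P set0 ->
  (forall x (A : {set T}), x \notin A -> P A -> P (x |: A)) -> forall A, P A.
Proof.
move=> P0 PU A; elim: {A}#|A| {-2}A (leqnn #|A|) => [|k IH] A.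
  by rewrite leqn0 cards_eq0 => /eqP->.
move=> cA; case: (set_0Vmem A) => [->//|[x xA]].
rewrite -(setD1K xA); apply: PU; first by rewrite !inE eqxx.
by apply: IH; move: cA; rewrite (cardsD1 x) xA.
Qed.

Section Lines.
Variable F : finFieldType.
Implicit Types a b c d : F.
Notation q := (#|F|%:R : int).

Lemma count1 (P : pred F) t0 : P =1 pred1 t0 -> \sum_t (P t)%:R = 1 :> int.
Proof.
move=> E; rewrite (bigD1 t0) //= E /= eqxx big1 ?addr0 // => t tt0.
by rewrite E /= (negPf tt0).
Qed.

Lemma sum_predC (P : pred F) : \sum_t (~~ P t)%:R = q - \sum_t (P t)%:R :> int.
Proof.
have -> : q = \sum_(t : F) 1 by rewrite sumr_const.
by rewrite -sumrB; apply: eq_bigr => t _; case: (P t).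
Qed.

Lemma sum_cst (k : int) : \sum_(t : F) k = q * k.
Proof. by rewrite sumr_const mulr_natl. Qed.

Lemma line_zeros a b :
  \sum_t (a * t + b == 0)%R%:R = (if a == 0%R then if b == 0%R then q else 0 else 1) :> int.
Proof.
case: eqP => [->|/eqP a0].
  under eq_bigr do rewrite mul0r add0r.
  by rewrite sumr_const; case: eqP => _; rewrite ?mul0rn.
apply: (@count1 _ (- b / a)) => t /=; rewrite addr_eq0.
by apply/eqP/eqP=> [<-|->]; field.
Qed.

Lemma line_nonzeros a b :
  \sum_t (a * t + b != 0)%R%:R = q * ((a != 0%R) || (b != 0%R))%:R - (a != 0%R)%:R :> int.
Proof.
rewrite sum_predC line_zeros; case: (a == 0) => /=; last by rewrite mulr1.
by case: (b == 0); rewrite ?mulr0 ?mulr1 ?subr0 ?subrr.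
Qed.

Lemma line_nonzeros2 a b c d :
  \sum_t ((a * t + b != 0) || (c * t + d != 0))%R%:R =
  q * [|| a != 0%R, b != 0%R, c != 0%R | d != 0%R]%:R
  - (((a != 0%R) || (c != 0%R)) && (a * d == b * c)%R)%:R :> int.
Proof.
under eq_bigr do rewrite -negb_and.
rewrite (@sum_predC (fun t => (a * t + b == 0) && (c * t + d == 0))).
case: (eqVneq a 0) => [->|a0] /=.
  case: (eqVneq c 0) => [->|c0] /=.
    under eq_bigr do rewrite !mul0r !add0r.
    rewrite sum_cst; case: (b == 0); case: (d == 0) => /=;
      by rewrite ?mulr0 ?mulr1 ?subr0 ?subrr.
  rewrite orbT mulr1 mul0r; congr (_ - _).
  case: (eqVneq b 0) => [->|b0]; last first.
    rewrite eq_sym mulf_eq0 (negPf b0) (negPf c0) big1 // => t _.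
    by rewrite mul0r add0r (negPf b0).
  rewrite mul0r eqxx; under eq_bigr do rewrite mul0r add0r eqxx /=.
  apply: (@count1 _ (- d / c)) => t /=; rewrite addr_eq0.
  by apply/eqP/eqP=> [<-|->]; field.
rewrite mulr1; congr (_ - _); have E t : (a * t + b == 0) = (t == - b / a).
  by rewrite addr_eq0; apply/eqP/eqP=> [<-|->]; field.
rewrite (bigD1 (- b / a)) //= E eqxx /= big1 ?addr0 => [|t /negPf tn]; last by rewrite E tn.
congr (_%:R); congr nat_of_bool; rewrite -(inj_eq (mulfI a0)) mulr0.
rewrite (_ : a * (c * (- b / a) + d) = a * d - b * c); last by field.
by rewrite subr_eq0.
Qed.

End Lines.

Section Affine.
Variables (F : finFieldType) (n : nat).
Implicit Types (S A B : {set 'I_n}) (e : 'I_n) (x y : 'rV[F]_n) (t : F).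
Notation q := (#|F|%:R : int).
Notation affine := (@affine F n).

Definition upd y e t : 'rV[F]_n := \row_i (if i == e then t else y 0 i).

Lemma updE y e t i : upd y e t 0 i = if i == e then t else y 0 i.
Proof. by rewrite mxE. Qed.

Lemma affineP S x : reflect (forall i, i \notin S -> x 0 i = 0) (x \in affine S).
Proof.
rewrite inE; apply: (iffP forallP) => H i; first by move=> iS; have := H i; rewrite iS => /eqP.
by apply/implyP=> /H ->.
Qed.

Lemma affine_setT : affine setT = setT.
Proof. by apply/setP=> x; rewrite !inE; apply/forallP=> i; rewrite inE. Qed.

Lemma affine0 : affine set0 = [set 0].
Proof.
apply/setP=> x; rewrite [RHS]inE; apply/affineP/eqP=> [H|-> i _]; last by rewrite mxE.
by apply/rowP=> i; rewrite H ?inE // mxE.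
Qed.

Lemma sum_affineU1 (R : nmodType) S e (f : 'rV[F]_n -> R) : e \notin S ->
  \sum_(x in affine (e |: S)) f x = \sum_(y in affine S) \sum_t f (upd y e t).
Proof.
move=> eS; rewrite pair_big /=.
rewrite (reindex_onto (fun p : 'rV[F]_n * F => upd p.1 e p.2) (fun x => (upd x e 0, x 0 e))) /=.
  apply: eq_bigl => -[y t] /=; rewrite andbT.
  apply/andP/affineP=> [[/affineP H /eqP[E _]] i iS|H].
    case: (eqVneq i e) => [->|ie]; first by rewrite -E updE eqxx.
    by have := H i; rewrite updE (negPf ie) !inE (negPf ie) (negPf iS); apply.
  split.
    by apply/affineP=> i; rewrite !inE negb_or updE => /andP[/negPf-> /H].
  rewrite xpair_eqE updE eqxx eqxx andbT; apply/eqP/rowP=> i; rewrite !updE.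
  by case: eqVneq => // ->; rewrite H.
by move=> x _; apply/rowP=> i; rewrite !updE; case: eqVneq => // ->.
Qed.

Lemma sum_affineU1_const (R : nmodType) S e (f : 'rV[F]_n -> R) : e \notin S ->
    (forall y t, y \in affine S -> f (upd y e t) = f y) ->
  \sum_(x in affine (e |: S)) f x = (\sum_(y in affine S) f y) *+ #|F|.
Proof.
move=> eS H; rewrite sum_affineU1 // -sumrMnl; apply: eq_bigr => y yS.
by rewrite (eq_bigr (fun=> f y)) ?sumr_const // => t _; apply: H.
Qed.

Lemma card_affine S : #|affine S| = (#|F| ^ #|S|)%N.
Proof.
elim/set_ind: S => [|e S eS IH].
  by rewrite affine0 cards1 cards0.
rewrite cardsU1 eS expnS -IH -sum1_card (@sum_affineU1_const nat) //.
by rewrite sum1_card -mulr_natr mulrC natn.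
Qed.

Lemma sum_affine1 S : \sum_(x in affine S) 1 = q ^+ #|S| :> int.
Proof. by rewrite sumr_const card_affine natrX. Qed.

(* On a line in direction e the coefficient of the parameter is the member of
   the family with e deleted, evaluated at the base point. *)
Definition line_affine (X : {set 'I_n}) (g : {set 'I_n} -> 'rV[F]_n -> F) :=
  forall A e y t, e \in X -> e \notin A -> y 0 e = 0 ->
    g A (upd y e t) = g (e |: A) y * t + g A y.

Lemma multi_affine_line X g : multi_affine X g ->
    (forall A e y t, e \in X -> g (e |: A) (upd y e t) = g (e |: A) y) ->
  line_affine X g.
Proof.
move=> mg H A e y t eX eA ye; rewrite (mg _ e) // H // updE eqxx mulrC.
congr (_ + g _ _); apply/rowP=> i; rewrite zapE inE updE.
by case: eqVneq => // ->.
Qed.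

Section Family.
Variables (X : {set 'I_n}) (g : {set 'I_n} -> 'rV[F]_n -> F).
Hypothesis gl : line_affine X g.

Lemma dvd_count_top A S : S \subset X -> [disjoint A & S] -> g (A :|: S) 0 = 0 ->
  (q %| \sum_(x in affine S) (g A x != 0)%:R)%Z.
Proof.
elim/set_ind: S A => [|e S eS IH] A.
  by rewrite setU0 affine0 big_set1 => _ _ ->; rewrite eqxx.
rewrite subUset sub1set disjoints_setU1r => /andP[eX SX] /andP[eA dAS] g0.
rewrite sum_affineU1 //.
rewrite (eq_bigr (fun y => q * ((g (e |: A) y != 0) || (g A y != 0))%:R
   - (g (e |: A) y != 0)%:R)) => [|y /affineP yS]; last first.
  by rewrite -line_nonzeros; apply: eq_bigr => t _; rewrite gl // yS.
rewrite sumrB -mulr_sumr; apply: rpredB; first by rewrite dvdz_mulr.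
apply: IH => //.
  by rewrite disjoint_sym disjoints_setU1r eS disjoint_sym.
by rewrite -setUA setUCA.
Qed.

Lemma count_zeros_le A S B : S \subset X -> [disjoint A & S] -> B \subset S -> g (A :|: B) 0 != 0 ->
  q * (\sum_(x in affine S) (g A x == 0)%:R) <= #|S|%:R * q ^+ #|S|.
Proof.
elim/set_ind: S A B => [|e S eS IH] A B.
  rewrite subset0 => _ _ /eqP-> /negPf; rewrite setU0 affine0 big_set1 cards0 => ->.
  by rewrite !mulr0 mul0r.
rewrite subUset sub1set disjoints_setU1r => /andP[eX SX] /andP[eA dAS] BS g0.
have q0 : 0 <= q by [].
rewrite sum_affineU1 // cardsU1 eS.
have H (f : 'rV[F]_n -> F) :
    q * \sum_(x in affine S) (f x == 0)%:R <= #|S|%:R * q ^+ #|S| ->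
    (forall y, y \in affine S -> \sum_t (g A (upd y e t) == 0)%:R <= q * (f y == 0)%:R + 1) ->
    q * \sum_(y in affine S) \sum_t (g A (upd y e t) == 0)%:R <=
      (true + #|S|)%:R * q ^+ (true + #|S|).
  move=> h1 h2; apply: (@le_trans _ _ (q * (\sum_(y in affine S) (q * (f y == 0)%:R + 1)))).
    by apply: ler_wpM2l => //; apply: ler_sum.
  rewrite big_split /= -mulr_sumr sum_affine1 mulrDr.
  rewrite (_ : (_ + _)%:R * _ = q * (#|S|%:R * q ^+ #|S|) + q * q ^+ #|S|).
    by rewrite lerD2r ler_wpM2l.
  by rewrite natrD exprS; ring.
case: (boolP (e \in B)) => eB.
  apply: (H (g (e |: A))) => [|y /affineP yS].
    apply: (IH _ (B :\ e)) => //.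
    - by rewrite disjoint_sym disjoints_setU1r eS disjoint_sym.
    - by rewrite subDset.
    - by rewrite -setUA setUCA setD1K.
  under eq_bigr => t _ do rewrite gl ?yS //.
  rewrite line_zeros; move: (q) q0 => z z0.
  by case: (g (e |: A) y == 0); case: (g A y == 0); rewrite /= ?mulr1 ?mulr0; lra.
apply: (H (g A)) => [|y /affineP yS].
  apply: (IH _ B) => //.
  apply/subsetP=> f fB; have := subsetP BS f fB; rewrite !inE => /orP[/eqP E|//].
  by move: eB; rewrite -E fB.
under eq_bigr => t _ do rewrite gl ?yS //.
rewrite line_zeros; move: (q) q0 => z z0.
by case: (g (e |: A) y == 0); case: (g A y == 0); rewrite /= ?mulr1 ?mulr0; lra.
Qed.

Lemma family_eq0 A S : S \subset X -> [disjoint A & S] ->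
    (forall x, x \in affine S -> g A x = 0) ->
  forall B, B \subset S -> g (A :|: B) 0 = 0.
Proof.
elim/set_ind: S A => [|e S eS IH] A.
  move=> _ _ H B; rewrite subset0 => /eqP->; rewrite setU0; apply: H.
  by rewrite affine0 inE.
rewrite subUset sub1set disjoints_setU1r => /andP[eX SX] /andP[eA dAS] H B BS.
have gy y t : y \in affine S -> g (e |: A) y * t + g A y = 0.
  move=> yS; have /affineP y0 := yS; rewrite -gl ?y0 //; apply: H.
  apply/affineP=> i; rewrite !inE negb_or updE => /andP[/negPf-> iS]; exact: y0.
have gA y : y \in affine S -> g A y = 0 by move=> /(gy y 0); rewrite mulr0 add0r.
case: (boolP (e \in B)) => eB.
  have -> : A :|: B = (e |: A) :|: (B :\ e) by rewrite -setUA setUCA setD1K.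
  apply: IH => //; last by rewrite subDset.
    by rewrite disjoint_sym disjoints_setU1r eS disjoint_sym.
  by move=> y yS; have := gy y 1 yS; rewrite gA // mulr1 addr0.
apply: IH => //; apply/subsetP=> f fB; have := subsetP BS f fB; rewrite !inE => /orP[/eqP E|//].
by move: eB; rewrite -E fB.
Qed.

End Family.

End Affine.

(** * Nonzeros of graph polynomials *)

Section TreeCount.
Variables (V : finType) (n : nat) (ends : 'I_n -> V * V) (v0 : V) (F : finFieldType).
Notation G := (whole_graph ends).
Notation tree_sum := (@tree_sum V n ends F).
Notation minor := (@tree_minor V n ends v0 F).
Notation r := #|[set~ v0]|.
Notation q := (#|F|%:R : int).
Notation affine := (@affine F n).
Implicit Types (A B S T K : {set 'I_n}) (e i j : 'I_n) (x y z : 'rV[F]_n).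

Lemma tree_sum_line : line_affine setT tree_sum.
Proof.
apply: multi_affine_line; first exact: tree_sum_affine.
move=> A e y t _; apply: tree_sum_eq => f; rewrite !inE updE negb_or.
by case/andP=> /negPf->.
Qed.

Lemma tree_sum_upd A e y t : e \notin A -> y 0 e = 0 ->
  tree_sum A (upd y e t) = tree_sum (e |: A) y * t + tree_sum A y.
Proof. by move=> eA ye; rewrite tree_sum_line // inE. Qed.

Lemma tree_minor_line i j : i != j -> line_affine (~: [set i; j]) (minor i j).
Proof.
move=> ij; apply: multi_affine_line; first exact: tree_minor_affine.
move=> A e y t _; apply: tree_minor_eq => // f; rewrite !inE updE negb_or.
by case/andP=> /negPf->.
Qed.

Lemma tree_sum_at0 A : tree_sum A 0 = (spanning_tree G (~: A))%:R.
Proof. by rewrite tree_sum0 // => e _; rewrite mxE. Qed.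

Lemma spanning_tree_neq T : #|T| != r -> spanning_tree G T = false.
Proof. by apply: contraNF => /(spanning_tree_card v0)/eqP. Qed.

Lemma tree_sum_at0_card A : #|~: A| != r -> tree_sum A 0 = 0.
Proof. by move=> h; rewrite tree_sum_at0 spanning_tree_neq. Qed.

Lemma cardsC_U1 A e : e \notin A -> #|~: (e |: A)|.+1 = #|~: A|.
Proof.
move=> eA; rewrite [RHS](cardsD1 e) inE eA add1n; congr _.+1.
by apply: eq_card => f; rewrite !inE negb_or.
Qed.

Lemma dvd_count_minor i j A S : i != j -> i \notin A :|: S -> j \notin A :|: S ->
    [disjoint A & S] -> (#|~: (A :|: S)| <= r)%N ->
  (q %| \sum_(x in affine S) (minor i j A x != 0)%:R)%Z.
Proof.
move=> ij iAS jAS dAS le; apply: (dvd_count_top (tree_minor_line ij)) => //.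
  apply/subsetP=> e eS; rewrite !inE negb_or; apply/andP; split.
    by apply: contraNneq iAS => <-; rewrite inE eS orbT.
  by apply: contraNneq jAS => <-; rewrite inE eS orbT.
apply/eqP; rewrite -sqrf_eq0 tree_minor_sqr //.
have ci := cardsC_U1 iAS; have cj := cardsC_U1 jAS.
rewrite (@tree_sum_at0_card (i |: _)) ?mul0r; last by rewrite neq_ltn -ci in le *; rewrite le.
have ij' : i \notin j |: (A :|: S) by rewrite inE in_set1 negb_or ij.
have cij := cardsC_U1 ij'.
rewrite (@tree_sum_at0_card (i |: (j |: _))) ?mulr0 ?subr0 //.
by rewrite neq_ltn; move: le; rewrite -cj -cij => /ltnW ->.
Qed.

Lemma dvd_count_pair A S e : e \notin A -> e \notin S -> [disjoint A & S] ->
    (#|~: (e |: (A :|: S))| + 2 <= r)%N ->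
  (q %| \sum_(x in affine S) ((tree_sum (e |: A) x != 0) || (tree_sum A x != 0))%:R)%Z.
Proof.
elim/set_ind: S A => [|j S jS IH] A eA.
  move=> _ _; rewrite setU0 affine0 big_set1 => le.
  have c := cardsC_U1 eA; rewrite !tree_sum_at0_card ?eqxx //;
    move: le c; move: #|~: (e |: A)| #|~: A| #|[set~ v0]| => a b d; lia.
rewrite !inE negb_or => /andP[ej eS]; rewrite disjoints_setU1r => /andP[jA dAS] le.
rewrite sum_affineU1 //.
have ejA : j \notin e |: A by rewrite !inE negb_or eq_sym ej.
rewrite (eq_bigr (fun y =>
    q * [|| tree_sum (j |: (e |: A)) y != 0, tree_sum (e |: A) y != 0,
            tree_sum (j |: A) y != 0 | tree_sum A y != 0]%:R
   - ((tree_sum (e |: (j |: A)) y != 0) || (tree_sum (j |: A) y != 0))%:R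
   + (minor e j A y != 0)%:R)) => [|y /affineP yS].
  have le' : (#|~: (A :|: S)| <= r)%N.
    have h1 : e \notin j |: (A :|: S) by rewrite !inE !negb_or ej eA.
    have h2 : j \notin A :|: S by rewrite inE negb_or jA.
    have := cardsC_U1 h1; have := cardsC_U1 h2.
    rewrite [j |: (A :|: S)]setUCA; move: le.
    by move: #|~: (e |: _)| #|~: (A :|: (j |: S))| #|~: (A :|: S)| #|[set~ v0]| => a b c d; lia.
  rewrite big_split sumrB /= -mulr_sumr; apply: rpredD; last first.
    by apply: dvd_count_minor; rewrite // ?inE ?negb_or ?eA ?jA.
  apply: rpredB; first by rewrite dvdz_mulr.
  apply: IH => //.
  - by rewrite !inE negb_or ej.
  - by rewrite disjoint_sym disjoints_setU1r jS disjoint_sym.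
  - by rewrite -[(j |: A) :|: S]setUA -[j |: (A :|: S)]setUCA.
under eq_bigr => t _ do rewrite !tree_sum_upd ?yS //.
rewrite line_nonzeros2 -addrA; congr (_ + _).
have E := @tree_minor_sqr V n ends v0 F e j A y ej.
have nz : minor e j A y != 0 ->
    (tree_sum (e |: (j |: A)) y != 0) || (tree_sum (j |: A) y != 0).
  rewrite -negb_and; apply: contraNN => /andP[/eqP a0 /eqP c0].
  by rewrite -sqrf_eq0 E a0 c0 !mulr0 subrr.
have {}E : (tree_sum (e |: (j |: A)) y * tree_sum A y ==
    tree_sum (e |: A) y * tree_sum (j |: A) y) = (minor e j A y == 0).
  by rewrite -[RHS]sqrf_eq0 E subr_eq0 eq_sym [X in _ = (_ == X)]mulrC.
rewrite setUCA E; case: eqP nz => [_ _|_ -> //].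
by rewrite andbT addr0.
Qed.

Lemma dvd_count A S : [disjoint A & S] -> (#|~: (A :|: S)| + 2 <= r)%N ->
  (q ^+ 2 %| \sum_(x in affine S) (tree_sum A x != 0)%:R)%Z.
Proof.
elim/set_ind: S A => [|e S eS IH] A.
  rewrite affine0 big_set1 setU0 => _ le; rewrite tree_sum_at0_card ?eqxx //.
  by rewrite neq_ltn; move: le; rewrite addn2 => /ltnW ->.
rewrite disjoints_setU1r => /andP[eA dAS]; rewrite setUCA => le.
rewrite sum_affineU1 // (eq_bigr (fun y =>
    q * ((tree_sum (e |: A) y != 0) || (tree_sum A y != 0))%:R
    - (tree_sum (e |: A) y != 0)%:R)) => [|y /affineP yS]; last first.
  by rewrite -line_nonzeros; apply: eq_bigr => t _; rewrite tree_sum_upd ?yS.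
rewrite sumrB -mulr_sumr; apply: rpredB.
  by rewrite expr2 dvdz_mul // dvd_count_pair.
apply: IH; last by rewrite -setUA.
by rewrite disjoint_sym disjoints_setU1r eS disjoint_sym.
Qed.

Lemma minor_neq0 k j T : k != j -> k \notin T -> j \notin T ->
    spanning_tree G (k |: T) -> spanning_tree G (j |: T) ->
  minor k j (~: (k |: (j |: T))) 0 != 0.
Proof.
move=> kj kT jT tk tj; rewrite -sqrf_eq0 tree_minor_sqr //.
have E1 : ~: (k |: ~: (k |: (j |: T))) = j |: T.
  apply/setP=> e; rewrite !inE negb_or negbK.
  by case: (eqVneq e k) => [->|_] //=; rewrite (negPf kj) (negPf kT).
have E2 : ~: (j |: ~: (k |: (j |: T))) = k |: T.
  apply/setP=> e; rewrite !inE negb_or negbK.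
  by case: (eqVneq e j) => [->|_] //=; rewrite [_ == k]eq_sym (negPf kj) (negPf jT).
have E3 : ~: (k |: (j |: ~: (k |: (j |: T)))) = T.
  apply/setP=> e; rewrite !inE.
  case: (eqVneq e k) => [->|_] /=; first by rewrite (negPf kT).
  by case: (eqVneq e j) => [->|_] /=; rewrite ?(negPf jT) ?negbK.
rewrite !(@tree_sum_at0 (_ |: _)) E1 E2 E3 tk tj mulr1 spanning_tree_neq.
  by rewrite mulr0 subr0 oner_neq0.
by rewrite -(spanning_tree_card v0 tk) cardsU1 kT neq_ltn leqnn.
Qed.

(* K grows by one edge j at a time: a line in direction j on which vanishing (j |: K)
   fails contains at most one point with vanishing K, and none unless the minor of k
   and j is 0 there, for any k in K. *)
Definition vanishing K y :=
  [forall x : 'rV[F]_n, [forall i, (i \notin K) ==> (x 0 i == y 0 i)] ==> (tree_sum set0 x == 0)].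

Lemma vanishingP K y :
  reflect (forall x, (forall i, i \notin K -> x 0 i = y 0 i) -> tree_sum set0 x = 0)
          (vanishing K y).
Proof.
apply: (iffP forallP) => H x; first move=> Hx.
  have := H x; move=> /implyP/(_ _)/eqP; apply.
  by apply/forallP=> i; apply/implyP=> /Hx ->.
by apply/implyP=> /forallP Hx; apply/eqP/H => i iK; apply/eqP; have /implyP := Hx i; apply.
Qed.

Lemma vanishing_eq K y z : (forall i, i \notin K -> y 0 i = z 0 i) ->
  vanishing K y = vanishing K z.
Proof.
by move=> E; apply/vanishingP/vanishingP=> H x Hx; apply: H => i iK; rewrite Hx // E.
Qed.

Lemma setT_U1C e : setT = e |: ~: [set e].
Proof. by rewrite setUCr. Qed.

Lemma notin_C1 e : e \notin ~: [set e]. Proof. by rewrite !inE eqxx. Qed.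

Lemma vanishing_step K k j B : k \in K -> j \notin K ->
    B \subset ~: [set k; j] -> minor k j B 0 != 0 ->
  \sum_x (vanishing K x)%:R <= \sum_x (vanishing (j |: K) x)%:R + n%:R * q ^+ (n - 2) :> int.
Proof.
move=> kK jK BS m0; have kj : k != j by apply: contraNneq jK => <-.
have q0 : 0 <= q by [].
have toA (f : 'rV[F]_n -> int) : \sum_x f x = \sum_(y in affine (~: [set j])) \sum_t f (upd y j t).
  rewrite -sum_affineU1 ?notin_C1 // -setT_U1C affine_setT.
  by apply: eq_bigl => x; rewrite inE.
have jS : j \notin ~: [set j] := notin_C1 j.
have kS : k \notin ~: [set k; j] by rewrite !inE eqxx.
have Ej : ~: [set j] = k |: ~: [set k; j].
  by apply/setP=> e; rewrite !inE negb_or; case: (eqVneq e k) => [->|].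
have cS : #|~: [set k; j]| = (n - 2)%N.
  by rewrite [LHS]cardsCs setCK cards2 kj card_ord.
rewrite !toA.
apply: (@le_trans _ _ (\sum_(y in affine (~: [set j]))
   (q * (vanishing (j |: K) y)%:R + (minor k j set0 y == 0)%:R))).
  apply: ler_sum => y yS; have yj : y 0 j = 0 by move/affineP: yS; apply.
  case: (boolP (vanishing (j |: K) y)) => vy.
    rewrite mulr1; apply: le_trans (_ : q <= _); last by rewrite lerDl; case: (_ == _).
    rewrite -[leRHS]mulr1 -sum_cst; apply: ler_sum => t _; by case: (vanishing _ _).
  rewrite mulr0 add0r.
  case: (pickP (fun t => vanishing K (upd y j t))) => [t vt|no]; last first.
    by rewrite big1 => [|t _]; [case: (_ == _)|rewrite no].
  have line t' : vanishing K (upd y j t') -> forall x, (forall i, i \notin j |: K -> x 0 i = y 0 i) ->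
      tree_sum [set j] (zap [set j] x) * t' + tree_sum set0 (zap [set j] x) = 0.
    move=> /vanishingP H x Hx; rewrite -[[set j]]setU0 -tree_sum_upd ?inE //; last first.
      by rewrite zapE !inE eqxx.
    apply: H => i iK; rewrite !updE zapE !inE orbF; case: eqVneq => // ij.
    by apply: Hx; rewrite !inE negb_or ij.
  have uniq t' : vanishing K (upd y j t') -> t' = t.
    move=> vt'; apply/eqP; apply: contraNT vy => tt'; apply/vanishingP=> x Hx.
    have h1 := line t vt x Hx; have h2 := line t' vt' x Hx.
    have a0 : tree_sum [set j] (zap [set j] x) = 0.
      apply/eqP; have /eqP := congr2 (fun a b => a - b) h2 h1.
      rewrite subrr opprD addrACA subrr addr0 -mulrBr mulf_eq0 => /orP[//|].
      by rewrite subr_eq0 (negPf tt').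
    move: h1; rewrite a0 mul0r add0r => b0.
    have -> : x = upd (zap [set j] x) j (x 0 j).
      by apply/rowP=> i; rewrite updE zapE inE; case: eqVneq => [->|].
    rewrite tree_sum_upd ?inE //; last by rewrite zapE !inE eqxx.
    by rewrite setU0 a0 mul0r add0r.
  rewrite (bigD1 t) //= vt big1 ?addr0 => [|t' tt']; last first.
    by case: (boolP (vanishing _ _)) => // /uniq E; rewrite E eqxx in tt'.
  suff -> : minor k j set0 y == 0 by [].
  pose y0 := zap [set k] y.
  have y0j : y0 0 j = 0 by rewrite zapE yj; case: ifP.
  have y0k : y0 0 k = 0 by rewrite zapE !inE eqxx.
  have zapj (s : F) : zap [set j] (upd y0 k s) = upd y0 k s.
    apply/rowP=> i; rewrite zapE inE; case: eqVneq => // ->.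
    by rewrite updE eq_sym (negPf kj) y0j.
  have val s : tree_sum [set j] (upd y0 k s) * t + tree_sum set0 (upd y0 k s) = 0.
    rewrite -{1 2}zapj; apply: line => // i; rewrite !inE negb_or updE zapE inE => /andP[_ iK].
    by case: eqVneq => // ik; rewrite -ik (negPf iK) in kK.
  have vs s : (tree_sum (k |: [set j]) y0 * s + tree_sum [set j] y0) * t +
      (tree_sum [set k] y0 * s + tree_sum set0 y0) = 0.
    by rewrite -(val s) !tree_sum_upd ?inE // setU0.
  have -> : minor k j set0 y = minor k j set0 y0.
    apply: tree_minor_eq => // e _; rewrite !inE negb_or zapE inE => /andP[/negPf->] //.
  rewrite -sqrf_eq0 tree_minor_sqr // !setU0.
  have v0' := vs 0; have v1 := vs 1.
  have d0 : tree_sum set0 y0 = - (tree_sum [set j] y0 * t).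
    by apply/eqP; rewrite -addr_eq0 addrC -v0'; apply/eqP; ring.
  have c0 : tree_sum [set k] y0 = - (tree_sum (k |: [set j]) y0 * t).
    by apply/eqP; rewrite -addr_eq0 -[X in _ == X](subrr (0 : F)) -{1}v1 -v0'; apply/eqP; ring.
  by rewrite c0 d0; apply/eqP; ring.
rewrite big_split /= -mulr_sumr; apply: lerD.
  rewrite mulr_sumr; apply: ler_sum => y _; rewrite -sum_cst; apply: ler_sum => t _.
  rewrite (@vanishing_eq _ y (upd y j t)) // => i; rewrite !inE negb_or updE.
  by case/andP=> /negPf->.
rewrite Ej sum_affineU1_const // => [|y t _]; last first.
  congr (nat_of_bool (_ == _))%:R; apply: tree_minor_eq => // e _.
  by rewrite !inE negb_or updE => /andP[/negPf->].
rewrite -[leLHS]mulr_natl.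
have := @count_zeros_le _ _ _ _ (tree_minor_line kj) set0 (~: [set k; j]) B.
rewrite -setI_eq0 set0I eqxx set0U m0 => /(_ (subxx _) isT BS isT) h.
by apply: le_trans h _; rewrite cS ler_wpM2r ?exprn_ge0 // ler_nat leq_subr.
Qed.

End TreeCount.

Section Growth.
Variables (V : finType) (n : nat) (ends : 'I_n -> V * V).
Notation G := (whole_graph ends).
Hypothesis (simple : simple_graph G) (conn : vertex_connected 2 G).
Implicit Types (A B S T K : {set 'I_n}) (e i j k : 'I_n).

Lemma tree_exists v e : v \in endset G e -> exists T, spanning_tree G (e |: T).
Proof. by move=> ve; have [T [_ /(_ e ve)]] := tree_avoiding simple v conn; exists T. Qed.

Lemma adjacent_edge K k0 j0 : k0 \in K -> j0 \notin K ->
  exists v k j, [/\ k \in K, j \notin K, v \in endset G k & v \in endset G j].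
Proof.
move=> k0K j0K.
case: (pickP (fun p : V * 'I_n * 'I_n => [&& p.1.2 \in K, p.2 \notin K,
    p.1.1 \in endset G p.1.2 & p.1.1 \in endset G p.2])) => [[[v k] j] /and4P[] /= *|no].
  by exists v, k, j.
have {}no v k j : k \in K -> j \notin K -> v \in endset G k -> v \in endset G j -> False.
  by move=> h1 h2 h3 h4; have := no (v, k, j); rewrite /= h1 h2 h3 h4.
have e1 e : (ends e).1 \in endset G e by rewrite !inE eqxx.
have e2 e : (ends e).2 \in endset G e by rewrite !inE eqxx orbT.
have [T /and3P[_ /andP[_ /forall_inP sT] _]] := tree_exists (e1 k0).
pose U := [pred w | [exists k in K, w \in endset G k]].
have cl : closed (joined G (k0 |: T)) U.
  apply: intro_closed; first exact: joined_csym.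
  move=> x y /joinedP[e _ E] /existsP[k /andP[kK xk]]; rewrite inE.
  have [xe ye] : x \in endset G e /\ y \in endset G e.
    by split; rewrite !inE; case: E => ->; rewrite /= eqxx ?orbT.
  case: (boolP (e \in K)) => eK; last by case: (no x k e).
  by apply/existsP; exists e; rewrite eK.
have /forall_inP/(_ (ends j0).1) := sT (ends k0).1 (in_setT _).
rewrite in_setT => /(_ isT)/(closed_connect cl).
have -> : (ends k0).1 \in U by apply/existsP; exists k0; rewrite k0K e1.
by move/esym/existsP=> [k /andP[kK]] /(no _ _ _ kK j0K) /(_ (e1 _)).
Qed.

Section Bound.
Variables (v0 : V) (F : finFieldType).
Notation tree_sum := (@tree_sum V n ends F).
Notation r := #|[set~ v0]|.
Notation q := (#|F|%:R : int).
Notation affine := (@affine F n).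

Lemma edge_exists : exists e : 'I_n, True.
Proof.
case: (pickP (fun e : 'I_n => true)) => [e _|no]; first by exists e.
have [] := conn; rewrite cardsT => c /(_ set0); rewrite sub0set cards0 => /(_ isT isT).
case/andP=> _ /forall_inP /(_ v0); rewrite !inE => /(_ isT) /forall_inP H.
have [w wv] : exists w, w != v0.
  apply/existsP; apply: contraLR c => /existsPn h; rewrite -leqNgt.
  rewrite (_ : #|V| = 1)%N //; rewrite -cardsT -(cards1 v0); apply: eq_card => w.
  by rewrite !inE; apply/esym/negPn.
have := H w; rewrite !inE => /(_ isT)/connectP[[|x p]] /=; first by move=> _ E; rewrite E eqxx in wv.
by case/andP=> /joinedP[e]; have := no e.
Qed.

Lemma rank_ge2 : (2 <= r)%N.
Proof. by have [] := conn; rewrite cardsT cardsC1; case: #|V|. Qed.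

Lemma rank_le : (r <= n)%N.
Proof.
have [e _] := edge_exists; have [T /(spanning_tree_card v0) <-] := tree_exists (set21 _ _ : (ends e).1 \in endset G e).
by rewrite -[X in (_ <= X)%N]card_ord max_card.
Qed.

Lemma vanishing_le K k : k \in K ->
  \sum_x (vanishing ends (F := F) K x)%:R <= (n - #|K|)%:R * (n%:R * q ^+ (n - 2)) :> int.
Proof.
move: {2}(n - #|K|)%N (erefl (n - #|K|)%N) => m; elim: m K k => [|m IH] K k cK kK.
  have KT : K = setT.
    apply/eqP; rewrite eqEcard subsetT cardsT card_ord /=; move: cK; move: #|K| => c; lia.
  rewrite cK mul0r big1 // => x _; case: vanishingP => // H; exfalso.
  have [T tT] := tree_exists (set21 _ _ : (ends k).1 \in endset G k).
  have := @family_eq0 _ _ _ _ (tree_sum_line ends (F := F)) set0 setT.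
  rewrite subxx -setI_eq0 set0I eqxx => /(_ isT isT).
  have z x' : x' \in affine setT -> tree_sum set0 x' = 0.
    by move=> _; apply: H => i; rewrite KT inE.
  move=> /(_ z (~: (k |: T)) (subsetT _)); rewrite set0U tree_sum_at0 setCK tT.
  by move/eqP; rewrite oner_eq0.
have [j0 j0K] : exists j, j \notin K.
  apply/existsP; apply: contraPT cK => /existsPn h.
  rewrite (_ : K = setT) ?cardsT ?card_ord ?subnn //.
  by apply/setP=> e; rewrite inE; apply/negPn.
have [v [k' [j [kK' jK vk vj]]]] := adjacent_edge kK j0K.
have [T [Tv Tt]] := tree_avoiding simple v conn.
have kj : k' != j by apply: contraNneq jK => <-.
have kT : k' \notin T by apply: contraTN vk; apply: Tv.
have jT : j \notin T by apply: contraTN vj; apply: Tv.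
have m0 := minor_neq0 v0 F kj kT jT (Tt _ vk) (Tt _ vj).
have BS : ~: (k' |: (j |: T)) \subset ~: [set k'; j].
  by rewrite setCS; apply: setUS; apply: subsetUl.
apply: le_trans (vanishing_step kK' jK BS m0) _.
rewrite cK -natr1 mulrDl mul1r lerD2r.
have cj : (n - #|j |: K| = m)%N by rewrite cardsU1 jK; move: cK; move: #|K| => c; lia.
by have := IH _ k' cj; rewrite cj; apply; rewrite !inE kK' orbT.
Qed.

Lemma count_zeros_tree_sum :
  `|\sum_x (tree_sum set0 x == 0)%:R - q ^+ (n - 1)| <= n%:R ^+ 2 * q ^+ (n - 2) :> int.
Proof.
have n2 : (2 <= n)%N := leq_trans rank_ge2 rank_le.
have [e1 _] := edge_exists.
have [j0 j0e] : exists j, j \notin [set e1].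
  apply/existsP; apply: contraLR n2 => /existsPn h; rewrite -leqNgt -[n]card_ord -(cards1 e1).
  by apply: subset_leq_card; apply/subsetP=> e _; apply/negPn.
have [v [k [j [/set1P-> je vk vj]]]] := adjacent_edge (set11 e1) j0e.
have [T [Tv Tt]] := tree_avoiding simple v conn.
have e1T : e1 \notin T by apply: contraTN vk; apply: Tv.
set S := ~: [set e1].
have cS : #|S| = n.-1 by rewrite cardsC1 card_ord.
have toA (f : 'rV[F]_n -> int) : \sum_x f x = \sum_(y in affine S) \sum_t f (upd y e1 t).
  rewrite -sum_affineU1 ?notin_C1 // -setT_U1C affine_setT.
  by apply: eq_bigl => x; rewrite inE.
pose Z := \sum_(y in affine S) (tree_sum [set e1] y == 0)%:R : int.
pose W := \sum_x (vanishing ends (F := F) [set e1] x)%:R : int.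
have q0 : 0 <= q by [].
have E : \sum_x (tree_sum set0 x == 0)%:R - q ^+ (n - 1) = W - Z.
  rewrite subn1 -cS -sum_affine1 /W /Z !toA -!sumrB; apply: eq_bigr => y /affineP yS.
  have y1 : y 0 e1 = 0 by apply: yS; rewrite !inE eqxx.
  have -> : \sum_t (vanishing ends [set e1] (upd y e1 t))%:R =
      q * ((tree_sum [set e1] y == 0) && (tree_sum set0 y == 0))%:R.
    rewrite -sum_cst; apply: eq_bigr => t _; congr (nat_of_bool _)%:R.
    apply/vanishingP/andP=> [H|[/eqP a0 /eqP b0] x Hx].
      have b0 : tree_sum set0 y = 0.
        by apply: H => i; rewrite !inE updE => /negPf->.
      have : tree_sum set0 (upd y e1 1) = 0.
        by apply: H => i; rewrite !inE !updE => /negPf->.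
      by rewrite tree_sum_upd ?inE // setU0 b0 mulr1 addr0 => ->; rewrite eqxx.
    have -> : x = upd y e1 (x 0 e1).
      apply/rowP=> i; rewrite updE; case: eqVneq => [->//|ie].
      by rewrite Hx ?inE // updE (negPf ie).
    by rewrite tree_sum_upd ?inE // setU0 a0 b0 mul0r addr0.
  under eq_bigr => t _ do rewrite tree_sum_upd ?inE // setU0.
  rewrite line_zeros.
  by case: (tree_sum [set e1] y == 0); case: (tree_sum set0 y == 0);
    rewrite /= ?mulr1 ?mulr0 ?subrr ?sub0r ?subr0.
have W0 : 0 <= W by apply: sumr_ge0.
have Z0 : 0 <= Z by apply: sumr_ge0.
have qn : 0 <= q ^+ (n - 2) by apply: exprn_ge0.
have Wle : W <= n%:R ^+ 2 * q ^+ (n - 2).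
  apply: le_trans (vanishing_le (set11 e1)) _; rewrite expr2 -mulrA ler_wpM2r ?mulr_ge0 //.
  by rewrite ler_nat leq_subr.
have Zle : Z <= n%:R ^+ 2 * q ^+ (n - 2).
  have q1 : 0 < q by rewrite ltr0n; apply/card_gt0P; exists 0.
  have B0 : tree_sum ([set e1] :|: ~: (e1 |: (j |: T))) 0 != 0.
    suff E' : ~: ([set e1] :|: ~: (e1 |: (j |: T))) = j |: T.
      by rewrite tree_sum_at0 E' (Tt _ vj) oner_neq0.
    apply/setP=> e; rewrite !inE; case: (eqVneq e e1) => [->|_] /=; last by rewrite negbK.
    by rewrite (negPf e1T) orbF eq_sym; move: je; rewrite inE => /negPf->.
  have := count_zeros_le (tree_sum_line ends (F := F)) (subsetT S) _ _ B0.
  rewrite disjoints1 notin_C1 setCS subsetUl => /(_ isT isT); rewrite -/Z cS => h.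
  rewrite -(ler_pM2l q1); apply: le_trans h _.
  rewrite mulrCA -exprS (_ : (n - 2).+1 = n.-1)%N; last by lia.
  rewrite ler_wpM2r ?exprn_ge0 // -natrX ler_nat expnS expn1.
  by apply: leq_trans (leq_pred _) _; apply: leq_pmull; apply: leq_trans n2.
rewrite E ler_norml; apply/andP; split; lra.
Qed.

End Bound.
End Growth.

(** * Three-valent vertices *)

Section Pointwise.
Let bool_int : (false%:R = 0 :> int) * (true%:R = 1 :> int). Proof. by []. Qed.
Variable F : finFieldType.
Notation q := (#|F|%:R : int).
Notation nz x := ((x != 0%R)%R%:R : int).

Lemma quadric_nonzeros (a b c k d : F) : d ^+ 2 = b * c - a * k ->
  \sum_t \sum_u ((a * t + b) * u + (c * t + k) != 0)%R%:R =
  q ^+ 2 * [|| a != 0%R, b != 0%R, c != 0%R | k != 0%R]%:R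
  - q * (((a != 0%R) || (c != 0%R)) && (d == 0%R))%:R
  - q * ((a != 0%R) || (b != 0%R))%:R + nz a :> int.
Proof.
move=> E; under eq_bigr => t _ do rewrite line_nonzeros.
rewrite sumrB -mulr_sumr line_nonzeros2 line_nonzeros.
have -> : (a * k == b * c) = (d == 0).
  by rewrite -[RHS]sqrf_eq0 E subr_eq0 eq_sym.
by ring.
Qed.

(* f0, ..., k stand for the values of Psi_{-123}, Psi_{-1/23}, Psi_{-2/13}, Psi_{-3/12}
   and Psi_{/123}, and d for that of Delta. *)
Lemma star_nonzeros (f0 f1 f2 f3 k d : F) : d ^+ 2 = f1 * f2 - f0 * k ->
    f3 = f1 + f2 - d *+ 2 ->
  \sum_t3 \sum_t2 \sum_t1
    ((f0 * t2 + (f0 * t3 + f1)) * t1 + ((f0 * t3 + f2) * t2 + (f3 * t3 + k)) != 0)%R%:R =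
  q ^+ 3 * [|| f0 != 0%R, f1 != 0%R, f2 != 0%R | k != 0%R]%:R
  - q ^+ 2 * [|| f0 != 0%R, f1 != 0%R | f2 != 0%R]%:R :> int.
Proof.
move=> E E3.
have H t3 := @quadric_nonzeros f0 (f0 * t3 + f1) (f0 * t3 + f2) (f3 * t3 + k) (f0 * t3 + d).
under eq_bigr => t3 _.
  rewrite H; last first.
    transitivity ((f0 * t3) ^+ 2 + f0 * t3 * (d *+ 2) + d ^+ 2); first by ring.
    by rewrite E E3; ring.
  over.
case: (eqVneq f0 0) E {H} => [->|f00] E /=.
  under eq_bigr => t3 _ do rewrite mul0r !add0r addr0.
  rewrite mul0r subr0 in E.
  case: (eqVneq f1 0) E E3 => [->|f10] E E3 /=.
    rewrite mul0r in E; have d0 : d = 0 by apply/eqP; rewrite -sqrf_eq0 E.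
    rewrite d0 eqxx; case: (eqVneq f2 0) E3 => [->|f20] E3 /=.
      have -> : f3 = 0 by rewrite E3 d0; ring.
      by under eq_bigr => t3 _ do rewrite mul0r add0r; rewrite sum_cst ?bool_int; ring.
    by rewrite sum_cst ?bool_int; ring.
  case: (eqVneq f2 0) E => [->|f20] E /=.
    by rewrite sum_cst ?bool_int; ring.
  have /negPf-> : d != 0 by rewrite -sqrf_eq0 E mulf_neq0.
  by rewrite sum_cst ?bool_int; ring.
rewrite big_split /= sum_cst sumrB sum_cst sumrB sum_cst -mulr_sumr line_zeros (negPf f00).
by rewrite ?bool_int; ring.
Qed.

Lemma star_contract_nonzeros (f0 f1 f2 k d : F) : d ^+ 2 = f1 * f2 - f0 * k ->
  q ^+ 3 * [|| f0 != 0%R, f1 != 0%R, f2 != 0%R | k != 0%R]%:R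
  - q ^+ 2 * [|| f0 != 0%R, f1 != 0%R | f2 != 0%R]%:R =
  q * (q ^+ 2 * [|| f0 != 0%R, f1 != 0%R, f2 != 0%R | k != 0%R]%:R
       - q * (((f0 != 0%R) || (f2 != 0%R)) && (d == 0%R))%:R
       - q * ((f0 != 0%R) || (f1 != 0%R))%:R + nz f0)
  + q * (q * ((f0 != 0%R) || (d != 0%R))%:R - nz f0) - q ^+ 2 * nz d.
Proof.
case: (eqVneq f0 0) => [->|_] E /=.
  rewrite mul0r subr0 in E.
  have -> : (d == 0) = (f1 == 0) || (f2 == 0) by rewrite -sqrf_eq0 E mulf_eq0.
  by case: (f1 == 0); case: (f2 == 0) => /=; rewrite ?bool_int; ring.
by case: (d == 0) => /=; rewrite ?bool_int; ring.
Qed.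

(* p, s, t, a, d stand for the values of Psi_{-1234}, Psi_{-123/4}, Psi_{-24/13},
   Psi_{-4/123} and delta. *)
Lemma triangle_nonzeros (p s t a d : F) : d ^+ 2 = s * t - p * a ->
  \sum_x (q ^+ 3 * [|| p * x + s != 0, s * x != 0, t * x + a != 0 | a * x != 0]%R%:R
          - q ^+ 2 * [|| p * x + s != 0, s * x != 0 | t * x + a != 0]%R%:R) =
  q * (q - 2) * (\sum_x \sum_y ((p * x + s) * y + (t * x + a) != 0)%R%:R)
  + q * (q - 1) * (\sum_x (p * x + s != 0)%R%:R + \sum_x (p * x + t != 0)%R%:R)
  + q ^+ 2 * \sum_x (s * x + a != 0)%R%:R
  + q ^+ 2 * (nz p + nz s - ((p != 0%R) || (d != 0%R))%:R - ((s != 0%R) || (d != 0%R))%:R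
              - (q - 2) * nz d) :> int.
Proof.
move=> E; rewrite (quadric_nonzeros E) !line_nonzeros.
case: (eqVneq s 0) E => [->|s0] E /=.
  under eq_bigr => x _ do rewrite mul0r addr0 eqxx /=.
  have E3 : \sum_x ((p * x != 0) || (t * x + a != 0))%R%:R =
      q * [|| p != 0%R, t != 0%R | a != 0%R]%:R
      - (((p != 0%R) || (t != 0%R)) && (p * a == 0)%R)%:R :> int.
    under eq_bigr => x _ do rewrite -[p * x]addr0.
    by rewrite line_nonzeros2 eqxx mul0r.
  rewrite sumrB -!mulr_sumr E3; rewrite mul0r sub0r in E.
  have -> : \sum_x [|| (p * x != 0), (t * x + a != 0) | (a * x != 0)]%R%:R =
      (if a == 0%R then q * ((p != 0%R) || (t != 0%R))%:R - ((p != 0%R) || (t != 0%R))%:R else q) :> int.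
    case: (eqVneq a 0) E3 => [->|a0] _.
      under eq_bigr => x _ do rewrite mul0r eqxx orbF -[p * x]addr0.
      by rewrite line_nonzeros2 eqxx !orbF mulr0 mul0r eqxx andbT.
    rewrite -[RHS]mulr1 -sum_cst; apply: eq_bigr => x _.
    case: (eqVneq x 0) => [->|x0]; first by rewrite !mulr0 add0r a0 eqxx.
    by rewrite [a * x != 0]mulf_neq0 // !orbT.
  have -> : (p * a == 0) = (d == 0) by rewrite -[RHS]sqrf_eq0 E oppr_eq0.
  have {E} : (d == 0) = (p == 0) || (a == 0) by rewrite -[LHS]sqrf_eq0 E oppr_eq0 mulf_eq0.
  move=> ->; case: (p == 0); case: (t == 0); case: (a == 0) => /=; rewrite ?bool_int; ring.
under eq_bigr => x _.
  have -> : [|| p * x + s != 0, s * x != 0, t * x + a != 0 | a * x != 0].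
    case: (eqVneq x 0) => [->|x0]; first by rewrite mulr0 add0r s0.
    by rewrite [s * x != 0]mulf_neq0 // orbT.
  have -> : [|| p * x + s != 0, s * x != 0 | t * x + a != 0].
    case: (eqVneq x 0) => [->|x0]; first by rewrite mulr0 add0r s0.
    by rewrite [s * x != 0]mulf_neq0 // orbT.
  over.
rewrite sum_cst !orbT !mulr1 /=.
case: (eqVneq p 0) E => [->|p0] E /=.
  rewrite mul0r subr0 in E.
  have -> : (d == 0) = (t == 0) by rewrite -[LHS]sqrf_eq0 E mulf_eq0 (negPf s0).
  by case: (t == 0) => /=; rewrite ?bool_int; ring.
by case: (d == 0) => /=; rewrite ?bool_int; ring.
Qed.

End Pointwise.

Section Nbar.
Variables (F : finFieldType) (n : nat).
Notation q := (#|F|%:R : int).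
Notation affine := (@affine F n).
Implicit Types (S : {set 'I_n}) (p : {mpoly int[n]}) (fs : seq {mpoly int[n]}).

Definition point_count S (P : pred 'rV[F]_n) : int := \sum_(x in affine S) (P x)%:R.

Lemma card_field_gt1 : (1 < #|F|)%N.
Proof. by rewrite (cardD1 (0:F)) (cardD1 (1:F)) !inE oner_neq0. Qed.

Lemma card_field_neq1 : #|F|%:R - 1 != 0 :> rat.
Proof. by rewrite subr_eq0 pnatr_eq1 gtn_eqF ?card_field_gt1. Qed.

Lemma Nbar_count S fs P :
    (forall x, x \in affine S -> has (fun p => eval_at p x != 0) fs = P x) ->
  Nbar F S fs = (point_count S P)%:~R / (#|F|%:R - 1).
Proof.
move=> E; rewrite /Nbar; congr (_ / _).
have -> : point_count S P = q ^+ #|S| - (nb_zeros F S fs)%:R.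
  rewrite -sum_affine1 /nb_zeros -sum1_card natr_sum.
  under [X in _ - X]eq_bigl => x do rewrite inE.
  rewrite big_mkcondr -sumrB; apply: eq_bigr => x /E <-.
  by rewrite -(eq_all (fun p => negbK _)) all_predC; case: (has _ _).
by rewrite rmorphB rmorphXn /= !rmorph_nat.
Qed.

Lemma eq_point_count S (P Q : pred 'rV[F]_n) : {in affine S, P =1 Q} -> point_count S P = point_count S Q.
Proof. by move=> E; apply: eq_bigr => x /E ->. Qed.

Lemma Nbar_int S p d k : (0 < d)%N -> p \is d.-homog ->
    (q ^+ k %| point_count S (fun x => eval_at p x != 0%R))%Z ->
  exists w : int, Nbar F S [:: p] = (#|F|%:R ^+ k * w)%:~R.
Proof.
move=> d0 hp qk; pose c := point_count S (fun x => eval_at p x != 0).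
have E1 : Nbar F S [:: p] = c%:~R / (#|F|%:R - 1).
  by apply: Nbar_count => x _ /=; rewrite orbF.
have E2 : Nbar F S [:: p] = (#|proj_nonzeros F S [:: p]|%:Z)%:~R.
  by rewrite NbarE => // p'; rewrite inE => /eqP ->; exists d.
set z := #|proj_nonzeros F S [:: p]| in E2.
have Ec : c = z%:Z * (q - 1).
  apply: (@intr_inj rat); rewrite rmorphM rmorphB /= rmorph_nat -E2 E1 divfK //.
  exact: card_field_neq1.
have : (q ^+ k %| z%:Z)%Z.
  move: qk; rewrite -/c Ec Gauss_dvdzl // coprimezXl //.
  by apply/coprimezP; exists (1, -1); rewrite /=; ring.
case/dvdzP=> w Ew; exists w; rewrite E2 Ew; congr _%:~R; exact: mulrC.
Qed.

Lemma dvdz_mul_ex (a b : int) : (a %| b)%Z -> exists w, b = a * w.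
Proof. by case/dvdzP=> w ->; exists w; rewrite mulrC. Qed.

End Nbar.

Section GraphPolynomial.
Variables (V : finType) (n : nat) (ends : 'I_n -> V * V).
Notation G := (whole_graph ends).
Notation X := (edge_vars n).
Hypothesis (simple : simple_graph G) (conn : vertex_connected 2 G).
Implicit Types (A B S T : {set 'I_n}).

Lemma eval_tree_sum (F : finFieldType) A B (x : 'rV[F]_n) : (forall e, e \in B -> x 0 e = 0) ->
  eval_at (tree_sum ends A (zap B X)) x = tree_sum ends A x.
Proof.
move=> x0; rewrite eval_atE rmorph_tree_sum map_eval_vars; congr tree_sum.
by apply/rowP=> e; rewrite zapE; case: ifP => // /x0.
Qed.

Lemma eval_graph_poly (F : finFieldType) (x : 'rV[F]_n) :
  eval_at (graph_poly G) x = tree_sum ends set0 x.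
Proof.
rewrite graph_polyE -(@eval_tree_sum _ _ set0) => [|e]; last by rewrite inE.
by congr eval_at; congr tree_sum; apply/rowP=> e; rewrite zapE inE.
Qed.

Variable v0 : V.
Notation r := #|[set~ v0]|.

Lemma rank_lt : (r < n)%N.
Proof.
have n2 : (2 <= n)%N := leq_trans (rank_ge2 conn v0) (rank_le simple conn v0).
have [e1 _] := edge_exists conn v0.
have [j0 j0e] : exists j, j \notin [set e1].
  apply/existsP; apply: contraLR n2 => /existsPn h; rewrite -leqNgt -[n]card_ord -(cards1 e1).
  by apply: subset_leq_card; apply/subsetP=> e _; apply/negPn.
have [v [k [j [/set1P-> je vk vj]]]] := adjacent_edge simple conn (set11 e1) j0e.
have [T [Tv Tt]] := tree_avoiding simple v conn.
rewrite -(spanning_tree_card v0 (Tt _ vj)) -[X in (_ < X)%N]card_ord -cardsT.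
apply: proper_card; apply/properP; split; first exact: subsetT.
exists e1; rewrite ?inE // negb_or eq_sym; apply/andP; split; last by apply: contraTN vk; apply: Tv.
by move: je; rewrite inE.
Qed.

Lemma graph_poly_homog : graph_poly G \is (n - r).-homog.
Proof.
have := tree_sum_homog ends v0 set0 set0; rewrite cards0 addn0 graph_polyE.
by rewrite (_ : zap set0 X = X) //; apply/rowP=> e; rewrite zapE inE.
Qed.

Lemma Nbar_graph_poly_congr (F : finFieldType) :
  congr_int (#|F| ^ 2) (Nbar F setT [:: graph_poly G]) 0.
Proof.
have [||w Ew] := @Nbar_int F n setT (graph_poly G) (n - r) 2 _ graph_poly_homog.
- by rewrite subn_gt0 rank_lt.
- rewrite (@eq_point_count _ _ _ _ (fun x => tree_sum ends set0 x != 0)) => [|x _]; last first.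
    by rewrite /= eval_graph_poly.
  apply: (@dvd_count V n ends v0 F set0 setT); first by rewrite -setI_eq0 set0I.
  by rewrite setUT setCT cards0 (rank_ge2 conn v0).
by exists w; rewrite subr0 Ew -natz natrX.
Qed.

Lemma Nbar_graph_poly (F : finFieldType) :
  Nbar F setT [:: graph_poly G] =
  (point_count setT (fun x : 'rV[F]_n => tree_sum ends set0 x != 0))%:~R / (#|F|%:R - 1).
Proof. by apply: Nbar_count => x _ /=; rewrite orbF eval_graph_poly. Qed.

Lemma Nbar_graph_poly_bound (F : finFieldType) :
  `|Nbar F setT [:: graph_poly G] - #|F|%:R ^+ (n - 1)|
    <= 2 * n%:R ^+ 2 * #|F|%:R ^+ (n - 3) :> rat.
Proof.
have n2 : (2 <= n)%N := leq_trans (rank_ge2 conn v0) (rank_le simple conn v0).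
set Z := \sum_x (tree_sum (R := F) ends set0 x == 0)%:R : int.
have EZ : point_count setT (fun x : 'rV[F]_n => tree_sum ends set0 x != 0) = #|F|%:R ^+ n - Z.
  have <- : \sum_(x : 'rV[F]_n) 1 = #|F|%:R ^+ n :> int.
    have := @sum_affine1 F n setT; rewrite affine_setT cardsT card_ord => <-.
    by apply: eq_bigl => x; rewrite inE.
  rewrite /point_count affine_setT /Z -sumrB; under eq_bigl => x do rewrite inE.
  by apply: eq_bigr => x _; case: (_ == 0).
have := count_zeros_tree_sum simple conn v0 F; rewrite -/Z => hZ.
have q1 : 0 < #|F|%:R - 1 :> rat by rewrite subr_gt0 ltr1n card_field_gt1.
have q2 : 2 <= #|F|%:R :> rat by rewrite ler_nat card_field_gt1.
rewrite Nbar_graph_poly EZ.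
have -> : (#|F|%:R ^+ n - Z)%:~R / (#|F|%:R - 1) - #|F|%:R ^+ (n - 1) =
    - (Z - #|F|%:R ^+ (n - 1))%:~R / (#|F|%:R - 1) :> rat.
  rewrite !rmorphB !rmorphXn /= !rmorph_nat.
  rewrite (_ : #|F|%:R ^+ n = #|F|%:R * #|F|%:R ^+ (n - 1)); last first.
    by rewrite -exprS subn1 prednK //; apply: leq_trans n2.
  by field; apply: card_field_neq1.
rewrite normrM normrN normfV (gtr0_norm q1) ler_pdivrMr // -intr_norm.
apply: (@le_trans _ _ ((n%:R ^+ 2 * #|F|%:R ^+ (n - 2) : int)%:~R)); first by rewrite ler_int.
rewrite rmorphM !rmorphXn /= !rmorph_nat.
rewrite [leRHS](_ : _ = n%:R ^+ 2 * (#|F|%:R ^+ (n - 3) * (2 * (#|F|%:R - 1)))); last by ring.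
apply: ler_wpM2l; first by rewrite exprn_ge0.
have q0 : 0 <= #|F|%:R ^+ (n - 3) :> rat by apply: exprn_ge0.
case: (ltnP 2 n) => n3.
  rewrite (_ : n - 2 = (n - 3).+1)%N; last by lia.
  by rewrite exprSr; apply: ler_wpM2l => //; lra.
have -> : (n - 2 = 0)%N by lia.
have -> : (n - 3 = 0)%N by lia.
by rewrite !expr0; lra.
Qed.

End GraphPolynomial.

Lemma disjoints2 (T : finType) (a b : T) (B : {set T}) :
  [disjoint [set a; b] & B] = (a \notin B) && (b \notin B).
Proof. by rewrite disjoint_sym disjoints_setU1r disjoint_sym disjoints1. Qed.

Lemma three_valent_neq (V : finType) (n : nat) (ends : 'I_n -> V * V) v e1 e2 e3 :
    simple_graph (whole_graph ends) -> three_valent (whole_graph ends) v e1 e2 e3 ->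
  ((e1 == e2) = false) * ((e1 == e3) = false) * ((e2 == e3) = false) *
  ((e2 == e1) = false) * ((e3 == e1) = false) * ((e3 == e2) = false).
Proof.
move=> simple tv; have [[/negPf e12 /negPf e13 /negPf e23] _ _] := three_valentP simple tv.
by rewrite ![e2 == e1]eq_sym ![e3 == _]eq_sym e12 e13 e23.
Qed.

Section Star.
Variables (V : finType) (n : nat) (ends : 'I_n -> V * V) (v v0 : V) (e1 e2 e3 : 'I_n).
Notation G := (whole_graph ends).
Notation X := (edge_vars n).
Notation r := #|[set~ v0]|.
Notation S := (~: [set e1; e2; e3]).
Notation Gv := (delete_verts [set v] G).
Hypothesis (simple : simple_graph G) (conn : vertex_connected 2 G).
Hypothesis (tv : three_valent G v e1 e2 e3) (vv0 : v0 != v).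
Implicit Types (A B T : {set 'I_n}).
Notation ts := (tree_sum ends).

Let eE := (three_valent_neq simple tv, eqxx).

Let incE e : (v \in endset G e) = (e \in [set e1; e2; e3]).
Proof. by case: (three_valentP simple tv) => _ /(_ e). Qed.

Let ST1 : setT = e1 |: (e2 |: (e3 |: S)).
Proof. by apply/setP=> e; rewrite !inE; case: (e == e1); case: (e == e2); case: (e == e3). Qed.
Let ST3 : ~: [set e3] = e1 |: (e2 |: S).
Proof.
apply/setP=> e; rewrite !inE; case: (eqVneq e e1) => [->|_]; rewrite ?eE //.
by case: (eqVneq e e2) => [->|_]; rewrite ?eE.
Qed.
Let ST12 : ~: [set e1; e2] = e3 |: S.
Proof.
apply/setP=> e; rewrite !inE; case: (eqVneq e e3) => [->|_]; rewrite ?eE //.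
by rewrite !orbF.
Qed.
Let notin3 : e3 \notin S. Proof. by rewrite !inE eqxx !orbT. Qed.
Let notin2 : e2 \notin e3 |: S. Proof. by rewrite !inE ?eE !orbT. Qed.
Let notin2' : e2 \notin S. Proof. by rewrite !inE ?eE !orbT. Qed.
Let notin1 : e1 \notin e2 |: (e3 |: S). Proof. by rewrite !inE ?eE. Qed.
Let notin1' : e1 \notin e2 |: S. Proof. by rewrite !inE ?eE. Qed.

Lemma tree_meets_star T : spanning_tree G T -> ~~ [disjoint T & [set e1; e2; e3]].
Proof.
case/and3P=> _ /andP[_ /forall_inP sT] _; apply/negP=> dT.
have Tv f : f \in T -> v \notin endset G f by move=> fT; rewrite incE (disjointFr dT).
have /forall_inP/(_ v0) := sT v (in_setT _); rewrite in_setT => /(_ isT).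
by move=> /(connect_isolated Tv) E; move: vv0; rewrite E eqxx.
Qed.

Section Values.
Variable R : comNzRingType.
Implicit Type y : 'rV[R]_n.

Lemma star_tree_sum0 A y : [set e1; e2; e3] \subset A -> ts A y = 0.
Proof.
move=> sA; rewrite /tree_sum big1 // => T /andP[/tree_meets_star/negP h dTA]; case: h.
by apply: disjointWr dTA.
Qed.

Lemma star_tree_sum_swap A1 A2 y : A1 \subset [set e1; e2; e3] -> A2 \subset [set e1; e2; e3] ->
    #|A1| = 2 -> #|A2| = 2 -> (forall e, e \in [set e1; e2; e3] -> y 0 e = 0) ->
  ts A1 y = ts A2 y.
Proof.
move=> s1 s2 c1 c2 y0; apply: (tree_sum_swap s1 s2 y0) => T dT.
have Tv f : f \in T -> v \notin endset G f by move=> fT; rewrite incE (disjointFr dT).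
have H A : A \subset [set e1; e2; e3] -> #|A| = 2 ->
    spanning_tree G (T :|: ([set e1; e2; e3] :\: A)) = spanning_tree Gv T.
  move=> sA cA; have : #|[set e1; e2; e3] :\: A| == 1%N.
    have := cardsID A [set e1; e2; e3]; rewrite (setIidPr sA) cA.
    rewrite [#|[set e1; e2; e3]|](_ : _ = 3)%N; last first.
      by rewrite -setUA !cardsU1 cards1 !inE !eE.
    by move=> /eqP; rewrite -[3%N]/(2 + 1)%N eqn_add2l.
  case/cards1P=> e Ee; rewrite Ee setUC; apply/esym/spanning_tree_removed => //.
  have : e \in [set e1; e2; e3] :\: A by rewrite Ee inE.
  by rewrite incE inE => /andP[].
by rewrite !H.
Qed.

End Values.

Section Count.
Variable F : finFieldType.
Notation q := (#|F|%:R : int).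
Implicit Type y : 'rV[F]_n.

Let zero y : y \in affine F S -> forall e, e \in [set e1; e2; e3] -> y 0 e = 0.
Proof. by move=> /affineP H e eE'; apply: H; rewrite inE negbK. Qed.

Lemma contract_value y t1 t2 : y \in affine F S ->
  ts set0 (upd (upd y e2 t2) e1 t1) =
  (ts [set e1; e2] y * t2 + ts [set e1] y) * t1 + (ts [set e2] y * t2 + ts set0 y).
Proof.
move=> yS; have z := zero yS.
have z1 : y 0 e1 = 0 by apply: z; rewrite !inE !eE.
have z2 : y 0 e2 = 0 by apply: z; rewrite !inE !eE.
rewrite tree_sum_upd ?inE //; last by rewrite updE eE.
by rewrite !setU0 !tree_sum_upd ?inE ?eE // !setU0 [e2 |: [set e1]]setUC.
Qed.

Lemma star_value y t1 t2 t3 : y \in affine F S ->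
  ts set0 (upd (upd (upd y e3 t3) e2 t2) e1 t1) =
  (ts [set e1; e2] y * t2 + (ts [set e1; e2] y * t3 + ts [set e1] y)) * t1
  + ((ts [set e1; e2] y * t3 + ts [set e2] y) * t2 + (ts [set e3] y * t3 + ts set0 y)).
Proof.
move=> yS; have z := zero yS.
have z1 : y 0 e1 = 0 by apply: z; rewrite !inE !eE.
have z2 : y 0 e2 = 0 by apply: z; rewrite !inE !eE.
have z3 : y 0 e3 = 0 by apply: z; rewrite !inE !eE.
have sw A : A \subset [set e1; e2; e3] -> #|A| = 2 -> ts A y = ts [set e1; e2] y.
  move=> sA cA; apply: star_tree_sum_swap => //; last by rewrite cards2 eE.
  by apply/subsetP=> e; rewrite !inE => ->.
rewrite tree_sum_upd ?inE //; last by rewrite !updE ?eE.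
rewrite setU0 !tree_sum_upd ?inE ?updE ?eE //.
rewrite !setU0 star_tree_sum0; last first.
  by apply/subsetP=> e; rewrite !inE; case: (e == e1); case: (e == e2); case: (e == e3).
rewrite mul0r add0r (sw (e3 |: [set e1])); first last.
- by rewrite cards2 eE.
- by apply/subsetP=> e; rewrite !inE; case: (e == e1); case: (e == e3); rewrite ?orbT.
rewrite (sw (e3 |: [set e2])); first last.
- by rewrite cards2 eE.
- by apply/subsetP=> e; rewrite !inE; case: (e == e2); case: (e == e3); rewrite ?orbT.
by rewrite [e2 |: [set e1]]setUC.
Qed.

Variable s : int.
Hypothesis s1 : s ^+ 2 = 1.
Hypothesis sD : forall (R : comNzRingType) A (x : 'rV[R]_n), [disjoint A & [set e1; e2; e3]] ->
      (s%:~R * tree_minor ends v0 e1 e2 A x) *+ 2 =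
      ts (e1 |: A) x + ts (e2 |: A) x - ts (e3 |: A) x.

Definition signed_minor A y : F := s%:~R * tree_minor ends v0 e1 e2 A y.

Lemma signed_minor_sqr A y :
  signed_minor A y ^+ 2 = ts (e1 |: A) y * ts (e2 |: A) y - ts A y * ts (e1 |: (e2 |: A)) y.
Proof.
by rewrite /signed_minor exprMn -rmorphXn /= s1 mul1r tree_minor_sqr // eE.
Qed.

Lemma signed_minor0_sqr y :
  signed_minor set0 y ^+ 2 = ts [set e1] y * ts [set e2] y - ts [set e1; e2] y * ts set0 y.
Proof. by rewrite signed_minor_sqr !setU0 [ts set0 y * _]mulrC. Qed.

Lemma signed_minor0_double y :
  ts [set e3] y = ts [set e1] y + ts [set e2] y - signed_minor set0 y *+ 2.
Proof.
rewrite sD; last by rewrite -setI_eq0 set0I.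
by rewrite !setU0 opprB addrCA subrr addr0.
Qed.

Lemma count_star :
  point_count setT (fun x : 'rV[F]_n => ts set0 x != 0) =
  \sum_(y in affine F S)
    (q ^+ 3 * [|| ts [set e1; e2] y != 0, ts [set e1] y != 0, ts [set e2] y != 0
              | ts set0 y != 0]%:R
     - q ^+ 2 * [|| ts [set e1; e2] y != 0, ts [set e1] y != 0 | ts [set e2] y != 0]%:R).
Proof.
rewrite /point_count ST1 !sum_affineU1 //; apply: eq_bigr => y yS.
rewrite -(star_nonzeros (signed_minor0_sqr y) (signed_minor0_double y)).
by do 3! (apply: eq_bigr => ? _); rewrite star_value.
Qed.

Lemma count_star_contract :
  point_count setT (fun x : 'rV[F]_n => ts set0 x != 0) =
  q * point_count (~: [set e3]) (fun x : 'rV[F]_n => ts set0 x != 0)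
  + q * point_count (~: [set e1; e2]) (fun x : 'rV[F]_n =>
          ts [set e1; e2] (zap [set e3] x) * x 0 e3 + signed_minor set0 (zap [set e1; e2; e3] x) != 0)
  - q ^+ 2 * point_count S (fun x : 'rV[F]_n => signed_minor set0 x != 0).
Proof.
rewrite count_star /point_count ST3 ST12 !sum_affineU1 // !mulr_sumr -big_split -sumrB /=.
apply: eq_bigr => y yS; rewrite (star_contract_nonzeros (signed_minor0_sqr y)) -(quadric_nonzeros (signed_minor0_sqr y)).
congr (_ * _ + _ * _ - _).
  by do 2! (apply: eq_bigr => ? _); rewrite contract_value.
rewrite -line_nonzeros; apply: eq_bigr => t _.
have -> : zap [set e3] (upd y e3 t) = y.
  apply/rowP=> i; rewrite zapE inE updE; case: eqVneq => // ->.
  by rewrite (zero yS) // !inE eqxx !orbT.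
have -> : zap [set e1; e2; e3] (upd y e3 t) = y.
  apply/rowP=> i; rewrite zapE updE; case: ifP => [/(zero yS)//|].
  by rewrite !inE; case: (eqVneq i e3) => [_|//]; rewrite orbT.
by rewrite updE eqxx.
Qed.

Lemma count_signed_minor :
  point_count (~: [set e1; e2]) (fun x : 'rV[F]_n =>
     ts [set e1; e2] (zap [set e3] x) * x 0 e3 + signed_minor set0 (zap [set e1; e2; e3] x) != 0) =
  q * point_count S (fun x : 'rV[F]_n => (ts [set e1; e2] x != 0) || (signed_minor set0 x != 0))
  - point_count S (fun x : 'rV[F]_n => ts [set e1; e2] x != 0).
Proof.
rewrite /point_count ST12 sum_affineU1 // mulr_sumr -sumrB; apply: eq_bigr => y yS.
rewrite -line_nonzeros; apply: eq_bigr => t _.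
have -> : zap [set e3] (upd y e3 t) = y.
  apply/rowP=> i; rewrite zapE inE updE; case: eqVneq => // ->.
  by rewrite (zero yS) // !inE eqxx !orbT.
have -> : zap [set e1; e2; e3] (upd y e3 t) = y.
  apply/rowP=> i; rewrite zapE updE; case: ifP => [/(zero yS)//|].
  by rewrite !inE; case: (eqVneq i e3) => [_|//]; rewrite orbT.
by rewrite updE eqxx.
Qed.

Section Triangle.
Variable e4 : 'I_n.
Hypothesis tri : triangle G e2 e3 e4.
Notation S4 := (~: [set e1; e2; e3; e4]).
Notation Z := [set e1; e2; e3; e4].

Let e4v : v \notin endset G e4 /\ [/\ connect (joined G [set e3; e4]) (ends e2).1 (ends e2).2
  & connect (joined G [set e3; e2]) (ends e4).1 (ends e4).2].
Proof.
case: tri => _ [x [y [z [un [E2 E3 E4]]]]].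
have xy : x != y by move: un; rewrite /= inE negb_or => /andP[/andP[]].
have xz : x != z by move: un; rewrite /= !inE negb_or => /andP[/andP[]].
have yz : y != z by move: un; rewrite /= !inE => /andP[_ /andP[]].
have v2 : v \in endset G e2 by rewrite incE !inE eqxx orbT.
have v3 : v \in endset G e3 by rewrite incE !inE eqxx !orbT.
have vy : v = y.
  move: v2 v3; rewrite E2 E3 !inE => /orP[] /eqP -> //.
  by rewrite (negPf xy) (negPf xz).
split.
  by rewrite E4 vy !inE negb_or yz eq_sym.
have conn_ends e a b B : a != b -> endset G e = [set a; b] -> connect (joined G B) a b ->
    connect (joined G B) (ends e).1 (ends e).2.
  move=> ab Ee c; have ba : b != a by rewrite eq_sym.
  by case: (leaf_ends ba Ee) => /= -> //; rewrite joined_csym.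
split.
  apply: (conn_ends _ x y) => //; apply: (@connect_trans _ _ z).
    by apply: (@connect_endset _ _ _ _ e4); rewrite ?inE ?eqxx ?orbT // E4 setUC.
  by apply: (@connect_endset _ _ _ _ e3); rewrite ?inE ?eqxx 1?eq_sym // E3 setUC.
apply: (conn_ends _ z x) => //; first by rewrite eq_sym.
apply: (@connect_trans _ _ y).
  by apply: (@connect_endset _ _ _ _ e3); rewrite ?inE ?eqxx 1?eq_sym // E3 setUC.
by apply: (@connect_endset _ _ _ _ e2); rewrite ?inE ?eqxx ?orbT 1?eq_sym // E2 setUC.
Qed.

Lemma triangle_notin_endset : v \notin endset G e4. Proof. by case: e4v. Qed.

Let e4n : e4 \notin [set e1; e2; e3]. Proof. by rewrite -incE triangle_notin_endset. Qed.
Let e41 : (e4 == e1) = false. Proof. by move: e4n; rewrite !inE => /norP[/norP[/negPf]]. Qed.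
Let e42 : (e4 == e2) = false. Proof. by move: e4n; rewrite !inE => /norP[/norP[_ /negPf]]. Qed.
Let e43 : (e4 == e3) = false. Proof. by move: e4n; rewrite !inE => /norP[_ /negPf]. Qed.
Let e14 : (e1 == e4) = false. Proof. by rewrite eq_sym. Qed.
Let e24 : (e2 == e4) = false. Proof. by rewrite eq_sym. Qed.
Let e34 : (e3 == e4) = false. Proof. by rewrite eq_sym. Qed.
Let eE4 := (three_valent_neq simple tv, e41, e42, e43, e14, e24, e34, eqxx).

Let swap T : [disjoint T & [set e2; e3; e4]] ->
  spanning_tree G (T :|: [set e3; e4]) = spanning_tree G (T :|: [set e2; e3]).
Proof.
move=> dT; have nT e : e \in [set e2; e3; e4] -> e \notin T by move=> h; rewrite (disjointFl dT).
have [_ [c2 c4]] := e4v.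
have n2 : e2 \notin T by apply: nT; rewrite !inE eqxx.
have n3 : e3 \notin T by apply: nT; rewrite !inE eqxx orbT.
have n4 : e4 \notin T by apply: nT; rewrite !inE eqxx orbT.
apply/idP/idP=> h.
  rewrite [[set e2; e3]]setUC; rewrite [[set e3; e4]]setUC in h.
  by apply: (@spanning_tree_swap _ _ _ _ e4 e3 e2); rewrite ?eE4.
by apply: (@spanning_tree_swap _ _ _ _ e2 e3 e4); rewrite ?eE4.
Qed.

Lemma no_tree_triangle T : spanning_tree G T -> ~~ ([set e2; e3; e4] \subset T).
Proof.
case/and3P=> _ _ /acyclicP aT; apply/negP=> /subsetP sT.
have e2T : e2 \in T by apply: sT; rewrite !inE eqxx.
have [_ [c2 _]] := e4v; case/negP: (aT e2 e2T); move: c2; apply: connect_joinedS.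
apply/subsetP=> e he; have eT : e \in T by apply: sT; move: he; rewrite !inE => /orP[] ->; rewrite ?orbT.
by rewrite !inE eT andbT; move: he; rewrite !inE => /orP[] /eqP ->; rewrite ?eE4.
Qed.

Ltac by_edges e :=
  let E := fresh "E" in
  case: (eqVneq e e1) => [E|_]; [by rewrite ?E ?eE4 /= ?orbT ?orbF ?andbF|];
  case: (eqVneq e e2) => [E|_]; [by rewrite ?E ?eE4 /= ?orbT ?orbF ?andbF|];
  case: (eqVneq e e3) => [E|_]; [by rewrite ?E ?eE4 /= ?orbT ?orbF ?andbF|];
  case: (eqVneq e e4) => [E|_]; by rewrite ?E ?eE4 /= ?orbT ?orbF ?andbF.

Section TriangleValues.
Variable R : comNzRingType.
Variable y : 'rV[R]_n.
Hypothesis y0 : forall e, e \in Z -> y 0 e = 0.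

Lemma triangle_swap12 : ts [set e1; e2] y = ts [set e1; e4] y.
Proof.
apply: (tree_sum_swap (Z := Z)) => //.
- by apply/subsetP=> e; rewrite !inE; by_edges e.
- by apply/subsetP=> e; rewrite !inE; by_edges e.
move=> T dT; have -> : Z :\: [set e1; e2] = [set e3; e4].
  by apply/setP=> e; rewrite !inE; by_edges e.
have -> : Z :\: [set e1; e4] = [set e2; e3].
  by apply/setP=> e; rewrite !inE; by_edges e.
apply: swap; apply: disjointWr dT; apply/subsetP=> e; rewrite !inE; by_edges e.
Qed.

Lemma triangle_swap2 : ts [set e2] y = ts [set e4] y.
Proof.
apply: (tree_sum_swap (Z := Z)) => //.
- by apply/subsetP=> e; rewrite !inE; by_edges e.
- by apply/subsetP=> e; rewrite !inE; by_edges e.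
move=> T dT; have -> : T :|: (Z :\: [set e2]) = (e1 |: T) :|: [set e3; e4].
  by apply/setP=> e; rewrite !inE; by_edges e.
have -> : T :|: (Z :\: [set e4]) = (e1 |: T) :|: [set e2; e3].
  by apply/setP=> e; rewrite !inE; by_edges e.
apply: swap; rewrite disjoint_sym disjoints_setU1r !inE !eE4 /= disjoint_sym.
apply: disjointWr dT; apply/subsetP=> e; rewrite !inE; by_edges e.
Qed.

Lemma triangle_eq0 A : [disjoint A & [set e2; e3; e4]] -> ts A y = 0.
Proof.
move=> dA; apply: (tree_sum_eq0 dA); last exact: no_tree_triangle.
move=> e; rewrite !inE => h; apply: y0; move: h; rewrite !inE.
by case: (e == e2); case: (e == e3); case: (e == e4); rewrite ?orbT.
Qed.

End TriangleValues.

Let S4E : S = e4 |: S4.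
Proof.
apply/setP=> e; rewrite !inE; case: (eqVneq e e4) => [->|_]; rewrite ?eE4 //.
by rewrite !orbF.
Qed.
Let S23E : ~: [set e2; e3] = e1 |: (e4 |: S4).
Proof.
apply/setP=> e; rewrite !inE; case: (eqVneq e e1) => [->|_]; rewrite ?eE4 //=.
by case: (eqVneq e e4) => [->|_]; rewrite ?eE4 ?orbF.
Qed.
Let S234E : ~: [set e2; e3; e4] = e1 |: S4.
Proof. by apply/setP=> e; rewrite !inE; case: (eqVneq e e1) => [->|_]; rewrite ?eE4. Qed.
Let n4 : e4 \notin S4. Proof. by rewrite !inE eqxx !orbT. Qed.
Let n1 : e1 \notin S4. Proof. by rewrite !inE eqxx. Qed.
Let n14 : e1 \notin e4 |: S4. Proof. by rewrite !inE ?eE4. Qed.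

Let yv y : y \in affine F S4 ->
  [/\ (signed_minor [set e4] y) ^+ 2 = ts [set e1; e2] y * ts [set e2; e4] y - ts [set e1; e2; e4] y * ts [set e2] y,
      (forall x, ts [set e1; e2] (upd y e4 x) = ts [set e1; e2; e4] y * x + ts [set e1; e2] y),
      (forall x, ts [set e1] (upd y e4 x) = ts [set e1; e2] y * x),
      (forall x, ts [set e2] (upd y e4 x) = ts [set e2; e4] y * x + ts [set e2] y) &
      (forall x, ts set0 (upd y e4 x) = ts [set e2] y * x)].
Proof.
move=> /affineP yS.
have y0 e : e \in Z -> y 0 e = 0 by move=> eZ; apply: yS; rewrite inE negbK.
have y1 : y 0 e1 = 0 by apply: y0; rewrite !inE !eE4.
have y4 : y 0 e4 = 0 by apply: y0; rewrite !inE !eE4.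
split=> [|x|x|x|x].
- rewrite signed_minor_sqr triangle_swap12 // triangle_swap2 // [ts [set e4] y * _]mulrC.
  by rewrite setUA.
- by rewrite tree_sum_upd ?inE ?eE4 // setUC.
- rewrite tree_sum_upd ?inE ?eE4 // [ts [set e1] y]triangle_eq0 ?addr0; first last.
  + by rewrite disjoints1 !inE !eE4.
  + by [].
  by rewrite setUC triangle_swap12.
- by rewrite tree_sum_upd ?inE ?eE4 // setUC.
- rewrite tree_sum_upd ?inE // [ts set0 y]triangle_eq0 ?addr0; first last.
  + by rewrite -setI_eq0 set0I.
  + by [].
  by rewrite setU0 triangle_swap2.
Qed.

Lemma count_triangle :
  point_count setT (fun x : 'rV[F]_n => ts set0 x != 0) =
  q * (q - 2) * point_count (~: [set e2; e3]) (fun x : 'rV[F]_n => ts [set e2] x != 0)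
  + q * (q - 1) * (point_count S (fun x : 'rV[F]_n => ts [set e1; e2] x != 0)
      + point_count (~: [set e2; e3; e4]) (fun x : 'rV[F]_n => ts [set e2; e4] x != 0))
  + q ^+ 2 * point_count (~: [set e2; e3; e4]) (fun x : 'rV[F]_n => ts [set e2] x != 0)
  + q ^+ 2 * (point_count S4 (fun x : 'rV[F]_n => ts [set e1; e2; e4] x != 0)
      + point_count S4 (fun x : 'rV[F]_n => ts [set e1; e2] x != 0)
      - point_count S4 (fun x : 'rV[F]_n => (ts [set e1; e2; e4] x != 0) || (signed_minor [set e4] x != 0))
      - point_count S4 (fun x : 'rV[F]_n => (ts [set e1; e2] x != 0) || (signed_minor [set e4] x != 0))
      - (q - 2) * point_count S4 (fun x : 'rV[F]_n => signed_minor [set e4] x != 0)).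
Proof.
rewrite count_star /point_count S4E S23E S234E !sum_affineU1 //.
pose p y := ts [set e1; e2; e4] y; pose s' y := ts [set e1; e2] y.
pose t' y := ts [set e2; e4] y; pose a y := ts [set e2] y; pose d y := signed_minor [set e4] y.
transitivity (\sum_(y in affine F S4)
 (q * (q - 2) * (\sum_x \sum_t ((p y * x + s' y) * t + (t' y * x + a y) != 0)%R%:R)
  + q * (q - 1) * (\sum_x (p y * x + s' y != 0)%R%:R + \sum_x (p y * x + t' y != 0)%R%:R)
  + q ^+ 2 * \sum_x (s' y * x + a y != 0)%R%:R
  + q ^+ 2 * ((p y != 0)%R%:R + (s' y != 0)%R%:R - ((p y != 0%R) || (d y != 0%R))%:R
       - ((s' y != 0%R) || (d y != 0%R))%:R - (q - 2) * (d y != 0)%R%:R)) : int); last first.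
  rewrite !big_split /= -!mulr_sumr !big_split /= !sumrN -!mulr_sumr.
  congr (_ * _ + _ * (_ + _) + _ * _ + _ * _); apply: eq_bigr => y yS.
  - have [_ f12 _ f2 _] := yv yS; have /affineP y0 := yS.
    do 2! (apply: eq_bigr => ? _); rewrite tree_sum_upd ?inE ?eE4 // ?updE ?eE4 ?y0 //.
    by rewrite f12 f2.
  - by have [_ f12 _ _ _] := yv yS; apply: eq_bigr => x _; rewrite f12.
  - have /affineP y0 := yS; apply: eq_bigr => x _; rewrite tree_sum_upd ?y0 // ?inE ?eE4 //.
    by rewrite setUA.
  - have /affineP y0 := yS; apply: eq_bigr => x _; rewrite tree_sum_upd ?y0 // ?inE ?eE4 //.
apply: eq_bigr => y yS; have [E f12 f1 f2 f0] := yv yS.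
by rewrite -(triangle_nonzeros E); apply: eq_bigr => x _; rewrite f12 f1 f2 f0.
Qed.

End Triangle.

End Count.
End Star.

Section HasNonzero.
Variables (F : finFieldType) (n : nat) (x : 'rV[F]_n).
Implicit Types (p : {mpoly int[n]}) (fs : seq {mpoly int[n]}).

Lemma has_nonzero1 p a : eval_at p x = a -> has (fun p => eval_at p x != 0) [:: p] = (a != 0).
Proof. by move=> <- /=; rewrite orbF. Qed.

Lemma has_nonzero_cons p fs a b : eval_at p x = a ->
    has (fun p => eval_at p x != 0) fs = b ->
  has (fun p => eval_at p x != 0) (p :: fs) = (a != 0) || b.
Proof. by move=> <- <-. Qed.

End HasNonzero.

Section Assembly.
Variables (V : finType) (n : nat) (ends : 'I_n -> V * V) (v v0 : V) (e1 e2 e3 : 'I_n).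
Notation G := (whole_graph ends).
Notation X := (edge_vars n).
Notation r := #|[set~ v0]|.
Notation S := (~: [set e1; e2; e3]).
Notation Gv := (delete_verts [set v] G).
Hypothesis (simple : simple_graph G) (conn : vertex_connected 2 G).
Hypothesis (tv : three_valent G v e1 e2 e3) (vv0 : v0 != v) (r3 : (3 <= r)%N).
Implicit Types (A B T : {set 'I_n}).
Notation ts := (tree_sum ends).
Notation Psi A B := (graph_poly (minor G A B)).
Notation Psi_v A B := (graph_poly (minor Gv A B)).

Let eE := (three_valent_neq simple tv, eqxx).

Let sub_star B : B \subset [set e1; e2; e3] -> acyclic G B.
Proof. by move=> /acyclicS; apply; apply: acyclic_star tv. Qed.

Lemma acyclic_set0 : acyclic G set0. Proof. by apply: sub_star; apply: sub0set. Qed.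

Lemma graph_poly_1_23 : Psi [set e1] [set e2; e3] = ts [set e1] (zap [set e2; e3] X).
Proof.
apply: graph_poly_minor; first by rewrite disjoints1 !inE !eE.
by apply: sub_star; apply/subsetP=> e; rewrite !inE => /orP[] ->; rewrite ?orbT.
Qed.

Lemma graph_poly_2_13 : Psi [set e2] [set e1; e3] = ts [set e2] (zap [set e1; e3] X).
Proof.
apply: graph_poly_minor; first by rewrite disjoints1 !inE !eE.
by apply: sub_star; apply/subsetP=> e; rewrite !inE => /orP[] ->; rewrite ?orbT.
Qed.

Lemma graph_poly_3_12 : Psi [set e3] [set e1; e2] = ts [set e3] (zap [set e1; e2] X).
Proof.
apply: graph_poly_minor; first by rewrite disjoints1 !inE !eE.
by apply: sub_star; apply/subsetP=> e; rewrite !inE => /orP[] ->; rewrite ?orbT.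
Qed.

Lemma graph_poly_contract123 : Psi set0 [set e1; e2; e3] = ts set0 (zap [set e1; e2; e3] X).
Proof. by apply: graph_poly_minor; [rewrite -setI_eq0 set0I|apply: sub_star]. Qed.

Lemma graph_poly_contract3 : Psi set0 [set e3] = ts set0 (zap [set e3] X).
Proof. by apply: graph_poly_minor; [rewrite -setI_eq0 set0I|apply: acyclic_set1]. Qed.

Lemma graph_poly_v_123 : Psi_v [set e1; e2; e3] set0 = ts [set e1; e2] (zap [set e3] X).
Proof.
have := @graph_poly_minor_removed _ _ _ simple _ _ _ _ set0 set0 tv.
by rewrite !setU0; apply; rewrite -?setI_eq0 ?set0I //; apply: acyclic_set0.
Qed.

Section Field.
Variable F : finFieldType.
Implicit Type x : 'rV[F]_n.

Lemma eval_minor1 x : x \in affine F S -> eval_at (Psi [set e1] [set e2; e3]) x = ts [set e1] x.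
Proof.
move=> /affineP x0; rewrite graph_poly_1_23 eval_tree_sum // => e h; apply: x0.
by move: h; rewrite !inE negbK; case: (e == e1); case: (e == e2).
Qed.

Lemma eval_minor2 x : x \in affine F S -> eval_at (Psi [set e2] [set e1; e3]) x = ts [set e2] x.
Proof.
move=> /affineP x0; rewrite graph_poly_2_13 eval_tree_sum // => e h; apply: x0.
by move: h; rewrite !inE negbK; case: (e == e1); case: (e == e2).
Qed.

Lemma eval_minor123 x : x \in affine F S -> eval_at (Psi set0 [set e1; e2; e3]) x = ts set0 x.
Proof.
by move=> /affineP x0; rewrite graph_poly_contract123 eval_tree_sum // => e h; apply: x0; rewrite inE negbK.
Qed.

Lemma eval_minor_v x : x \in affine F S -> eval_at (Psi_v [set e1; e2; e3] set0) x = ts [set e1; e2] x.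
Proof.
move=> /affineP x0; rewrite graph_poly_v_123 eval_tree_sum // => e h; apply: x0.
by move: h; rewrite !inE negbK => ->; rewrite orbT.
Qed.

Lemma eval_contract3 x : x \in affine F (~: [set e3]) -> eval_at (Psi set0 [set e3]) x = ts set0 x.
Proof.
by move=> /affineP x0; rewrite graph_poly_contract3 eval_tree_sum // => e h; apply: x0; rewrite inE negbK.
Qed.

End Field.

Variable s : int.
Hypothesis s1 : s ^+ 2 = 1.
Hypothesis sD : forall (R : comNzRingType) A (x : 'rV[R]_n), [disjoint A & [set e1; e2; e3]] ->
      (s%:~R * tree_minor ends v0 e1 e2 A x) *+ 2 =
      ts (e1 |: A) x + ts (e2 |: A) x - ts (e3 |: A) x.

Lemma Nbar_star (F : finFieldType) : let q : rat := #|F|%:R in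
  Nbar F setT [:: graph_poly G] =
    q ^+ 3 * Nbar F S [:: Psi_v [set e1; e2; e3] set0; Psi [set e1] [set e2; e3];
                          Psi [set e2] [set e1; e3]; Psi set0 [set e1; e2; e3]]
    - q ^+ 2 * Nbar F S [:: Psi_v [set e1; e2; e3] set0; Psi [set e1] [set e2; e3];
                            Psi [set e2] [set e1; e3]].
Proof.
rewrite /= Nbar_graph_poly (count_star simple tv vv0 F s1 sD) sumrB -!mulr_sumr.
rewrite (@Nbar_count F n S _ (fun x => [|| ts [set e1; e2] x != 0, ts [set e1] x != 0,
    ts [set e2] x != 0 | ts set0 x != 0])) => [|x xS]; last first.
  apply: (has_nonzero_cons (eval_minor_v xS)); apply: (has_nonzero_cons (eval_minor1 xS)).
  by apply: (has_nonzero_cons (eval_minor2 xS)); apply: has_nonzero1 (eval_minor123 xS).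
rewrite (@Nbar_count F n S _ (fun x => [|| ts [set e1; e2] x != 0, ts [set e1] x != 0 |
    ts [set e2] x != 0])) => [|x xS]; last first.
  apply: (has_nonzero_cons (eval_minor_v xS)); apply: (has_nonzero_cons (eval_minor1 xS)).
  exact: has_nonzero1 (eval_minor2 xS).
rewrite /point_count rmorphB !rmorphM /= !rmorph_nat.
by ring.
Qed.

(* Delta for A empty and B = {e1, e2, e3}; delta for A = {e4} and B = {e1, ..., e4}. *)
Definition delta_poly A B : {mpoly int[n]} :=
  s%:~R * tree_minor ends v0 e1 e2 A (zap B X).

Lemma eval_delta_poly (F : finFieldType) A B (x : 'rV[F]_n) :
  eval_at (delta_poly A B) x = signed_minor ends v0 e1 e2 s A (zap B x).
Proof.
by rewrite eval_atE rmorphM rmorph_int rmorph_tree_minor map_eval_vars.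
Qed.

Notation Delta := (delta_poly set0 [set e1; e2; e3]).

Lemma Delta_tree_sum : Delta *+ 2 = ts [set e1] (zap [set e1; e2; e3] X)
  + ts [set e2] (zap [set e1; e2; e3] X) - ts [set e3] (zap [set e1; e2; e3] X).
Proof. by rewrite sD ?setU0 // -setI_eq0 set0I. Qed.

Lemma Delta_double : Delta *+ 2 = Psi [set e1] [set e2; e3] + Psi [set e2] [set e1; e3]
                      - Psi [set e3] [set e1; e2].
Proof.
rewrite Delta_tree_sum graph_poly_1_23 graph_poly_2_13 graph_poly_3_12.
congr (_ + _ - _); apply: tree_sum_eq => e; rewrite !inE !zapE !inE => /negPf->;
  by rewrite ?orbF ?orFb.
Qed.

Lemma tree_sum_vars A B (C : {set 'I_n}) : ~: (A :|: B) \subset C -> in_vars C (ts A (zap B X)).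
Proof. by move=> /subsetP h m /(tree_sum_in_vars (ends := ends)) H i /H/h. Qed.

Lemma Delta_vars : in_vars S Delta.
Proof.
apply: in_vars_half; rewrite Delta_tree_sum; apply: in_varsD; first apply: in_varsD.
- by apply: tree_sum_vars; rewrite setCS subsetUr.
- by apply: tree_sum_vars; rewrite setCS subsetUr.
- by apply: in_varsN; apply: tree_sum_vars; rewrite setCS subsetUr.
Qed.

Lemma Delta_homog : Delta \is (n - (r + 1)).-homog.
Proof.
apply: dhomog_half; rewrite Delta_tree_sum.
have H e : ts [set e] (zap [set e1; e2; e3] X) \is (n - (r + 1)).-homog.
  by have := tree_sum_homog ends v0 [set e] [set e1; e2; e3]; rewrite cards1.
by apply: rpredB (H e3); apply: rpredD (H e1) (H e2).
Qed.

Lemma rank_lt2 : (r + 1 < n)%N.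
Proof.
have [T [Tv Tt]] := tree_avoiding simple v conn.
have [_ inc _] := three_valentP simple tv.
have ve3 : v \in endset G e3 by rewrite inc !inE eqxx !orbT.
have TS : T \subset S by apply/subsetP=> e /Tv; rewrite inc in_setC.
have e3T : e3 \notin T by apply: contraTN ve3; apply: Tv.
have := subset_leq_card TS; rewrite -(spanning_tree_card v0 (Tt _ ve3)) cardsU1 e3T.
rewrite [#|S|]cardsCs setCK card_ord (_ : #|[set e1; e2; e3]| = 3%N).
  have : (#|[set e1; e2; e3]| <= n)%N by rewrite -[X in (_ <= X)%N]card_ord max_card.
  rewrite (_ : #|[set e1; e2; e3]| = 3%N); last by rewrite -setUA !cardsU1 cards1 !inE !eE.
  by move: #|T| => k; clear; lia.
by rewrite -setUA !cardsU1 cards1 !inE !eE.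
Qed.

Lemma Nbar_star_delta (F : finFieldType) : let q : rat := #|F|%:R in
  let Delta12 := Psi_v [set e1; e2; e3] set0 * 'X_e3 + Delta in
  Nbar F setT [:: graph_poly G] =
    q * Nbar F (~: [set e3]) [:: Psi set0 [set e3]]
    + q * Nbar F (~: [set e1; e2]) [:: Delta12] - q ^+ 2 * Nbar F S [:: Delta] /\
  congr_int (#|F| ^ 3) (Nbar F setT [:: graph_poly G])
    (q * Nbar F (~: [set e1; e2]) [:: Delta12]) /\
  congr_loc (#|F| ^ 3) (q * Nbar F (~: [set e1; e2]) [:: Delta12])
    (q ^+ 2 * Nbar F S [:: Psi_v [set e1; e2; e3] set0; Delta]).
Proof.
move=> q Delta12; pose h := @signed_minor V n ends v0 e1 e2 F s.
have zapS x : x \in affine F S -> zap [set e1; e2; e3] x = x.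
  move=> /affineP x0; apply/rowP=> i; rewrite zapE; case: ifP => // iS.
  by rewrite x0 // inE negbK.
have N12 : Nbar F (~: [set e1; e2]) [:: Delta12] =
    (point_count (~: [set e1; e2]) (fun x : 'rV[F]_n =>
          ts [set e1; e2] (zap [set e3] x) * x 0 e3 + h set0 (zap [set e1; e2; e3] x) != 0))%:~R
    / (q - 1).
  apply: Nbar_count => x _; apply: has_nonzero1.
  rewrite eval_atE rmorphD rmorphM -!eval_atE eval_delta_poly; congr (_ * _ + _).
    by rewrite graph_poly_v_123 eval_atE rmorph_tree_sum map_eval_vars.
  exact: eval_edge_vars.
have N3 : Nbar F (~: [set e3]) [:: Psi set0 [set e3]] =
    (point_count (~: [set e3]) (fun x : 'rV[F]_n => ts set0 x != 0))%:~R / (q - 1).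
  by apply: Nbar_count => x xS; apply: has_nonzero1 (eval_contract3 xS).
have ND : Nbar F S [:: Delta] =
    (point_count S (fun x : 'rV[F]_n => h set0 x != 0))%:~R / (q - 1).
  by apply: Nbar_count => x xS; apply: has_nonzero1; rewrite eval_delta_poly zapS.
have E : Nbar F setT [:: graph_poly G] =
    q * Nbar F (~: [set e3]) [:: Psi set0 [set e3]]
    + q * Nbar F (~: [set e1; e2]) [:: Delta12] - q ^+ 2 * Nbar F S [:: Delta].
  rewrite Nbar_graph_poly (count_star_contract simple tv vv0 F s1 sD) N12 N3 ND.
  rewrite -/h rmorphB rmorphD !rmorphM /= !rmorph_nat -/q.
  by ring.
have natq k : ((#|F| ^ k)%N%:Z)%:~R = q ^+ k :> rat.
  by rewrite -natz natrX rmorphXn /= rmorph_nat.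
split=> //; split.
  have [|||w3 W3] := @Nbar_int F n (~: [set e3]) (Psi set0 [set e3]) (n - (r + 0)) 2.
  - by rewrite subn_gt0 addn0; apply: leq_trans rank_lt2; rewrite addn1.
  - by rewrite graph_poly_contract3; have := tree_sum_homog ends v0 set0 [set e3]; rewrite cards0.
  - rewrite (@eq_point_count _ _ _ _ (fun x : 'rV[F]_n => ts set0 x != 0)) => [|x xS]; last first.
      by rewrite /= eval_contract3.
    apply: (@dvd_count V n ends v0 F set0); first by rewrite -setI_eq0 set0I.
    by rewrite set0U setCK cards1.
  have [|||wD WD] := @Nbar_int F n S Delta (n - (r + 1)) 1.
  - by rewrite subn_gt0 rank_lt2.
  - exact: Delta_homog.
  - rewrite (@eq_point_count _ _ _ _ (fun x : 'rV[F]_n => tree_minor ends v0 e1 e2 set0 x != 0)) => [|x xS]; last first.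
      rewrite /= eval_delta_poly zapS // /signed_minor -sqrf_eq0 exprMn -rmorphXn /= s1 mul1r.
      by rewrite sqrf_eq0.
    rewrite expr1; apply: (@dvd_count_minor V n ends v0 F); rewrite ?eE ?set0U ?setCK //.
    + by rewrite !inE eqxx.
    + by rewrite !inE eqxx orbT.
    + by rewrite -setI_eq0 set0I.
    + by rewrite -setUA !cardsU1 cards1 !inE !eE.
  exists (w3 - wD); rewrite E W3 WD [RHS]rmorphM [X in _ = _ * X]rmorphB /= natq.
  by rewrite expr1 !rmorphM /= !rmorph_nat -/q; ring.
exists (#|F|.-1); have := @dvd_count V n ends v0 F [set e1; e2] S.
have -> : [disjoint [set e1; e2] & S].
  rewrite disjoints_subset setCK; apply/subsetP=> e; rewrite !inE => -> //.
rewrite (_ : ~: ([set e1; e2] :|: S) = [set e3]); last first.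
  apply/setP=> e; rewrite !inE; case: (eqVneq e e3) => [->|_]; rewrite ?eE //.
  by case: (e == e1); case: (e == e2).
rewrite cards1 => /(_ isT r3)/dvdz_mul_ex[w Ew].
exists (- w); split.
  by rewrite coprimeXr // coprimePn // ltnW // card_field_gt1.
have Nf : Nbar F S [:: Psi_v [set e1; e2; e3] set0; Delta] =
    (point_count S (fun x : 'rV[F]_n => (ts [set e1; e2] x != 0) || (h set0 x != 0)))%:~R / (q - 1).
  apply: Nbar_count => x xS; apply: (has_nonzero_cons (eval_minor_v xS)); apply: has_nonzero1.
  by rewrite eval_delta_poly zapS.
have q1 : q - 1 != 0 := card_field_neq1 F.
have Ew' : point_count S (fun x : 'rV[F]_n => ts [set e1; e2] x != 0) = #|F|%:R ^+ 2 * w := Ew.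
have -> : (#|F|.-1)%:R = q - 1 :> rat.
  by rewrite /q -[X in X%:R - 1](prednK (ltnW (card_field_gt1 F))) -natr1 addrK.
rewrite N12 (count_signed_minor v0 simple tv F s) -/h Ew' Nf.
rewrite [RHS]rmorphM rmorphN /= natq rmorphB !rmorphM /= !rmorph_nat -/q.
by field.
Qed.

Section Triangle.
Variable e4 : 'I_n.
Hypothesis tri : triangle G e2 e3 e4.
Notation S4 := (~: [set e1; e2; e3; e4]).

Let v4 : v \notin endset G e4 := triangle_notin_endset simple tv tri.
Let e4n : e4 \notin [set e1; e2; e3].
Proof. by have [_ <- _] := three_valentP simple tv. Qed.
Let e41 : (e4 == e1) = false. Proof. by move: e4n; rewrite !inE => /norP[/norP[/negPf]]. Qed.
Let e42 : (e4 == e2) = false. Proof. by move: e4n; rewrite !inE => /norP[/norP[_ /negPf]]. Qed.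
Let e43 : (e4 == e3) = false. Proof. by move: e4n; rewrite !inE => /norP[_ /negPf]. Qed.
Let e14 : (e1 == e4) = false. Proof. by rewrite eq_sym. Qed.
Let e24 : (e2 == e4) = false. Proof. by rewrite eq_sym. Qed.
Let e34 : (e3 == e4) = false. Proof. by rewrite eq_sym. Qed.
Let eE4 := (three_valent_neq simple tv, e41, e42, e43, e14, e24, e34, eqxx).

Let dis4 : [disjoint [set e4] & [set e1; e2; e3]].
Proof. by rewrite disjoints1. Qed.

Lemma acyclic34 : acyclic G [set e3; e4].
Proof.
have [_ inc _] := three_valentP simple tv.
have /(neighbour simple)[u uv E] : v \in endset G e3 by rewrite inc !inE eqxx !orbT.
rewrite (@acyclic_leaf _ _ _ v u) //; first exact: acyclic_set1.
by move=> f /set1P ->.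
Qed.

Lemma graph_poly_v_1234 : Psi_v [set e1; e2; e3; e4] set0 = ts [set e1; e2; e4] (zap [set e3] X).
Proof.
have := @graph_poly_minor_removed _ _ _ simple _ _ _ _ [set e4] set0 tv dis4.
by rewrite !setU0; apply; rewrite -?setI_eq0 ?set0I ?setI0 //; apply: acyclic_set0.
Qed.

Lemma graph_poly_v_123_4 : Psi_v [set e1; e2; e3] [set e4] = ts [set e1; e2] (zap [set e3; e4] X).
Proof.
have := @graph_poly_minor_removed _ _ _ simple _ _ _ _ set0 [set e4] tv.
by rewrite !setU0; apply; rewrite -?setI_eq0 ?set0I // ?setI_eq0 //; apply: acyclic_set1.
Qed.

Lemma graph_poly_24_13 : Psi [set e2; e4] [set e1; e3] = ts [set e2; e4] (zap [set e1; e3] X).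
Proof.
apply: graph_poly_minor; first by rewrite disjoints2 !inE !eE4.
by apply: sub_star; apply/subsetP=> e; rewrite !inE => /orP[] ->; rewrite ?orbT.
Qed.

Lemma graph_poly_34_12 : Psi [set e3; e4] [set e1; e2] = ts [set e3; e4] (zap [set e1; e2] X).
Proof.
apply: graph_poly_minor; first by rewrite disjoints2 !inE !eE4.
by apply: sub_star; apply/subsetP=> e; rewrite !inE => /orP[] ->; rewrite ?orbT.
Qed.

Lemma graph_poly_2_3 : Psi [set e2] [set e3] = ts [set e2] (zap [set e3] X).
Proof.
by apply: graph_poly_minor; [rewrite disjoints1 !inE !eE4|apply: acyclic_set1].
Qed.

Lemma graph_poly_24_3 : Psi [set e2; e4] [set e3] = ts [set e2; e4] (zap [set e3] X).
Proof.
by apply: graph_poly_minor; [rewrite disjoints2 !inE !eE4|apply: acyclic_set1].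
Qed.

Lemma graph_poly_2_34 : Psi [set e2] [set e3; e4] = ts [set e2] (zap [set e3; e4] X).
Proof.
by apply: graph_poly_minor; [rewrite disjoints1 !inE !eE4|apply: acyclic34].
Qed.

Notation delta := (delta_poly [set e4] [set e1; e2; e3; e4]).

Lemma delta_tree_sum : delta *+ 2 =
  ts [set e1; e4] (zap [set e1; e2; e3; e4] X) + ts [set e2; e4] (zap [set e1; e2; e3; e4] X)
  - ts [set e3; e4] (zap [set e1; e2; e3; e4] X).
Proof. by rewrite sD. Qed.

Lemma delta_double : delta *+ 2 = Psi_v [set e1; e2; e3] [set e4]
  + Psi [set e2; e4] [set e1; e3] - Psi [set e3; e4] [set e1; e2].
Proof.
rewrite delta_tree_sum graph_poly_v_123_4 graph_poly_24_13 graph_poly_34_12.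
rewrite -(triangle_swap12 simple tv tri) => [|e eZ]; last by rewrite zapE eZ.
congr (_ + _ - _); apply: tree_sum_eq => e; rewrite !inE !zapE !inE negb_or => /andP[/negPf-> /negPf->];
  by rewrite ?orbF ?orFb.
Qed.

Lemma delta_vars : in_vars S4 delta.
Proof.
apply: in_vars_half; rewrite delta_tree_sum; apply: in_varsD; first apply: in_varsD.
- by apply: tree_sum_vars; rewrite setCS subsetUr.
- by apply: tree_sum_vars; rewrite setCS subsetUr.
- by apply: in_varsN; apply: tree_sum_vars; rewrite setCS subsetUr.
Qed.

Lemma Nbar_triangle (F : finFieldType) : let q : rat := #|F|%:R in
  Nbar F setT [:: graph_poly G] =
    q * (q - 2) * Nbar F (~: [set e2; e3]) [:: Psi [set e2] [set e3]]
    + q * (q - 1) * (Nbar F S [:: Psi_v [set e1; e2; e3] set0]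
         + Nbar F (~: [set e2; e3; e4]) [:: Psi [set e2; e4] [set e3]])
    + q ^+ 2 * Nbar F (~: [set e2; e3; e4]) [:: Psi [set e2] [set e3; e4]]
    + q ^+ 2 * (Nbar F S4 [:: Psi_v [set e1; e2; e3; e4] set0]
         + Nbar F S4 [:: Psi_v [set e1; e2; e3] [set e4]]
         - Nbar F S4 [:: Psi_v [set e1; e2; e3; e4] set0; delta]
         - Nbar F S4 [:: Psi_v [set e1; e2; e3] [set e4]; delta]
         - (q - 2) * Nbar F S4 [:: delta]).
Proof.
move=> q; pose h := @signed_minor V n ends v0 e1 e2 F s [set e4].
have val A B C (x : 'rV[F]_n) : x \in affine F (~: C) -> B \subset C ->
    eval_at (ts A (zap B X)) x = ts A x.
  move=> /affineP x0 /subsetP BC; apply: eval_tree_sum => e /BC eC.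
  by apply: x0; rewrite inE negbK.
have sub3_4 : [set e3] \subset [set e1; e2; e3; e4].
  by apply/subsetP=> e; rewrite !inE => ->; rewrite !orbT.
have sub34_4 : [set e3; e4] \subset [set e1; e2; e3; e4].
  by apply/subsetP=> e; rewrite !inE => /orP[] ->; rewrite !orbT.
have sub3_234 : [set e3] \subset [set e2; e3; e4].
  by apply/subsetP=> e; rewrite !inE => ->; rewrite !orbT.
have sub34_234 : [set e3; e4] \subset [set e2; e3; e4].
  by apply/subsetP=> e; rewrite !inE => /orP[] ->; rewrite !orbT.
have sub3_23 : [set e3] \subset [set e2; e3] by apply: subsetUr.
have vd x : x \in affine F S4 -> eval_at delta x = h x.
  move=> /affineP x0; rewrite eval_delta_poly; congr signed_minor.
  by apply/rowP=> i; rewrite zapE; case: ifP => // iS; rewrite x0 // inE negbK.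
have vp x : x \in affine F S4 ->
    eval_at (Psi_v [set e1; e2; e3; e4] set0) x = ts [set e1; e2; e4] x.
  by move=> xS; rewrite graph_poly_v_1234; apply: val sub3_4.
have vs x : x \in affine F S4 -> eval_at (Psi_v [set e1; e2; e3] [set e4]) x = ts [set e1; e2] x.
  by move=> xS; rewrite graph_poly_v_123_4; apply: val sub34_4.
have N1 : Nbar F (~: [set e2; e3]) [:: Psi [set e2] [set e3]] =
    (point_count (~: [set e2; e3]) (fun x : 'rV[F]_n => ts [set e2] x != 0))%:~R / (q - 1).
  by apply: Nbar_count => x xS; apply: has_nonzero1; rewrite graph_poly_2_3; apply: val sub3_23.
have N2 : Nbar F S [:: Psi_v [set e1; e2; e3] set0] =
    (point_count S (fun x : 'rV[F]_n => ts [set e1; e2] x != 0))%:~R / (q - 1).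
  by apply: Nbar_count => x xS; apply: has_nonzero1 (eval_minor_v xS).
have N3 : Nbar F (~: [set e2; e3; e4]) [:: Psi [set e2; e4] [set e3]] =
    (point_count (~: [set e2; e3; e4]) (fun x : 'rV[F]_n => ts [set e2; e4] x != 0))%:~R / (q - 1).
  by apply: Nbar_count => x xS; apply: has_nonzero1; rewrite graph_poly_24_3; apply: val sub3_234.
have N4 : Nbar F (~: [set e2; e3; e4]) [:: Psi [set e2] [set e3; e4]] =
    (point_count (~: [set e2; e3; e4]) (fun x : 'rV[F]_n => ts [set e2] x != 0))%:~R / (q - 1).
  by apply: Nbar_count => x xS; apply: has_nonzero1; rewrite graph_poly_2_34; apply: val sub34_234.
have N5 : Nbar F S4 [:: Psi_v [set e1; e2; e3; e4] set0] =
    (point_count S4 (fun x : 'rV[F]_n => ts [set e1; e2; e4] x != 0))%:~R / (q - 1).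
  by apply: Nbar_count => x xS; apply: has_nonzero1 (vp x xS).
have N6 : Nbar F S4 [:: Psi_v [set e1; e2; e3] [set e4]] =
    (point_count S4 (fun x : 'rV[F]_n => ts [set e1; e2] x != 0))%:~R / (q - 1).
  by apply: Nbar_count => x xS; apply: has_nonzero1 (vs x xS).
have N7 : Nbar F S4 [:: Psi_v [set e1; e2; e3; e4] set0; delta] =
    (point_count S4 (fun x : 'rV[F]_n => (ts [set e1; e2; e4] x != 0) || (h x != 0)))%:~R / (q - 1).
  apply: Nbar_count => x xS; apply: (has_nonzero_cons (vp x xS)).
  exact: has_nonzero1 (vd x xS).
have N8 : Nbar F S4 [:: Psi_v [set e1; e2; e3] [set e4]; delta] =
    (point_count S4 (fun x : 'rV[F]_n => (ts [set e1; e2] x != 0) || (h x != 0)))%:~R / (q - 1).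
  apply: Nbar_count => x xS; apply: (has_nonzero_cons (vs x xS)).
  exact: has_nonzero1 (vd x xS).
have N9 : Nbar F S4 [:: delta] =
    (point_count S4 (fun x : 'rV[F]_n => h x != 0))%:~R / (q - 1).
  by apply: Nbar_count => x xS; apply: has_nonzero1 (vd x xS).
rewrite Nbar_graph_poly (count_triangle simple tv vv0 F s1 sD tri) N1 N2 N3 N4 N5 N6 N7 N8 N9 -/h.
rewrite !(rmorphD, rmorphB, rmorphM) /= !rmorph_nat -/q.
by ring.
Qed.

End Triangle.

End Assembly.

Theorem theorem1 (V : finType) (n : nat) (ends : 'I_n -> V * V) :
  let G := whole_graph ends in
  simple_graph G -> vertex_connected 2 G ->
  (* (i) *)
  ((exists C : rat, forall F : finFieldType,
      `|Nbar F setT [:: graph_poly G] - #|F|%:R ^+ (n - 1)|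
        <= C * #|F|%:R ^+ (n - 3)) /\
   (forall F : finFieldType,
      congr_int (#|F| ^ 2) (Nbar F setT [:: graph_poly G]) 0)) /\
  (forall (v : V) (e1 e2 e3 : 'I_n), three_valent G v e1 e2 e3 ->
     let G_v := delete_verts [set v] G in
     let Psi A B := graph_poly (minor G A B) in
     (* used when A contains e1, e2, e3: the isolated vertex v is dropped *)
     let Psi_v A B := graph_poly (minor G_v A B) in
     let S := ~: [set e1; e2; e3] in
     (* (ii) *)
     ((forall F : finFieldType, let q : rat := #|F|%:R in
         Nbar F setT [:: graph_poly G] =
           q ^+ 3 * Nbar F S [:: Psi_v [set e1; e2; e3] set0;
                                 Psi [set e1] [set e2; e3];
                                 Psi [set e2] [set e1; e3];
                                 Psi set0 [set e1; e2; e3]]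
           - q ^+ 2 * Nbar F S [:: Psi_v [set e1; e2; e3] set0;
                                   Psi [set e1] [set e2; e3];
                                   Psi [set e2] [set e1; e3]]) /\
      (exists Delta : {mpoly int[n]},
         Delta *+ 2 = Psi [set e1] [set e2; e3] + Psi [set e2] [set e1; e3]
                      - Psi [set e3] [set e1; e2] /\
         in_vars S Delta /\
         let Delta12 := Psi_v [set e1; e2; e3] set0 * 'X_e3 + Delta in
         forall F : finFieldType, let q : rat := #|F|%:R in
           Nbar F setT [:: graph_poly G] =
             q * Nbar F (~: [set e3]) [:: Psi set0 [set e3]]
             + q * Nbar F (~: [set e1; e2]) [:: Delta12]
             - q ^+ 2 * Nbar F S [:: Delta] /\
           congr_int (#|F| ^ 3) (Nbar F setT [:: graph_poly G])
             (q * Nbar F (~: [set e1; e2]) [:: Delta12]) /\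
           congr_loc (#|F| ^ 3)
             (q * Nbar F (~: [set e1; e2]) [:: Delta12])
             (q ^+ 2 * Nbar F S [:: Psi_v [set e1; e2; e3] set0; Delta]))) /\
     (* (iii) *)
     (forall e4 : 'I_n, triangle G e2 e3 e4 ->
        let S4 := ~: [set e1; e2; e3; e4] in
        exists delta : {mpoly int[n]},
          delta *+ 2 = Psi_v [set e1; e2; e3] [set e4]
                       + Psi [set e2; e4] [set e1; e3]
                       - Psi [set e3; e4] [set e1; e2] /\
          in_vars S4 delta /\
          forall F : finFieldType, let q : rat := #|F|%:R in
            Nbar F setT [:: graph_poly G] =
              q * (q - 2) * Nbar F (~: [set e2; e3]) [:: Psi [set e2] [set e3]]
              + q * (q - 1)
                * (Nbar F S [:: Psi_v [set e1; e2; e3] set0]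
                   + Nbar F (~: [set e2; e3; e4])
                       [:: Psi [set e2; e4] [set e3]])
              + q ^+ 2 * Nbar F (~: [set e2; e3; e4])
                           [:: Psi [set e2] [set e3; e4]]
              + q ^+ 2
                * (Nbar F S4 [:: Psi_v [set e1; e2; e3; e4] set0]
                   + Nbar F S4 [:: Psi_v [set e1; e2; e3] [set e4]]
                   - Nbar F S4 [:: Psi_v [set e1; e2; e3; e4] set0; delta]
                   - Nbar F S4 [:: Psi_v [set e1; e2; e3] [set e4]; delta]
                   - (q - 2) * Nbar F S4 [:: delta]))).
Proof.
move=> G simple conn.
have [v0 _] : exists v0 : V, v0 \in [set: V].
  by apply/set0Pn; rewrite -card_gt0; have [c _] := conn; apply: leq_trans c.
split; [split|].
- by exists (2 * n%:R ^+ 2) => F; apply: Nbar_graph_poly_bound.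
- by move=> F; apply: Nbar_graph_poly_congr.
move=> v e1 e2 e3 tv G_v Psi Psi_v S.
have [_ _ [u1 [u2 [u3 [[u1v u2v u3v] [u12 u13 u23] _]]]]] := three_valentP simple tv.
have vu1 : v != u1 by rewrite eq_sym.
have r3 : (3 <= #|[set~ u1]|)%N.
  have <- : #|[set v; u2; u3]| = 3%N.
    by rewrite -setUA !cardsU1 cards1 !inE negb_or ![v == _]eq_sym u2v u3v u23.
  apply: subset_leq_card; apply/subsetP=> w; rewrite !inE => /orP[/orP[]|] /eqP-> //.
    by rewrite eq_sym.
  by rewrite eq_sym.
have [s [s1 sD]] := three_valent_minor simple vu1 tv.
split; [split|].
- by move=> F; apply: (Nbar_star simple tv u1v s1 sD).
- exists (delta_poly ends u1 e1 e2 s set0 [set e1; e2; e3]); split; [|split].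
  + exact: (Delta_double simple tv sD).
  + exact: (Delta_vars sD).
  + by move=> Delta12 F q; apply: (Nbar_star_delta simple conn tv u1v r3 s1 sD).
move=> e4 tri S4; exists (delta_poly ends u1 e1 e2 s [set e4] [set e1; e2; e3; e4]); split; [|split].
- exact: (delta_double simple tv sD tri).
- exact: (delta_vars simple tv sD tri).
- by move=> F q; apply: (Nbar_triangle simple tv u1v s1 sD tri).
Qed.
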